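(* The set $S^*[\mathbf Y^2(\Omega;E)]$ consists precisely of all positive measures $\mu\in\mathcal M^+(\overline{\Omega\times Z\times\mathbb B_E})$ satisfying the following property: for all $\varphi\in C(\overline\Omega)$ and all $g\in C(Z)$, $$\int_{\overline{\Omega\times Z\times\mathbb B_E}}\varphi(x)g(\xi)(1-|\hat z|)\,d\mu(x,\xi,\hat z)=\int_\Omega\varphi(x)\,dx\int_Zg(\xi)\,d\xi.$$
   Context: $\Omega\subset\mathbb R^d$ is open and bounded with $\mathscr L^d(\partial\Omega)=0$; $Z=\mathbb T^d=\mathbb R^d/\mathbb Z^d$ with Lebesgue measure $d\xi$; $E$ is a finite-dimensional Euclidean space with open unit ball $\mathbb B_E$. A two-scale* Young measure is a four-tuple $\boldsymbol\nu=(\nu,\lambda,\rho,\nu^\infty)$ where: (i) $(x,\xi)\mapsto\nu_{x,\xi}$ is a weak-* measurable (w.r.t. Lebesgue measure) map from $\overline\Omega\times Z$ to $\mathrm{Prob}(E)$ with $(x,\xi)\mapsto\int_E|z|\,d\nu_{x,\xi}(z)$ integrable; (ii) $\lambda$ is a bounded positive measure on $\overline\Omega$; (iii) $x\mapsto\rho_x$ is a weak-* $\lambda$-measurable map from $\overline\Omega$ to $\mathrm{Prob}(Z)$; (iv) $(x,\xi)\mapsto\nu^\infty_{x,\xi}$ is a weak-* $(\lambda\otimes\rho_x)$-measurable map from $\overline\Omega\times Z$ to $\mathrm{Prob}(\partial\mathbb B_E)$. The set of these is $\mathbf Y^2(\Omega;E)$. For $f\in C(\Omega\times Z\times E)$ put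 $(Tf)(x,\xi,\hat z)=(1-|\hat z|)f(x,\xi,\hat z/(1-|\hat z|))$. $\mathbf E^2(\Omega;E)$ is the Banach space of those $f$ for which $Tf$ extends continuously to $\overline{\Omega\times Z\times\mathbb B_E}$, with norm $\|Tf\|_\infty$; for such $f$, $f^\infty(x,\xi,z)=\lim_{x'\to x,\xi'\to\xi,t\to\infty}f(x',\xi',tz)/t$ exists. $T:\mathbf E^2(\Omega;E)\to C(\overline{\Omega\times Z\times\mathbb B_E})$ is an isometric isomorphism with inverse $(Sg)(x,\xi,z)=(1+|z|)g(x,\xi,z/(1+|z|))$. $\boldsymbol\nu\in\mathbf Y^2(\Omega;E)$ is identified with the element of $\mathbf E^2(\Omega;E)^*$ given by $$\langle\!\langle f,\boldsymbol\nu\rangle\!\rangle=\int_\Omega\int_Z\Big(\int_Ef(x,\xi,\cdot)\,d\nu_{x,\xi}\Big)d\xi\,dx+\int_{\overline\Omega}\int_Z\Big(\int_{\partial\mathbb B_E}f^\infty(x,\xi,\cdot)\,d\nu^\infty_{x,\xi}\Big)d\rho_x(\xi)\,d\lambda(x).$$ $S^*\boldsymbol\nu\in\mathcal M(\overline{\Omega\times Z\times\mathbb B_E})$ is the measure determined by $\int g\,d(S^*\boldsymbol\nu)=\langle\!\langle Sg,\boldsymbol\nu\rangle\!\rangle$ for all $g\in C(\overline{\Omega\times Z\times\mathbb B_E})$. *)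

(* Defs.v *)
From HB Require Import structures.
From mathcomp Require Import all_boot all_order all_algebra.
From mathcomp Require Import all_classical all_reals all_analysis.
From mathcomp Require Import measurable_realfun.

Set Implicit Arguments.
Unset Strict Implicit.
Unset Printing Implicit Defensive.

Import Order.TTheory GRing.Theory Num.Theory.
Import numFieldNormedType.Exports.

Local Open Scope classical_set_scope.
Local Open Scope ring_scope.

Notation borel T := (g_sigma_algebraType (@open T)).

Definition frontier (T : topologicalType) (A : set T) : set T :=
  closure A `\` A°.

Lemma borel_open (T : ptopologicalType) (A : set T) :
  open A -> measurable (A : set (borel T)).
Proof. exact: sub_sigma_algebra. Qed.

Lemma continuous_measurable_borel (S T : ptopologicalType) (f : S -> T) :
  continuous f -> measurable_fun [set: borel S] (f : borel S -> borel T).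
Proof.
move=> /continuousP fc.
apply: (@measurability _ _ (borel S) (borel T) setT f open) => //.
by move=> _ [U oU <-]; rewrite setTI; apply: borel_open; exact: fc.
Qed.

Section lebesgue.
Context {R : realType}.

Definition cons_rV n (p : measurableTypeR R * borel 'rV[R]_n) :
    borel 'rV[R]_n.+1 :=
  row_mx (const_mx p.1 : 'rV[R]_1) p.2.

Definition uncons_rV n (v : borel 'rV[R]_n.+1) :
    measurableTypeR R * borel 'rV[R]_n :=
  (v 0 0, \row_j v 0 (lift 0 j)).

Lemma cons_rV0 n p : @cons_rV n p 0 0 = p.1.
Proof.
rewrite /cons_rV mxE; case: splitP => // k _.
by rewrite mxE.
Qed.

Lemma cons_rVS n p j : @cons_rV n p 0 (lift 0 j) = p.2 0 j.
Proof.
rewrite /cons_rV mxE; case: splitP => k /=.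
  by rewrite ord1 /= /bump /= add1n.
by rewrite /bump /= !add1n => -[/val_inj ->].
Qed.

Lemma cons_rVK n : cancel (@cons_rV n) (@uncons_rV n).
Proof.
move=> [t v]; rewrite /uncons_rV cons_rV0/=; congr pair.
by apply/rowP => j; rewrite mxE cons_rVS.
Qed.

Lemma uncons_rVK n : cancel (@uncons_rV n) (@cons_rV n).
Proof.
move=> v; apply/rowP => j; case: (unliftP 0 j) => [k|] ->.
  by rewrite cons_rVS mxE.
by rewrite cons_rV0.
Qed.

Lemma measurable_cons_rV n :
  measurable_fun [set: measurableTypeR R * borel 'rV[R]_n] (@cons_rV n).
Proof.
apply: (@measurability _ _ _ (borel 'rV[R]_n.+1) setT _ open) => //.
move=> _ [U oU <-]; rewrite setTI.
pose B (q : 'rV[rat]_n.+1 * nat) : set 'rV[R]_n.+1 :=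
  ball (map_mx ratr q.1 : 'rV[R]_n.+1) q.2.+1%:R^-1.
have -> : U = \bigcup_(q in [set q | B q `<=` U]) B q.
  apply/seteqP; split=> [x Ux|x [q /= qU Bqx]]; last exact: qU.
  have /nbhs_ballP[e /= e0 eU] : nbhs x U by exact: open_nbhs_nbhs.
  have [k ke] : exists k, k.+1%:R^-1 < e / 2.
    have e2 : 0 < e / 2 by rewrite divr_gt0.
    have [k _ Hk] := near_infty_natSinv_lt (PosNum e2).
    by exists k; exact: Hk (leqnn k).
  have k0 : 0 < k.+1%:R^-1 :> R by rewrite invr_gt0.
  have /choice[q qx] j : exists q : rat, ball (x 0 j) k.+1%:R^-1 (ratr q).
    have /rat_in_itvoo[q] : x 0 j - k.+1%:R^-1 < x 0 j + k.+1%:R^-1.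
      by rewrite ltrBlDr -addrA ltrDl addr_gt0.
    rewrite in_itv/= => /andP[q1 q2]; exists q.
    by rewrite /ball/= ltr_distlC q1 q2.
  have Bx : ball (map_mx ratr (\row_j q j) : 'rV[R]_n.+1) k.+1%:R^-1 x.
    by split=> // i j; rewrite ord1 !mxE; exact/ball_sym/qx.
  exists (\row_j q j, k) => //= y By; apply: eU.
  rewrite (splitr e); apply: (@ball_triangle _ _ (map_mx ratr (\row_j q j) : 'rV[R]_n.+1)).
    exact/(le_ball (ltW ke))/ball_sym.
  exact: (le_ball (ltW ke)).
rewrite preimage_bigcup bigcup_mkcond; apply: countable_bigcupT_measurable.
  exact: countableP.
move=> q; case: ifPn => _; last exact: measurable0.
have -> : @cons_rV n @^-1` B q =
    ball (ratr (q.1 0 0) : R) q.2.+1%:R^-1 `*`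
    ball (map_mx ratr (\row_j q.1 0 (lift 0 j)) : 'rV[R]_n) q.2.+1%:R^-1.
  apply/seteqP; split=> [p [q0 Bp]|p [/= Bp1 [q0 Bp2]]].
    split=> /=; first by have := Bp 0 0; rewrite mxE cons_rV0.
    split=> // i j; rewrite ord1 !mxE.
    by have := Bp 0 (lift 0 j); rewrite mxE cons_rVS.
  split=> // i j; rewrite ord1 mxE; case: (unliftP 0 j) => [k|] ->.
    by rewrite cons_rVS; have := Bp2 0 k; rewrite !mxE.
  by rewrite cons_rV0.
apply: measurableX; first by apply: open_measurable; exact: ball_open.
apply: (@borel_open 'rV[R]_n).
exact: ball_open.
Qed.

Lemma measurable_coord n (i : 'I_n) :
  measurable_fun [set: borel 'rV[R]_n]
    (fun x : borel 'rV[R]_n => x 0 i : measurableTypeR R).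
Proof.
apply: (@measurability _ _ (borel 'rV[R]_n) (measurableTypeR R) setT _ _
    (RGenOpens.measurableE R)).
move=> _ [_ [a [b ->]] <-]; rewrite setTI; apply: borel_open.
apply: open_comp => [x _|]; last exact: interval_open.
exact: coord_continuous.
Qed.

Definition box n (a b : 'rV[R]_n) : set (borel 'rV[R]_n) :=
  [set x | forall i, x 0 i \in `[a 0 i, b 0 i[].

Lemma measurable_box n (a b : 'rV[R]_n) : measurable (box a b).
Proof.
rewrite (_ : box a b = \bigcap_(i in [set: 'I_n])
    (fun x : borel 'rV[R]_n => x 0 i) @^-1` `[a 0 i, b 0 i[%classic).
  apply: fin_bigcap_measurable => // i _.
  by rewrite -[X in measurable X]setTI; exact: measurable_coord.
by apply/seteqP; split=> x /= xab i; [move=> _|]; exact: xab.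
Qed.

Lemma measurable_uncons_rV n :
  measurable_fun [set: borel 'rV[R]_n.+1] (@uncons_rV n).
Proof.
apply/measurable_fun_pair.
  exact: measurable_coord.
apply: continuous_measurable_borel => v.
move=> U /nbhs_ballP[e /= e0 eU]; have := nbhsx_ballx v e e0.
apply: (@filterS _ (nbhs v)) => w [_ vw]; apply: eU; split=> // i j.
rewrite ord1 !mxE; exact: vw.
Qed.

HB.instance Definition _ n := isMeasurableFun.Build _ _ _ _ (@cons_rV n)
  (@measurable_cons_rV n).

Section succ.
Variables (n : nat) (m : {sigma_finite_measure set (borel 'rV[R]_n) -> \bar R}).
Local Open Scope ereal_scope.

Definition lebesgue_succ : set (borel 'rV[R]_n.+1) -> \bar R :=
  pushforward (lebesgue_measure \x m) (@cons_rV n).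

Let lebesgue_succ0 : lebesgue_succ set0 = 0.
Proof. exact: measure0. Qed.

Let lebesgue_succ_ge0 A : 0 <= lebesgue_succ A.
Proof. exact: measure_ge0. Qed.

Let lebesgue_succ_sigma_additive : semi_sigma_additive lebesgue_succ.
Proof. exact: measure_semi_sigma_additive. Qed.

HB.instance Definition _ := isMeasure.Build _ _ _ lebesgue_succ
  lebesgue_succ0 lebesgue_succ_ge0 lebesgue_succ_sigma_additive.

Let lebesgue_succ_sigma_finite : sigma_finite setT lebesgue_succ.
Proof.
have /sigma_finiteP[F [FT Fnd Foo]] := sigma_finiteT (@lebesgue_measure R).
have /sigma_finiteP[G [GT Gnd Goo]] := sigma_finiteT m.
exists (fun k => @uncons_rV n @^-1` (F k `*` G k)).
  apply/seteqP; split=> // v _.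
  have [i _ Fi] : (\bigcup_i F i) (uncons_rV v).1 by rewrite -FT.
  have [j _ Gj] : (\bigcup_j G j) (uncons_rV v).2 by rewrite -GT.
  exists (maxn i j) => //; split.
    by move: Fi; exact/subsetPset/Fnd/leq_maxl.
  by move: Gj; exact/subsetPset/Gnd/leq_maxr.
move=> k; have [mFk Fkoo] := Foo k; have [mGk Gkoo] := Goo k.
have mFG := measurableX mFk mGk; split.
  by rewrite -[X in measurable X]setTI; exact: measurable_uncons_rV.
rewrite /lebesgue_succ /pushforward -comp_preimage.
rewrite (_ : _ \o _ = id); last by apply/funext => p /=; rewrite cons_rVK.
by rewrite preimage_id product_measure1E// lte_mul_pinfty// ge0_fin_numE.
Qed.

HB.instance Definition _ := Measure_isSigmaFinite.Build _ _ _ lebesgue_succ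
  lebesgue_succ_sigma_finite.

End succ.

(* Lebesgue measure on the Borel sets of R^n, as an iterated product measure;
   lebesgue_rV_box gives its value on boxes, which characterizes it. *)
Fixpoint lebesgue_rV n : {sigma_finite_measure set (borel 'rV[R]_n) -> \bar R} :=
  if n is n'.+1 then lebesgue_succ (lebesgue_rV n') else dirac (0 : borel 'rV[R]_0).

Lemma lebesgue_rV_box n (a b : 'rV[R]_n) : (forall i, a 0 i <= b 0 i) ->
  lebesgue_rV n (box a b) = (\prod_i (b 0 i - a 0 i))%:E.
Proof.
elim: n a b => [|n IH] a b ab.
  by rewrite big_ord0 /= diracE mem_set//; case.
pose ta : 'rV[R]_n := \row_j a 0 (lift 0 j).
pose tb : 'rV[R]_n := \row_j b 0 (lift 0 j).
have tab j : ta 0 j <= tb 0 j by rewrite !mxE.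
have -> : lebesgue_rV n.+1 (box a b) =
    (lebesgue_measure \x lebesgue_rV n)%E (`[a 0 0, b 0 0[%classic `*` box ta tb).
  congr ((_ \x _)%E _); apply/seteqP; split=> [p /= pab|p [/= p1 p2] i].
    split=> [|i]; first by have := pab 0; rewrite cons_rV0.
    by have := pab (lift 0 i); rewrite cons_rVS !mxE.
  case: (unliftP 0 i) => [k|] ->; last by rewrite cons_rV0.
  by rewrite cons_rVS; have := p2 k; rewrite !mxE.
rewrite product_measure1E//; last exact: measurable_box.
rewrite IH// big_ord_recl.
rewrite [X in (X * _)%E](_ : _ = (b 0 0 - a 0 0)%:E); last first.
  apply: etrans; first exact: lebesgue_measure_itv.
  have := ab 0; rewrite /= lte_fin le_eqVlt => /predU1P[->|->].
    by rewrite ltxx subrr.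
  by rewrite EFinB.
under eq_bigr do rewrite !mxE.
by rewrite EFinM.
Qed.
End lebesgue.

Section torus.
Context {R : realType} (d : nat).
Local Open Scope quotient_scope.

Definition lattice_equiv (x y : 'rV[R]_d) : bool :=
  [forall i, (x 0 i - y 0 i) \is a Num.int].

Lemma lattice_equiv_refl : reflexive lattice_equiv.
Proof. by move=> x; apply/forallP => i; rewrite subrr rpred0. Qed.

Lemma lattice_equiv_sym : symmetric lattice_equiv.
Proof.
by move=> x y; apply: eq_forallb => i; rewrite -rpredN opprB.
Qed.

Lemma lattice_equiv_trans : transitive lattice_equiv.
Proof.
move=> y x z /forallP xy /forallP yz; apply/forallP => i.
by rewrite -(subrKA (y 0 i)) rpredD.
Qed.

Canonical lattice_equiv_rel := EquivRel lattice_equiv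
  lattice_equiv_refl lattice_equiv_sym lattice_equiv_trans.

Definition torus := quotient_topology {eq_quot lattice_equiv_rel}.

HB.instance Definition _ := Quotient.on torus.
HB.instance Definition _ := Choice.on torus.
HB.instance Definition _ := PointedTopological.on torus.

Definition torus_pi (x : borel 'rV[R]_d) : borel torus := \pi_torus x.

Lemma measurable_torus_pi : measurable_fun [set: borel 'rV[R]_d] torus_pi.
Proof.
apply: (@continuous_measurable_borel 'rV[R]_d torus); exact: pi_continuous.
Qed.

Definition unit_cube : set (borel 'rV[R]_d) := box 0 (const_mx 1).

Definition torus_measure (A : set (borel torus)) : \bar R :=
  lebesgue_rV d (torus_pi @^-1` A `&` unit_cube).

Let mpre (A : set (borel torus)) : measurable A -> measurable (torus_pi @^-1` A).
Proof.
by move=> mA; rewrite -[X in measurable X]setTI; exact: measurable_torus_pi.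
Qed.

Let torus_measure0 : torus_measure set0 = 0%E.
Proof. by rewrite /torus_measure preimage_set0 set0I measure0. Qed.

Let torus_measure_ge0 A : (0 <= torus_measure A)%E.
Proof. exact: measure_ge0. Qed.

Let torus_measure_sigma_additive : semi_sigma_additive torus_measure.
Proof.
move=> F mF tF mUF; rewrite /torus_measure preimage_bigcup setI_bigcupl.
apply: measure_semi_sigma_additive => /=.
- by move=> i; apply: measurableI; [exact: mpre|exact: measurable_box].
- apply: trivIset_setIr; apply/trivIsetP => i j _ _ ij.
  rewrite -preimage_setI; move/trivIsetP : tF => /(_ i j I I ij) ->.
  exact: preimage_set0.
- apply: bigcupT_measurable => i.
  by apply: measurableI; [exact: mpre|exact: measurable_box].
Qed.

HB.instance Definition _ := isMeasure.Build _ _ _ torus_measure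
  torus_measure0 torus_measure_ge0 torus_measure_sigma_additive.

Let torus_measure_setT : torus_measure setT = 1%E.
Proof.
rewrite /torus_measure preimage_setT setTI lebesgue_rV_box; last first.
  by move=> i; rewrite !mxE.
by rewrite big1// => i _; rewrite !mxE subr0.
Qed.

HB.instance Definition _ := Measure_isProbability.Build _ _ _ torus_measure
  torus_measure_setT.

End torus.
Arguments torus R d : clear implicits.
Arguments torus_measure {R d} A.

(* mu-measurability: measurability for the mu-completion of the sigma-algebra,
   i.e. being mu-a.e. equal to a measurable function. *)
Definition ae_measurable d (T : measurableType d) (R : realType)
    (mu : set T -> \bar R) (D : set T) (f : T -> R) : Prop :=
  exists2 g : T -> R, measurable_fun D g &
    {ae mu, forall x, D x -> f x = g x}.

(* weak-* mu-measurability on D of x |-> k x, seen as a measure on the subset X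
   of Y, tested against the functions of the class C. *)
Definition weakstar_measurable d (T : measurableType d) (R : realType)
    (mu : set T -> \bar R) (D : set T) (Y : ptopologicalType) (X : set Y)
    (C : set (Y -> R)) (k : T -> probability (borel Y) R) : Prop :=
  forall h, C h -> ae_measurable mu D (fun x => \int[k x]_(y in X) h y).

Definition continuous_on (T : topologicalType) (R : realType) (A : set T) :
  set (T -> R) := [set f | {within A, continuous f}].

Definition vanishing_at_infinity (R : realType) (E : normedModType R) :
    set (E -> R) :=
  [set h | continuous h /\
    forall e, 0 < e -> exists r, forall z, r < `|z| -> `|h z| < e].

(* For mu a measure and k a family of probabilities this is mu (x) k_x, the
   product measure when k is constant. It is only used as a set function, since
   its countable additivity depends on the measurability of k. *)
Definition disintegrated d1 d2 (X : measurableType d1) (Y : measurableType d2)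
    (R : realType) (mu : {measure set X -> \bar R})
    (k : X -> probability Y R) (A : set (X * Y)) : \bar R :=
  (\int[mu]_x k x (xsection A x))%E.

(* Integral against a finite signed measure through its Jordan decomposition. *)
Definition charge_integral d (T : measurableType d) (R : realType)
    (mu : {charge set T -> \bar R}) (D : set T) (f : T -> R) : R :=
  let P := cid (Hahn_decomposition mu) in
  let N := cid (projT2 P) in
  \int[jordan_pos (projT2 N)]_(x in D) f x -
  \int[jordan_neg (projT2 N)]_(x in D) f x.

(* The inner product is positive definite because its diagonal is `|x| ^+ 2. *)
Definition euclidean_space (R : realType) (E : normedModType R) : Prop :=
  (exists dot : E -> E -> R,
    [/\ forall a x y z, dot (a *: x + y) z = a * dot x z + dot y z,
        forall x y, dot x y = dot y x &
        forall x, `|x| ^+ 2 = dot x x]) /\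
  (exists n (b : 'I_n -> E),
    forall x, exists c : 'I_n -> R, x = \sum_i c i *: b i).

Section two_scale_young_measures.
Context {R : realType} {d : nat} (E : normedModType R).
Local Notation V := 'rV[R]_d.
Local Notation Z := (torus R d).
Local Notation M := (charge (borel (V * Z * E)%type) R).

Definition unit_ball : set E := ball 0 1.

(* Total functions stand for maps on the closure of Omega (times the torus), and
   measures on a closed subset are measures on the whole space carried by it. *)
Record young_quadruple := YoungQuadruple {
  osc : V -> Z -> probability (borel E) R ;
  conc : {finite_measure set (borel V) -> \bar R} ;
  conc_scale : V -> probability (borel Z) R ;
  conc_angle : V -> Z -> probability (borel E) R }.

Implicit Types (Omega : set V) (nu : young_quadruple) (f g : V * Z * E -> R).

(* Lebesgue measure on R^d x Z and the measure lambda (x) rho_x *)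
Definition lebesgue_VZ : set (borel V * borel Z) -> \bar R :=
  disintegrated (lebesgue_rV d) (fun=> torus_measure).
Definition conc_VZ nu : set (borel V * borel Z) -> \bar R :=
  disintegrated (conc nu) (conc_scale nu).

(* A map into the probabilities on the unit sphere is, like any weak-* measurable
   map, defined up to negligible sets: this matters only if E = 0, where the
   sphere carries no probability and conc nu has to vanish. *)
Definition two_scale_young_measure Omega : set young_quadruple := [set nu |
  let D := (closure Omega `*` [set: Z]) : set (borel V * borel Z) in
  [/\ weakstar_measurable lebesgue_VZ D setT
        (@vanishing_at_infinity R E) (fun p => osc nu p.1 p.2) /\
      (\int[lebesgue_VZ]_(p in D) \int[osc nu p.1 p.2]_z `|z : E|%:E < +oo)%E,
      conc nu (~` closure Omega) = 0,
      weakstar_measurable (conc nu) (closure Omega) setT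
        [set h | continuous (h : Z -> R)] (conc_scale nu) &
      weakstar_measurable (conc_VZ nu) D (frontier unit_ball)
        (continuous_on (frontier unit_ball))
        (fun p => conc_angle nu p.1 p.2) /\
      {ae conc_VZ nu, forall p, D p ->
        conc_angle nu p.1 p.2 (frontier unit_ball) = 1%E}]].

Definition recession Omega f (p : V * Z * E) : R :=
  lim ((fun q : V * Z * R => f (q.1.1, q.1.2, q.2 *: p.2) / q.2) @
    filter_prod (filter_prod (within Omega (nbhs p.1.1)) (nbhs p.1.2)) +oo).

Definition young_pairing Omega f nu : R :=
  \int[lebesgue_rV d]_(x in Omega) \int[torus_measure]_xi
    \int[osc nu x xi]_z f (x, xi, z) +
  \int[conc nu]_(x in closure Omega) \int[conc_scale nu x]_xi
    \int[conc_angle nu x xi]_(z in frontier unit_ball)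
      recession Omega f (x, xi, z).

Definition S_map g (p : V * Z * E) : R :=
  (1 + `|p.2|) * g (p.1, (1 + `|p.2|)^-1 *: p.2).

Definition compactification Omega : set (V * Z * E) :=
  closure (Omega `*` [set: Z] `*` unit_ball).

(* signed measures on the compactification *)
Definition signed_measures Omega :
    set M :=
  [set mu | forall A : set (borel (V * Z * E)%type), measurable A ->
    compactification Omega `&` A = set0 -> mu A = 0%E].

Definition is_Sstar Omega nu
    (mu : M) : Prop :=
  signed_measures Omega mu /\
  forall g, continuous_on (compactification Omega) g ->
    charge_integral mu (compactification Omega) g =
    young_pairing Omega (S_map g) nu.

(* the measure determined by [is_Sstar] (junk value if there is none) *)
Definition Sstar Omega nu : M :=
  if pselect (exists mu, is_Sstar Omega nu mu) is left mu_ex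
  then projT1 (cid mu_ex) else czero.

(* Signed measures are identified when they agree on the Borel sets: their values
   elsewhere are irrelevant. *)
Definition Sstar_image Omega :
    set M :=
  [set mu | exists2 nu, two_scale_young_measure Omega nu &
    forall A, measurable A -> mu A = Sstar Omega nu A].

Definition positive_measures Omega :
    set M :=
  [set mu | signed_measures Omega mu /\
    forall A, measurable A -> (0 <= mu A)%E].

End two_scale_young_measures.
Arguments compactification {R d} E Omega.
Arguments Sstar_image {R d} E Omega.
Arguments positive_measures {R d} E Omega.

(* Main.v *)
Require Import Defs.
From HB Require Import structures.
From mathcomp Require Import all_boot all_order all_algebra.
From mathcomp Require Import all_classical all_reals all_analysis.
From mathcomp Require Import measurable_realfun.
From mathcomp Require Import finmap ring lra.

Set Implicit Arguments.
Unset Strict Implicit.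
Unset Printing Implicit Defensive.

Import Order.TTheory GRing.Theory Num.Theory.
Import numFieldNormedType.Exports.

Local Open Scope classical_set_scope.
Local Open Scope ring_scope.

Section functional_measure.
Import HBNNSimple.
Context d (T : measurableType d) (R : realType).
Local Open Scope ereal_scope.
Variable I : (T -> \bar R) -> \bar R.

Definition integral_functional := [/\
  forall f, measurable_fun setT f -> (forall x, 0 <= f x) -> 0 <= I f,
  forall f g, measurable_fun setT f -> (forall x, 0 <= f x) ->
    measurable_fun setT g -> (forall x, 0 <= g x) ->
    I (fun x => f x + g x) = I f + I g,
  forall (a : R) f, (0 <= a)%R -> measurable_fun setT f -> (forall x, 0 <= f x) ->
    I (fun x => a%:E * f x) = a%:E * I f &
  forall (F : nat -> T -> \bar R) f, (forall n, measurable_fun setT (F n)) ->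
    (forall n x, 0 <= F n x) -> (forall x, nondecreasing_seq (F ^~ x)) ->
    (forall x, F n x @[n --> \oo] --> f x) -> I (F n) @[n --> \oo] --> I f].

Hypothesis If : integral_functional.

Let I0 : I (fun=> 0) = 0.
Proof.
case: If => _ _ IZ _.
have := IZ 0%R (fun=> 0) (lexx _) (measurable_cst _) (fun=> lexx _).
by rewrite !mul0e.
Qed.

Let Isum (J : eqType) (s : seq J) (F : J -> T -> \bar R) :
  (forall j, j \in s -> measurable_fun setT (F j)) ->
  (forall j, j \in s -> forall x, 0 <= F j x) ->
  I (fun x => \sum_(j <- s) F j x) = \sum_(j <- s) I (F j).
Proof.
case: If => _ ID _ _.
elim: s => [_ _|j s IH mF F0].
  by rewrite big_nil -I0; congr I; apply/funext => x; rewrite big_nil.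
have IH' : I (fun x => \sum_(j <- s) F j x) = \sum_(j <- s) I (F j).
  by apply: IH => k ks; [apply: mF|apply: F0]; rewrite in_cons ks orbT.
rewrite big_cons -IH' -ID.
- by congr I; apply/funext => x; rewrite big_cons.
- by apply: mF; rewrite mem_head.
- by apply: F0; rewrite mem_head.
- rewrite (_ : (fun x => _) = 
      (fun x => \sum_(j <- s) (if j \in s then F j else cst 0) x)); last first.
    apply/funext => x; rewrite big_seq [RHS]big_seq.
    by apply: eq_bigr => k ->.
  apply: emeasurable_sum => k; case: ifPn => // ks.
  by apply: mF; rewrite in_cons ks orbT.
- move=> x; rewrite big_seq; apply: sume_ge0 => k ks.
  by apply: F0; rewrite in_cons ks orbT.
Qed.

Let mu (A : set T) : \bar R := if pselect (measurable A) then I (EFin \o \1_A) else 0.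

Let muE A : measurable A -> mu A = I (EFin \o \1_A).
Proof. by rewrite /mu; case: pselect. Qed.

Let mindic (A : set T) : measurable A -> measurable_fun setT (EFin \o (\1_A : T -> R)).
Proof. by move=> mA; apply/measurable_EFinP; exact: measurable_indic. Qed.

Let mu0 : mu set0 = 0.
Proof. by rewrite muE// -I0; congr I; apply/funext => x /=; rewrite indic0. Qed.

Let mu_ge0 A : 0 <= mu A.
Proof.
rewrite /mu; case: pselect => // mA; case: If => I_ge0 _ _ _.
by apply: I_ge0 => [|x]; [exact: mindic|rewrite lee_fin].
Qed.

Let mu_sigma_additive : semi_sigma_additive mu.
Proof.
case: (If) => _ _ _ Imon F mF tF mUF; rewrite muE//.
rewrite (_ : (fun n => _) =
    (fun n => I (fun x => \sum_(0 <= i < n) (EFin \o \1_(F i)) x))); last first.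
  apply/funext => n; rewrite Isum.
  - by apply: eq_bigr => i _; rewrite muE.
  - by move=> j _; exact: mindic.
  - by move=> j _ x; rewrite lee_fin.
apply: Imon.
- by move=> n; apply: emeasurable_sum => i; exact: mindic.
- by move=> n x; apply: sume_ge0 => i _; rewrite lee_fin.
- by move=> x m n mn; apply: lee_sum_nneg_natr => // k _ _; rewrite lee_fin.
- move=> x; rewrite /= indic_bigcup//; apply: is_cvg_nneseries => n _ _.
  by rewrite lee_fin.
Qed.

HB.instance Definition _ := isMeasure.Build _ _ _ mu mu0 mu_ge0 mu_sigma_additive.

Lemma functional_measure : exists m : {measure set T -> \bar R},
  forall f, measurable_fun setT f -> (forall x, 0 <= f x) -> \int[m]_x f x = I f.
Proof.
exists mu => f mf f0; case: (If) => _ _ IZ Imon.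

pose g := nnsfun_approx measurableT mf.
have gf x : (g n x)%:E @[n --> \oo] --> f x by exact: cvg_nnsfun_approx.
have g_nd x : nondecreasing_seq (fun n => (g n x)%:E).
  by move=> m n mn; rewrite lee_fin; apply/lefP/nd_nnsfun_approx.
have mg n : measurable_fun setT (EFin \o g n) by exact/measurable_EFinP.
have : \int[mu]_x (g n x)%:E @[n --> \oo] --> \int[mu]_x f x.
  rewrite (eq_integral (fun x => limn (fun n => (g n x)%:E))); last first.
    by move=> x _; apply/esym/cvg_lim => //; exact: gf.
  by apply: cvg_monotone_convergence => // n x _; rewrite lee_fin.
have g0 n x : 0 <= (EFin \o g n) x by rewrite lee_fin.
have := Imon (fun n => EFin \o g n) f mg g0 g_nd gf.
rewrite (_ : (fun n => \int[mu]_x (g n x)%:E) = (fun n => I (EFin \o g n))).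
  by move=> h1 h2; exact: cvg_unique h2 h1.
apply/funext => n; rewrite integralT_nnsfun sintegralE.
have mp r : measurable (g n @^-1` [set r]) by [].
have g_ge0 r : r \in (fset_set (range (g n)) : seq R) -> (0 <= r)%R.
  by rewrite in_fset_set// => /set_mem[x _ <-].
transitivity (\sum_(r <- fset_set (range (g n)))
    I (fun x => r%:E * (EFin \o \1_(g n @^-1` [set r])) x)).
  rewrite fsbig_finite//= big_seq [RHS]big_seq; apply: eq_bigr => r rg.
  rewrite IZ//; [|exact: g_ge0|exact: mindic].
  by rewrite -muE.
rewrite -Isum; last 2 first.
  by move=> r _; apply: emeasurable_funM => //; exact: mindic.
  by move=> r /g_ge0 r0 x; rewrite mule_ge0// lee_fin.
congr I; apply/funext => x /=.
rewrite [in RHS](fimfunE (g n)) fsbig_finite//= sumEFin.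
by [].
Qed.

End functional_measure.

Definition pkernel d1 d2 (X : measurableType d1) (Y : measurableType d2)
    (R : realType) (k : X -> probability Y R) :=
  forall U, measurable U -> measurable_fun [set: X] (fun x => k x U).

Section pkernel_theory.
Context d1 d2 (X : measurableType d1) (Y : measurableType d2) (R : realType).
Local Open Scope ereal_scope.

Section integral.
Variables (k : X -> probability Y R) (mk : pkernel k).

Let K (x : X) : {measure set Y -> \bar R} := k x.
HB.instance Definition _ := isKernel.Build _ _ X Y R K mk.
HB.instance Definition _ :=
  Kernel_isProbability.Build _ _ X Y R K (fun x => probability_setT (k x)).

Lemma measurable_pkernel_integral (f : X * Y -> \bar R) :
  measurable_fun setT f -> (forall p, 0 <= f p) ->
  measurable_fun setT (fun x => \int[k x]_y f (x, y)).
Proof. by move=> mf f0; exact: (@measurable_kfcomp _ _ _ _ _ K f mf f0). Qed.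

Lemma pkernel_product (m : {measure set X -> \bar R}) :
  exists M : {measure set (X * Y) -> \bar R},
    forall f, measurable_fun setT f -> (forall p, 0 <= f p) ->
      \int[M]_p f p = \int[m]_x \int[k x]_y f (x, y).
Proof.
apply: functional_measure; split.
- by move=> f _ f0; apply: integral_ge0 => x _; exact: integral_ge0.
- move=> f g mf f0 mg g0; rewrite -ge0_integralD//.
  + apply: eq_integral => x _; rewrite ge0_integralD//.
    * exact: measurableT_comp.
    * exact: measurableT_comp.
  + by move=> x _; exact: integral_ge0.
  + exact: measurable_pkernel_integral.
  + by move=> x _; exact: integral_ge0.
  + exact: measurable_pkernel_integral.
- move=> a f a0 mf f0; rewrite -ge0_integralZl_EFin//.
  + apply: eq_integral => x _; rewrite ge0_integralZl_EFin//.
    exact: measurableT_comp.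
  + by move=> x _; exact: integral_ge0.
  + exact: measurable_pkernel_integral.
- move=> F f mF F0 Fnd Ff.
  have Fkf x : \int[k x]_y F n (x, y) @[n --> \oo] --> \int[k x]_y f (x, y).
    rewrite (eq_integral (fun y => limn (fun n => F n (x, y)))); last first.
      by move=> y _; apply/esym/cvg_lim => //; exact: Ff.
    apply: cvg_monotone_convergence => //.
    by move=> n; exact: measurableT_comp.
  rewrite (eq_integral (fun x => limn (fun n => \int[k x]_y F n (x, y)))); last first.
    by move=> x _; apply/esym/cvg_lim => //; exact: Fkf.
  apply: cvg_monotone_convergence => //.
  + by move=> n; exact: measurable_pkernel_integral.
  + by move=> n x _; exact: integral_ge0.
  + move=> x _ m' n mn; apply: ge0_le_integral => //.
    * exact: measurableT_comp.
    * exact: measurableT_comp.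
    * by move=> y _; apply: Fnd.
Qed.

End integral.

Lemma pkernel_RintegralE (k : X -> probability Y R) (m : {measure set X -> \bar R})
    (M : {measure set (X * Y) -> \bar R}) (f : X * Y -> R) :
  pkernel k ->
  (forall f, measurable_fun setT f -> (forall p, 0 <= f p) ->
      \int[M]_p f p = \int[m]_x \int[k x]_y f (x, y)) ->
  M.-integrable setT (EFin \o f) ->
  (\int[M]_p f p = \int[m]_x \int[k x]_y f (x, y))%R.
Proof.
move=> mk ME intf.
have mf : measurable_fun setT (EFin \o f) by exact: measurable_int intf.
pose fp x := \int[k x]_y (EFin \o f)^\+ (x, y).
pose fn x := \int[k x]_y (EFin \o f)^\- (x, y).
have mfp : measurable_fun setT fp.
  by apply: measurable_pkernel_integral => //; exact: measurable_funepos.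
have mfn : measurable_fun setT fn.
  by apply: measurable_pkernel_integral => //; exact: measurable_funeneg.
have fp0 x : 0 <= fp x by exact: integral_ge0.
have fn0 x : 0 <= fn x by exact: integral_ge0.
have ifp : m.-integrable setT fp.
  apply/integrableP; split => //; under eq_integral do rewrite gee0_abs//.
  rewrite -ME//; last exact: measurable_funepos.
  exact: integral_funepos_lt_pinfty.
have ifn : m.-integrable setT fn.
  apply/integrableP; split => //; under eq_integral do rewrite gee0_abs//.
  rewrite -ME//; last exact: measurable_funeneg.
  exact: integral_funeneg_lt_pinfty.
rewrite /Rintegral [in LHS]integralE ME//; last exact: measurable_funepos.
rewrite ME//; last exact: measurable_funeneg.
congr fine; rewrite -/(fp) -/(fn) -integralB//.
rewrite [RHS](eq_integral (EFin \o (fine \o (fun x => fp x - fn x)))); last first.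
  move=> x _ /=; rewrite [in LHS]integralE. 
  by congr ((fine (_ - _))%:E); apply: eq_integral => y _; rewrite ?funeposE ?funenegE.
apply: ae_eq_integral => //.
- exact: emeasurable_funB.
- by apply/measurable_EFinP; apply: measurableT_comp => //; exact: emeasurable_funB.
have := integrable_ae measurableT ifp; have := integrable_ae measurableT ifn.
apply: filterS2 => x /(_ I) n_fin /(_ I) p_fin _ /=.
by rewrite fineK// fin_numB p_fin.
Qed.

Lemma pkernelS (k : X -> probability Y R) (G : set (set Y)) :
  measurable = <<s G >> -> setI_closed G ->
  (forall U, G U -> measurable_fun setT (fun x => k x U)) -> pkernel k.
Proof.
move=> mG GI Gk.
pose H := [set U | measurable U /\ measurable_fun setT (fun x => k x U)].
suff HG : <<s G >> `<=` H by move=> U; rewrite mG => /HG[].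
apply: lambda_system_subset => //.
- split=> //.
  + split => //; rewrite (_ : (fun x => _) = cst 1)//.
    by apply/funext => x; exact: probability_setT.
  + move=> A B BA [mA kA] [mB kB]; split; first exact: measurableD.
    rewrite (_ : (fun x => _) = (fun x => k x A - k x B)); last first.
      apply/funext => x; rewrite measureD//; last by rewrite ltey_eq fin_num_measure.
      by rewrite setIidr.
    exact: emeasurable_funB.
  + move=> F Fnd HF; have mF n : measurable (F n) by have [] := HF n.
    split; first exact: bigcupT_measurable.
    apply: (emeasurable_fun_cvg (fun n x => k x (F n))).
      by move=> n; have [] := HF n.
    move=> x _; apply: nondecreasing_cvg_mu => //; exact: bigcupT_measurable.
- move=> U GU; split; last exact: Gk.
  by rewrite mG; exact: sub_sigma_algebra.
Qed.

End pkernel_theory.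

Section ae_integral.
Context d (T : measurableType d) (R : realType) (mu : {measure set T -> \bar R}).
Local Open Scope ereal_scope.
Import HBNNSimple.

Lemma ge0_ae_eq_integral_nomeas (f g : T -> \bar R) :
  (forall x, 0 <= f x) -> (forall x, 0 <= g x) ->
  {ae mu, forall x, f x = g x} -> \int[mu]_x f x = \int[mu]_x g x.
Proof.
suff le f' g' : (forall x, 0 <= f' x) -> (forall x, 0 <= g' x) ->
    {ae mu, forall x, f' x = g' x} -> \int[mu]_x f' x <= \int[mu]_x g' x.
  move=> f0 g0 fg; apply/eqP; rewrite eq_le !le//.
  by apply: filterS fg => x ->.
move: f' g' => {}f {}g f0 g0 [N [mN N0 fgN]].
rewrite ge0_integralTE// [leRHS]ge0_integralTE//.
apply: ge_ereal_sup => _ [h /= hf <-].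
have mh : measurable_fun setT (EFin \o h) by exact/measurable_EFinP.
have h0 x : 0 <= (EFin \o h) x by rewrite lee_fin.
rewrite -integralT_nnsfun (ge0_negligible_integral mN)//; last first.
  by move=> x _; rewrite lee_fin.
rewrite setTD integral_mkcond.
pose h' := proj_nnsfun h (measurableC mN).
have -> : (fun x => (h x)%:E) \_ (~` N) = EFin \o h'.
  apply/funext => x; rewrite /= patchE /h' /proj_nnsfun/= mindicE.
  by case: ifPn; rewrite ?mulr1 ?mulr0.
rewrite integralT_nnsfun; apply: ereal_sup_ubound; exists h' => //= x.
rewrite mindicE; case: (boolP (x \in ~` N)) => [xN|]; last by rewrite mulr0.
rewrite mulr1; have <- : f x = g x; last exact: hf.
by apply: contrapT => fgx; move/set_mem: xN; apply; exact: fgN.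
Qed.

Lemma ae_eq_Rintegral (D : set T) (f g : T -> R) :
  {ae mu, forall x, D x -> f x = g x} ->
  (\int[mu]_(x in D) f x = \int[mu]_(x in D) g x)%R.
Proof.
move=> fg; rewrite /Rintegral; congr fine.
rewrite integral_mkcond [in RHS]integral_mkcond integralE [RHS]integralE.
have fg' : {ae mu, forall x, ((EFin \o f) \_ D) x = ((EFin \o g) \_ D) x}.
  apply: filterS fg => x fgx; rewrite !patchE; case: ifPn => // /set_mem Dx.
  by rewrite /= fgx.
congr (_ - _); apply: ge0_ae_eq_integral_nomeas => //;
  by apply: filterS fg' => x fgx; rewrite ?funeposE ?funenegE fgx.
Qed.

Lemma ge0_ae_eq_integral_in (D : set T) (f g : T -> \bar R) :
  (forall x, 0 <= f x) -> (forall x, 0 <= g x) ->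
  {ae mu, forall x, D x -> f x = g x} ->
  \int[mu]_(x in D) f x = \int[mu]_(x in D) g x.
Proof.
move=> f0 g0 fg; rewrite integral_mkcond [RHS]integral_mkcond.
apply: ge0_ae_eq_integral_nomeas.
- by move=> x; rewrite patchE; case: ifPn.
- by move=> x; rewrite patchE; case: ifPn.
apply: filterS fg => x fgx; rewrite !patchE; case: ifPn => // /set_mem Dx.
exact: fgx.
Qed.

End ae_integral.

Section ae_le.
Context d (X : measurableType d) (R : realType) (mu : {measure set X -> \bar R}).
Local Open Scope ereal_scope.

Lemma ae_le_integral (f g : X -> \bar R) :
  mu.-integrable setT f -> mu.-integrable setT g ->
  (forall A, measurable A -> \int[mu]_(x in A) f x <= \int[mu]_(x in A) g x) ->
  {ae mu, forall x, f x <= g x}.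
Proof.
move=> intf intg fg.
have mf := measurable_int _ intf; have mg := measurable_int _ intg.
pose N := [set x | g x < f x].
have mN : measurable N by rewrite -[N]setTI; exact: measurable_lte.
have NT : N `<=` setT by [].
have intf' := integrableS measurableT mN NT intf.
have intg' := integrableS measurableT mN NT intg.
have : ae_eq mu N f g.
  apply: integral_ae_eq => //; first exact: measurable_int intg'.
  move=> A AN mA; apply/eqP; rewrite eq_le fg//=.
  apply: le_integral => //.
  - exact: integrableS measurableT _ _ intg.
  - exact: integrableS measurableT _ _ intf.
  - by move=> x /set_mem Ax; apply/ltW/AN.
apply: filterS => x fgx; rewrite leNgt; apply/negP => gf.
by have := gf; rewrite fgx// ltxx.
Qed.

End ae_le.

Section conditional_cdf.
Context d (X : measurableType d) (R : realType).
Local Notation RR := (measurableTypeR R).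
Variables (m : {finite_measure set (X * RR)%type -> \bar R}).
Variables (m1 : {finite_measure set X -> \bar R}).
Hypothesis m1E : forall A, measurable A -> m1 A = m (A `*` setT).
Local Open Scope ereal_scope.

Definition slice (t : R) (A : set X) : \bar R := m (A `*` `]-oo, t]%classic).

Let mslice t (A : set X) : measurable A -> measurable (A `*` (`]-oo, t]%classic : set RR)).
Proof. by move=> mA; apply: measurableX => //; exact: measurable_itv. Qed.

Let slice0 t : slice t set0 = 0.
Proof. by rewrite /slice set0X measure0. Qed.

Let slice_ge0 t A : 0 <= slice t A.
Proof. exact: measure_ge0. Qed.

Let slice_sigma_additive t : semi_sigma_additive (slice t).
Proof.
move=> F mF tF mUF; rewrite /slice setX_bigcupl.
apply: measure_semi_sigma_additive.
- by move=> n; exact: mslice.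
- apply/trivIsetP => i j _ _ ij; move/trivIsetP : tF => /(_ i j I I ij) FF.
  apply/seteqP; split => // -[x y] [[Fx _] [Gx _]].
  by have : (F i `&` F j) x by []; rewrite FF.
- by rewrite -setX_bigcupl; exact: mslice.
Qed.

HB.instance Definition _ t := isMeasure.Build _ _ _ (slice t)
  (slice0 t) (slice_ge0 t) (@slice_sigma_additive t).

Let slice_fin t : fin_num_fun (slice t).
Proof. by move=> A mA; apply: fin_num_measure; exact: mslice. Qed.

HB.instance Definition _ t := Measure_isFinite.Build _ _ _ (slice t) (slice_fin t).

Lemma slice_le t A : measurable A -> slice t A <= m1 A.
Proof.
move=> mA; rewrite m1E//; apply: le_measure.
- by apply/mem_set; exact: mslice.
- by apply/mem_set; exact: measurableX.
- by move=> [x y] [].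
Qed.

Lemma slice_mono s t A : (s <= t)%R -> measurable A -> slice s A <= slice t A.
Proof.
move=> st mA; apply: le_measure; [by apply/mem_set; exact: mslice..|].
by move=> [x y] [/= Ax]; rewrite in_itv/= => ys; split => //=; rewrite in_itv/= (le_trans ys).
Qed.

Let slice_dom t : slice t `<< m1.
Proof.
apply/null_content_dominatesP => A mA A0; apply/eqP; rewrite eq_le measure_ge0 andbT.
by rewrite -A0; exact: slice_le.
Qed.

Definition cond_density (t : R) (x : X) : R :=
  fine (Radon_Nikodym_SigmaFinite.f (slice t) m1 x).

Let cond_densityE t :
  EFin \o cond_density t = Radon_Nikodym_SigmaFinite.f (slice t) m1.
Proof.
apply/funext => x /=; rewrite fineK//.
exact: (Radon_Nikodym_SigmaFinite.f_fin_num (slice_dom t)).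
Qed.

Let cond_density_ge0 t x : (0 <= cond_density t x)%R.
Proof. by rewrite fine_ge0//; exact: (Radon_Nikodym_SigmaFinite.f_ge0 (slice_dom t)). Qed.

Let cond_density_int t : m1.-integrable setT (EFin \o cond_density t).
Proof. rewrite cond_densityE; exact: (Radon_Nikodym_SigmaFinite.f_integrable (slice_dom t)). Qed.

Let cond_density_meas t : measurable_fun setT (cond_density t).
Proof. by apply/measurable_EFinP; exact: measurable_int (cond_density_int t). Qed.

Let cond_density_integral t A : measurable A ->
  \int[m1]_(x in A) (cond_density t x)%:E = slice t A.
Proof.
move=> mA; rewrite (Radon_Nikodym_SigmaFinite.f_integral (slice_dom t) mA).
by apply: eq_integral => x _; rewrite -cond_densityE.
Qed.

Let cond_density_mono s t : (s <= t)%R ->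
  {ae m1, forall x, (cond_density s x <= cond_density t x)%R}.
Proof.
move=> st.
have := @ae_le_integral _ _ _ m1 _ _ (cond_density_int s) (cond_density_int t).
move=> /(_ _)/[!cond_densityE] h.
have {h} : {ae m1, forall x, (EFin \o cond_density s) x <= (EFin \o cond_density t) x}.
  rewrite !cond_densityE; apply: h => A mA.
  rewrite -(Radon_Nikodym_SigmaFinite.f_integral (slice_dom s))//.
  rewrite -(Radon_Nikodym_SigmaFinite.f_integral (slice_dom t))//.
  exact: slice_mono.
by apply: filterS => x; rewrite lee_fin.
Qed.

Let cond_density_le1 t : {ae m1, forall x, (cond_density t x <= 1)%R}.
Proof.
have int1 : m1.-integrable setT (EFin \o (cst 1%R : X -> R)).
  by apply: finite_measure_integrable_cst.
have := @ae_le_integral _ _ _ m1 _ _ (cond_density_int t) int1.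
case.
  move=> A mA; rewrite cond_density_integral//= integral_cst// mul1e.
  exact: slice_le.
by move=> N [mN N0 h]; exists N; split => // x /= hx; apply: h => /=; rewrite lee_fin.
Qed.

(* The rationals above t suffice to make the infimum right-continuous; indices
   which do not code such a rational contribute the neutral value 1. *)
Definition cond_cdf_seq (t : R) (n : nat) (x : X) : R :=
  if (choice.unpickle n : option rat) is Some q then
    (if (t < ratr q)%R then Num.min 1%R (cond_density (ratr q) x) else 1%R)
  else 1%R.

Let seq_ge0 t n x : (0 <= cond_cdf_seq t n x)%R.
Proof.
rewrite /cond_cdf_seq; case: choice.unpickle => // q; case: ifPn => // _.
by rewrite le_min ler01/=.
Qed.

Let seq_le1 t n x : (cond_cdf_seq t n x <= 1)%R.
Proof.
rewrite /cond_cdf_seq; case: choice.unpickle => // q; case: ifPn => // _.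
by rewrite ge_min lexx.
Qed.

Let seq_nd s t n x : (s <= t)%R -> (cond_cdf_seq s n x <= cond_cdf_seq t n x)%R.
Proof.
move=> st; rewrite /cond_cdf_seq; case: choice.unpickle => // q.
case: ifPn => [sq|]; case: ifPn => //.
- by rewrite ge_min lexx.
- by move=> tq /negP; rewrite (le_lt_trans st tq).
Qed.

Let seq_meas t n : measurable_fun setT (cond_cdf_seq t n).
Proof.
rewrite /cond_cdf_seq; case: (choice.unpickle n : option rat) => [q|//].
case: (t < ratr q)%R => //.
exact: measurable_minr.
Qed.

Let cdf_mid (t : R) (x : X) : R := inf (range (fun n => cond_cdf_seq t n x)).

Let lb t x : has_lbound (range (fun n => cond_cdf_seq t n x)).
Proof. by exists 0%R => _ [n _ <-]. Qed.

Let cdf_mid_ge0 t x : (0 <= cdf_mid t x)%R.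
Proof.
apply: lb_le_inf; first by exists (cond_cdf_seq t 0%N x); exists 0%N.
by move=> _ [n _ <-].
Qed.

Let cdf_mid_le t n x : (cdf_mid t x <= cond_cdf_seq t n x)%R.
Proof. by apply: ge_inf => //; exists n. Qed.

Let cdf_mid_le1 t x : (cdf_mid t x <= 1)%R.
Proof. exact: le_trans (cdf_mid_le t 0%N x) (seq_le1 _ _ _). Qed.

Let cdf_mid_nd s t x : (s <= t)%R -> (cdf_mid s x <= cdf_mid t x)%R.
Proof.
move=> st; apply: lb_le_inf; first by exists (cond_cdf_seq t 0%N x); exists 0%N.
by move=> _ [n _ <-]; apply: le_trans (cdf_mid_le s n x) (seq_nd _ _ st).
Qed.

Let cdf_mid_meas t : measurable_fun setT (cdf_mid t).
Proof.
have -> : cdf_mid t = (fun x => infs (fun n => cond_cdf_seq t n x) 0%N).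
  apply/funext => x; rewrite /cdf_mid /infs; congr inf; apply/seteqP.
  by split=> [_ [n _ <-]|_ [n _ <-]]; exists n.
apply: measurable_fun_infs => [x _|n]; [exact: lb|exact: seq_meas].
Qed.

Let cdf_mid_rc t x e : (0 < e)%R ->
  exists2 s, (t < s)%R & forall u, (t <= u < s)%R -> (cdf_mid u x < cdf_mid t x + e)%R.
Proof.
move=> e0.
have hi : has_inf (range (fun n => cond_cdf_seq t n x)).
  by split => //; exists (cond_cdf_seq t 0%N x); exists 0%N.
have [_ [n _ <-]] := inf_adherent e0 hi; rewrite -/(cdf_mid t x) => tn.
case E : (choice.unpickle n) => [q|]; last first.
  exists (t + 1)%R => [|u _]; first by rewrite ltrDl.
  apply: le_lt_trans (cdf_mid_le1 u x) _; apply: le_lt_trans tn.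
  by rewrite /cond_cdf_seq E.
have [tq|qt] := ltP t (ratr q); last first.
  exists (t + 1)%R => [|u _]; first by rewrite ltrDl.
  apply: le_lt_trans (cdf_mid_le1 u x) _; apply: le_lt_trans tn.
  by rewrite /cond_cdf_seq E ltNge qt.
exists (ratr q) => // u /andP[tu uq].
apply: le_lt_trans tn; apply: le_trans (cdf_mid_le u n x) _.
by rewrite /cond_cdf_seq E uq tq.
Qed.

Let cdf_mid_integral t A : measurable A ->
  \int[m1]_(x in A) (cdf_mid t x)%:E = slice t A.
Proof.
move=> mA.
have mF : measurable_fun A (EFin \o cdf_mid t).
  by apply/measurable_EFinP; exact: measurable_funTS (cdf_mid_meas t).
have mg s : measurable_fun A (EFin \o cond_density s).
  by apply/measurable_EFinP; exact: measurable_funTS (cond_density_meas s).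
have F0 x : A x -> 0 <= (EFin \o cdf_mid t) x by rewrite lee_fin.
have g0 s x : A x -> 0 <= (EFin \o cond_density s) x by rewrite lee_fin.
apply/eqP; rewrite eq_le; apply/andP; split; last first.
  rewrite -cond_density_integral//.
  apply: (ae_ge0_le_integral mA (g0 t) (mg t) F0 mF).
  have : {ae m1, forall x n, (cond_density t x <= cond_cdf_seq t n x)%R}.
    apply: ae_foralln => n; rewrite /cond_cdf_seq.
    case: choice.unpickle => [q|]; last exact: cond_density_le1.
    have [tq|qt] := ltP t (ratr q); last exact: cond_density_le1.
    apply: filterS2 (cond_density_le1 t) (cond_density_mono (ltW tq)) => x h1 h2.
    by rewrite le_min h1 h2.
  apply: filterS => x h Ax; rewrite lee_fin; apply: lb_le_inf.
    by exists (cond_cdf_seq t 0%N x); exists 0%N.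
  by move=> _ [n _ <-].
have le_s s : (t < s)%R -> \int[m1]_(x in A) (cdf_mid t x)%:E <= slice s A.
  move=> /rat_in_itvoo[q]; rewrite in_itv/= => /andP[tq qs].
  apply: (@le_trans _ _ (slice (ratr q) A)); last exact: slice_mono (ltW qs) mA.
  rewrite -cond_density_integral//; apply: ge0_le_integral => //.
    exact: mg.
  move=> x Ax.
  rewrite lee_fin; apply: le_trans (cdf_mid_le t (choice.pickle q) x) _.
  by rewrite /cond_cdf_seq choice.pickleK tq ge_min lexx orbT.
pose G n := A `*` (`]-oo, (t + n.+1%:R^-1)%R]%classic : set RR).
have mG n : measurable (G n) by exact: mslice.
have GE : \bigcap_n G n = A `*` (`]-oo, t]%classic : set RR).
  apply/seteqP; split=> [[x y] h|[x y] [/= Ax]].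
    split; first by have [] := h 0%N I.
    rewrite /= in_itv/=; apply/ler_addgt0Pr => e e0.
    have [n _ ne] := near_infty_natSinv_lt (PosNum e0).
    have [_ /=] := h n I; rewrite in_itv/= => /le_trans; apply.
    by rewrite lerD2l ltW//; apply: ne => /=.
  rewrite in_itv/= => yt n _; split => //=; rewrite in_itv/=.
  by apply: le_trans yt _; rewrite lerDl.
have cvgG : m (G n) @[n --> \oo] --> m (\bigcap_n G n).
  apply: nonincreasing_cvg_mu => //.
  - by rewrite ltey_eq fin_num_measure.
  - by rewrite GE; exact: mslice.
  - move=> i j ij; apply/subsetPset => -[x y] [/= Ax].
    rewrite in_itv/= => yj; split => //=; rewrite in_itv/=.
    by apply: le_trans yj _; rewrite lerD2l lef_pV2 ?posrE// ler_nat.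
rewrite /slice -GE -(cvg_lim _ cvgG)//; apply: lime_ge.
  by apply/cvg_ex; exists (m (\bigcap_n G n)).
by apply: nearW => n; apply: le_s; rewrite ltrDl.
Qed.

Definition cond_cdf (x : X) (t : R) : R :=
  if (t < -1)%R then 0%R else if (1 <= t)%R then 1%R else cdf_mid t x.

Let cond_cdf_nd x : {homo cond_cdf x : s t / (s <= t)%R}.
Proof.
move=> s t st; rewrite /cond_cdf.
case: (ltP s (-1)%R) => s1; case: (ltP t (-1)%R) => t1;
  case: (leP 1%R s) => s2; case: (leP 1%R t) => t2 //; try lra.
exact: cdf_mid_nd.
Qed.

Let cond_cdf_low x t : (t < -1)%R -> cond_cdf x t = 0%R.
Proof. by rewrite /cond_cdf => ->. Qed.

Let cond_cdf_high x t : (1 <= t)%R -> cond_cdf x t = 1%R.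
Proof. by rewrite /cond_cdf => t1; rewrite t1; case: ltP => // h; lra. Qed.

Let cond_cdf_mid x t : (-1 <= t)%R -> (t < 1)%R -> cond_cdf x t = cdf_mid t x.
Proof. by rewrite /cond_cdf => t1 t2; rewrite ltNge t1 /= leNgt t2. Qed.

Let cond_cdf_rc x : right_continuous (cond_cdf x).
Proof.
move=> t; apply/cvgrPdist_lt => e e0.
have [t1|t1] := ltP t (-1)%R.
  near=> u; have u1 : (u < -1)%R by near: u; exact: nbhs_right_lt.
  by rewrite !cond_cdf_low// subrr normr0.
have [t2|t2] := leP 1%R t.
  near=> u; have tu : (t <= u)%R by near: u; exact: nbhs_right_ge.
  by rewrite !cond_cdf_high// ?(le_trans t2)// subrr normr0.
have [s ts hs] := cdf_mid_rc t x e0.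
near=> u; have tu : (t <= u)%R by near: u; exact: nbhs_right_ge.
have us : (u < s)%R by near: u; exact: nbhs_right_lt.
have u1 : (u < 1)%R by near: u; exact: nbhs_right_lt.
rewrite !cond_cdf_mid// ?(le_trans t1)//.
have := hs u; rewrite tu us => /(_ isT) h.
have h2 := cdf_mid_nd x tu.
by rewrite ltr_norml; apply/andP; split; lra.
Unshelve. all: by end_near. Qed.

HB.instance Definition _ x :=
  isCumulative.Build R _ R (cond_cdf x) (@cond_cdf_nd x) (@cond_cdf_rc x).

Let cond_cdfNy x : (cond_cdf x @ -oo --> 0)%R.
Proof.
apply: cvg_near_cst; exists (-1)%R; split; first exact: num_real.
by move=> t; exact: cond_cdf_low.
Qed.

Let cond_cdfy x : (cond_cdf x t @[t --> +oo] --> (1 : R))%R.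
Proof.
apply: cvg_near_cst; exists 1%R; split; first exact: num_real.
by move=> t /ltW; exact: cond_cdf_high.
Qed.

HB.instance Definition _ x :=
  isCumulativeBounded.Build R 0%R 1%R (cond_cdf x) (cond_cdfNy x) (cond_cdfy x).

Definition cond_kernel (x : X) : probability RR R :=
  lebesgue_stieltjes_measure (cond_cdf x : cumulativeBounded 0%R 1%R).

Let cond_kernel_oc x (a b : R) : (a <= b)%R ->
  cond_kernel x `]a, b]%classic = (cond_cdf x b - cond_cdf x a)%:E.
Proof.
move=> ab; rewrite /cond_kernel /= /lebesgue_stieltjes_measure /measure_extension.
by rewrite measurable_mu_extE/=; [rewrite wlength_itv_bnd|exact: is_ocitv].
Qed.

Let cond_kernel_low x (a : R) : (a < -1)%R -> cond_kernel x `]-oo, a]%classic = 0.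
Proof.
move=> a1; have a1' : (a <= 1)%R by lra.
have ma : measurable (`]-oo, a]%classic : set RR) by exact: measurable_itv.
have mab : measurable (`]a, 1%R]%classic : set RR) by exact: measurable_itv.
have : cond_kernel x (`]-oo, a]%classic `|` `]a, 1%R]%classic) <= 1.
  by apply: probability_le1; exact: measurableU.
rewrite measureU//; last first.
  apply/seteqP; split => // y []; rewrite /= !in_itv/= => ya /andP[ay _].
  by have := lt_le_trans ay ya; rewrite ltxx.
rewrite [X in _ + X <= _](cond_kernel_oc x a1').
rewrite (cond_cdf_low x a1) (cond_cdf_high x (lexx 1%R)).
rewrite subr0 => h; apply/eqP; rewrite eq_le measure_ge0 andbT.
have kfin : cond_kernel x `]-oo, a]%classic \is a fin_num by exact: fin_num_measure.
set K := cond_kernel x _ in kfin *; have {}h : K + 1%:E <= 1%:E by exact: h.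
move: kfin h; case: K => // r _.
by rewrite -EFinD !lee_fin; lra.
Qed.

Lemma cond_kernel_cdf x t : cond_kernel x `]-oo, t]%classic = (cond_cdf x t)%:E.
Proof.
have [t1|t1] := ltP t (-1)%R.
  by rewrite cond_kernel_low// /cond_cdf t1.
have -> : `]-oo, t]%classic = `]-oo, (-2)%R]%classic `|` `](-2)%R, t]%classic :> set R.
  apply/seteqP; split=> y; rewrite /= !in_itv/=.
    by move=> yt; case: (leP y (-2)%R) => h; [left|right; apply/andP].
  by case=> [h|/andP[_]//]; lra.
rewrite measureU//; last first.
  apply/seteqP; split => // y []; rewrite /= !in_itv/= => ya /andP[ay _].
  by have := lt_le_trans ay ya; rewrite ltxx.
have a2 : (-2 < -1 :> R)%R by lra.
rewrite [X in X + _](cond_kernel_low x a2).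
have t2 : (-2 <= t)%R by lra.
rewrite add0e [LHS](cond_kernel_oc x t2).
by congr EFin; rewrite {2}/cond_cdf ifT ?subr0//; lra.
Qed.

Hypothesis m_low : forall A t, measurable A -> (t < -1)%R -> slice t A = 0.
Hypothesis m_high : forall A t, measurable A -> (1 <= t)%R -> slice t A = m1 A.

Lemma cond_cdf_integral A t : measurable A ->
  \int[m1]_(x in A) (cond_cdf x t)%:E = slice t A.
Proof.
move=> mA; have [t1|t1] := ltP t (-1)%R.
  by rewrite m_low// integral0_eq// => x _; rewrite cond_cdf_low.
have [t2|t2] := leP 1%R t; last first.
  by rewrite -cdf_mid_integral//; apply: eq_integral => x _; rewrite cond_cdf_mid.
rewrite m_high// -[RHS]mul1e -integral_cst//.
by apply: eq_integral => x _; rewrite cond_cdf_high.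
Qed.

Lemma measurable_cond_cdf t : measurable_fun setT (fun x => cond_cdf x t).
Proof.
rewrite /cond_cdf; case: (t < -1)%R; first exact: measurable_cst.
by case: (1 <= t)%R; [exact: measurable_cst|exact: cdf_mid_meas].
Qed.

End conditional_cdf.

Section disintegration.
Context (R : realType).
Local Open Scope ereal_scope.

Definition disintegrates d1 d2 (X : measurableType d1) (Y : measurableType d2)
    (m : {measure set (X * Y)%type -> \bar R}) (m1 : {measure set X -> \bar R})
    (k : X -> probability Y R) :=
  pkernel k /\ forall f, measurable_fun setT f -> (forall p, 0 <= f p) ->
    \int[m]_p f p = \int[m1]_x \int[k x]_y f (x, y).

(* It suffices to test on rectangles with sides in generating pi-systems. *)
Lemma disintegrates_rectangle d1 d2 (X' : measurableType d1) (Y : measurableType d2)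
    (m : {finite_measure set (X' * Y)%type -> \bar R}) (m1 : {measure set X' -> \bar R})
    (k : X' -> probability Y R) (G : set (set Y)) :
  measurable = <<s G >> -> setI_closed G -> G setT ->
  pkernel k ->
  (forall A B, measurable A -> G B -> m (A `*` B) = \int[m1]_(x in A) k x B) ->
  disintegrates m m1 k.
Proof.
move=> mG GI GT mk mE; split=> // f mf f0.
have [M ME] := pkernel_product mk m1.
rewrite -ME//; apply: eq_measure_integral => S mS _.
pose C := [set A `*` B | A in @measurable _ X' & B in G].
have GB B : G B -> measurable B by rewrite mG; exact: sub_sigma_algebra.
have MAB A B : measurable A -> measurable B -> M (A `*` B) = \int[m1]_(x in A) k x B.
  move=> mA mB.
  transitivity (\int[M]_p (\1_(A `*` B) p)%:E).
    by rewrite integral_indic ?setIT//; exact: measurableX.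
  rewrite ME; last 2 first.
  - by apply/measurable_EFinP/measurable_indic; exact: measurableX.
  - by move=> p; rewrite lee_fin.
  rewrite [RHS]integral_mkcond; apply: eq_integral => x _.
  rewrite patchE; case: ifPn => xA.
    transitivity (\int[k x]_y (\1_B y)%:E); last by rewrite integral_indic// setIT.
    apply: eq_integral => y _.
    rewrite !indicE; congr ((nat_of_bool _)%:R%:E); apply/idP/idP => /set_mem yB.
      by apply/mem_set; case: yB.
    by apply/mem_set; split => //; exact/set_mem.
  apply: integral0_eq => y _; rewrite indicE memNset//= => -[Ax _].
  by move/negP: xA; apply; exact/mem_set.
have mMAB A B : measurable A -> measurable B -> m (A `*` B) = M (A `*` B).
  move=> mA; move: B; rewrite mG.
  pose H := [set B | measurable B /\ m (A `*` B) = M (A `*` B)].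
  suff GH : <<s G >> `<=` H by move=> B /GH[].
  have mMT : m (A `*` setT) = M (A `*` setT) by rewrite MAB// mE.
  have mfin B : measurable B -> m (A `*` B) < +oo.
    by move=> mB; rewrite ltey_eq fin_num_measure//; exact: measurableX.
  apply: lambda_system_subset => //.
    split=> //.
    + move=> B1 B2 B21 [mB1 e1] [mB2 e2]; split; first exact: measurableD.
      have E : A `*` (B1 `\` B2) = (A `*` B1) `\` (A `*` B2).
        apply/seteqP; split=> [[x y] [Ax [B1y B2y]]|[x y] [[Ax B1y] /= h]].
          by split => // -[].
        by split => //; split => // B2y; apply: h.
      have E2 : (A `*` B1) `&` (A `*` B2) = A `*` B2.
        by rewrite setIidr// => -[x y] [Ax B2y]; split => //; exact: B21.
      have [mA1 mA2] := (measurableX mA mB1, measurableX mA mB2).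
      rewrite E; rewrite (measureD mA1 mA2 (mfin _ mB1)).
      have M1 : M (A `*` B1) < +oo by rewrite -e1; exact: mfin.
      by rewrite (measureD mA1 mA2 M1) !E2; congr (_ - _); [exact: e1|exact: e2].
    + move=> F Fnd HF; have mF n : measurable (F n) by have [] := HF n.
    split; first exact: bigcupT_measurable.
    have E : A `*` \bigcup_n F n = \bigcup_n (A `*` F n) by rewrite setX_bigcupr.
    rewrite E.
    have nd : nondecreasing_seq (fun n => A `*` F n).
      move=> i j ij; apply/subsetPset => -[x y] [Ax Fy]; split => //.
      by move: Fy; apply/subsetPset/Fnd.
    have mAF i : measurable (A `*` F i) by exact: measurableX.
    have mU : measurable (\bigcup_n (A `*` F n)) by exact: bigcupT_measurable.
    have c1 := nondecreasing_cvg_mu (mu := m) mAF mU nd.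
    have c2 := nondecreasing_cvg_mu (mu := M) mAF mU nd.
    apply: cvg_unique c1 _ => //.
    suff -> : m \o (fun n => A `*` F n) = M \o (fun n => A `*` F n) by [].
    by apply/funext => n /=; have [] := HF n.
  by move=> B GB'; split; [exact: GB|rewrite MAB ?mE//; exact: GB].
apply: (measure_unique [set A `*` B | A in @measurable _ X' & B in @measurable _ Y]
  (fun=> setT)) => //.
- by rewrite measurable_prod_measurableType.
- move=> _ _ [A mA [B mB <-]] [A' mA' [B' mB' <-]].
  exists (A `&` A'); first exact: measurableI.
  by exists (B `&` B'); [exact: measurableI|rewrite setXI].
- by move=> _; exists setT => //; exists setT => //; rewrite setXTT.
- by rewrite bigcup_const//; exists 0%N.
- by move=> _ [A mA [B mB <-]]; exact: mMAB.
- by move=> _; rewrite ltey_eq fin_num_measure.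
Qed.

End disintegration.

Section transport.
Context d1 d2 (T1 : measurableType d1) (T2 : measurableType d2) (R : realType).
Local Open Scope ereal_scope.

Lemma transport_measure (m : {measure set T1 -> \bar R}) (D : set T1)
    (w : T1 -> R) (f : T1 -> T2) :
  measurable D -> measurable_fun setT w -> (forall x, 0 <= w x)%R ->
  measurable_fun setT f ->
  exists m' : {measure set T2 -> \bar R}, forall g, measurable_fun setT g ->
    (forall y, 0 <= g y) -> \int[m']_y g y = \int[m]_(x in D) ((w x)%:E * g (f x)).
Proof.
move=> mD mw w0 mf.
have w0' x : 0 <= (w x)%:E by rewrite lee_fin.
have mwg g : measurable_fun setT g -> measurable_fun D (fun x => (w x)%:E * g (f x)).
  move=> mg; apply: measurable_funTS; apply: emeasurable_funM => //.
    exact/measurable_EFinP.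
  exact: measurableT_comp.
apply: functional_measure; split.
- by move=> g mg g0; apply: integral_ge0 => x _; exact: mule_ge0.
- move=> g h mg g0 mh h0; rewrite -ge0_integralD//; last 4 first.
  + by move=> x _; exact: mule_ge0.
  + exact: mwg.
  + by move=> x _; exact: mule_ge0.
  + exact: mwg.
  by apply: eq_integral => x _; rewrite ge0_muleDr.
- move=> a g a0 mg g0; rewrite -ge0_integralZl_EFin//; last 2 first.
  + by move=> x _; exact: mule_ge0.
  + exact: mwg.
  by apply: eq_integral => x _; rewrite muleCA.
- move=> G g mG G0 Gnd Gg.
  rewrite (eq_integral (fun x => limn (fun n => (w x)%:E * G n (f x)))); last first.
    by move=> x _; apply/esym/cvg_lim => //; apply: cvgeZl => //; exact: Gg.
  apply: cvg_monotone_convergence => //.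
  + by move=> n; exact: mwg.
  + by move=> n x _; exact: mule_ge0.
  + by move=> x _ i j ij; apply: lee_wpmul2l => //; exact: Gnd.
Qed.

Lemma pushforward_measure (m : {measure set T1 -> \bar R}) (f : T1 -> T2) :
  measurable_fun setT f ->
  exists m' : {measure set T2 -> \bar R}, forall g, measurable_fun setT g ->
    (forall y, 0 <= g y) -> \int[m']_y g y = \int[m]_x g (f x).
Proof.
move=> mf.
have [m' m'E] := transport_measure m measurableT
  (measurable_cst (1 : R)%R) (fun=> ler01) mf.
by exists m' => g mg g0; rewrite m'E//; apply: eq_integral => x _; rewrite mul1e.
Qed.

End transport.

Section finite_versions.
Context d (T : measurableType d) (R : realType).
Local Open Scope ereal_scope.

Lemma finite_version (m : {measure set T -> \bar R}) : m setT < +oo ->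
  exists m' : {finite_measure set T -> \bar R}, forall A, m' A = m A.
Proof.
move=> moo; exists (mfrestr measurableT moo) => A.
by rewrite /= /mfrestr /mrestr setIT.
Qed.

Section probability_version.
Variables (m : {measure set T -> \bar R}) (m1 : m setT = 1).
Definition as_probability (A : set T) : \bar R := m A.
HB.instance Definition _ := Measure.on as_probability.
HB.instance Definition _ := @Measure_isProbability.Build _ _ _ as_probability m1.
Definition the_probability : probability T R := as_probability.
End probability_version.

Lemma probability_version (m : {measure set T -> \bar R}) : m setT = 1 ->
  exists P : probability T R, forall A, P A = m A.
Proof. by move=> m1; exists (the_probability m1). Qed.

Lemma integral_indicT (m : {measure set T -> \bar R}) A : measurable A ->
  \int[m]_x (\1_A x)%:E = m A.
Proof. by move=> mA; rewrite integral_indic// setIT. Qed.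

Lemma measure_setTE (m : {measure set T -> \bar R}) : m setT = \int[m]_x 1.
Proof. by rewrite integral_cst// mul1e. Qed.

Lemma measurable_EFin_indic (A : set T) : measurable A ->
  measurable_fun setT (fun x => (\1_A x)%:E : \bar R).
Proof. by move=> mA; apply/measurable_EFinP; exact: measurable_indic. Qed.

End finite_versions.

Lemma probability_image d1 d2 (T1 : measurableType d1) (T2 : measurableType d2)
    (R : realType) (P : probability T1 R) (f : T1 -> T2) :
  measurable_fun setT f ->
  exists Q : probability T2 R, (forall A, measurable A -> Q A = P (f @^-1` A)) /\
    forall g, measurable_fun setT g -> (forall y, 0 <= g y)%E ->
      (\int[Q]_y g y = \int[P]_x g (f x))%E.
Proof.
move=> mf; have [m mE] := pushforward_measure P mf.
have mA A : measurable A -> m A = P (f @^-1` A).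
  move=> mA; have mfA : measurable (f @^-1` A).
    by rewrite -[X in measurable X]setTI; exact: mf.
  rewrite -integral_indicT// mE.
  - by rewrite -integral_indicT.
  - exact: measurable_EFin_indic.
  - by move=> y; rewrite lee_fin.
have [|Q QE] := @probability_version _ _ _ m.
  by rewrite mA// preimage_setT probability_setT.
exists Q; split=> [A mA'|g mg g0]; first by rewrite QE mA.
by rewrite -mE//; apply: eq_measure_integral => A _ _; exact: QE.
Qed.

Lemma measurable_fun_invr (R : realType) : measurable_fun setT (@GRing.inv R).
Proof.
rewrite -(setvU [set 0]); apply/measurable_funU => //.
  by apply: measurableC; exact: measurable_set1.
split; last exact: measurable_fun_set1.
apply: open_continuous_measurable_fun.
  by apply/closed_openC; exact: closed_eq.
by move=> x /set_mem/= x0; apply: inv_continuous; exact/eqP.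
Qed.

Section disintegrable.
Context (R : realType).
Local Open Scope ereal_scope.

Definition marginal d1 d2 (X : measurableType d1) (Y : measurableType d2)
    (m : {measure set (X * Y)%type -> \bar R}) (m1 : {measure set X -> \bar R}) :=
  forall A, measurable A -> m1 A = m (A `*` setT).

Definition disintegrable d2 (Y : measurableType d2) :=
  forall d1 (X : measurableType d1) (m : {finite_measure set (X * Y)%type -> \bar R})
    (m1 : {finite_measure set X -> \bar R}),
  marginal m m1 -> exists k : X -> probability Y R, disintegrates m m1 k.

Lemma marginal_integral d1 d2 (X : measurableType d1) (Y : measurableType d2)
    (m : {measure set (X * Y)%type -> \bar R}) (m1 : {measure set X -> \bar R}) :
  marginal m m1 -> forall f, measurable_fun setT f -> (forall x, 0 <= f x) ->
  \int[m]_p f p.1 = \int[m1]_x f x.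
Proof.
move=> mm1 f mf f0.
have [m' m'E] := pushforward_measure m (@measurable_fst _ _ X Y).
rewrite -m'E//; apply: eq_measure_integral => A mA _.
rewrite mm1// -integral_indicT// m'E; last 2 first.
- exact: measurable_EFin_indic.
- by move=> y; rewrite lee_fin.
have -> : A `*` setT = @fst X Y @^-1` A by apply/seteqP; split=> [[x y] []|[x y]].
rewrite -[RHS]integral_indicT//.
by rewrite -[X in measurable X]setTI; exact: measurable_fst.
Qed.

Lemma integral_marginal d1 d2 (X : measurableType d1) (Y : measurableType d2)
    (m : {measure set (X * Y)%type -> \bar R}) (m1 : {measure set X -> \bar R}) :
  (forall f, measurable_fun setT f -> (forall x, 0 <= f x) ->
    \int[m]_p f p.1 = \int[m1]_x f x) -> marginal m m1.
Proof.
move=> mm1 A mA; rewrite -integral_indicT// -mm1; last 2 first.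
- exact: measurable_EFin_indic.
- by move=> y; rewrite lee_fin.
have -> : A `*` setT = @fst X Y @^-1` A by apply/seteqP; split=> [[x y] []|[x y]].
rewrite -[RHS]integral_indicT//.
by rewrite -[X in measurable X]setTI; exact: measurable_fst.
Qed.

Lemma pkernel_image d1 d2 d3 (X : measurableType d1) (Y : measurableType d2)
    (Z : measurableType d3) (k : X -> probability Y R) (f : Y -> Z) :
  pkernel k -> measurable_fun setT f ->
  exists k' : X -> probability Z R, pkernel k' /\ forall x g,
    measurable_fun setT g -> (forall z, 0 <= g z) ->
    \int[k' x]_z g z = \int[k x]_y g (f y).
Proof.
move=> mk mf; have /choice[k' k'E] := fun x => probability_image (k x) mf.
exists k'; split=> [U mU|x g mg g0]; last by have [_ ->] := k'E x.
rewrite (_ : (fun x => _) = fun x => k x (f @^-1` U)).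
  by apply: mk; rewrite -[X in measurable X]setTI; exact: mf.
by apply/funext => x; have [->] := k'E x.
Qed.

Lemma disintegrable_retract d2 d3 (Y : measurableType d2) (Z : measurableType d3)
    (c : Y -> Z) (r : Z -> Y) :
  measurable_fun setT c -> measurable_fun setT r -> cancel c r ->
  disintegrable Z -> disintegrable Y.
Proof.
move=> mc mr crK dZ d1 X m m1 mm1.
have mic : measurable_fun setT (fun p : X * Y => (p.1, c p.2)).
  apply/measurable_fun_pair; first exact: measurable_fst.
  exact: measurableT_comp.
have [m' m'E] := pushforward_measure m mic.
have [|m'' m''E] := @finite_version _ _ _ m'.
  by rewrite measure_setTE m'E// integral_cst// mul1e ltey_eq fin_num_measure.
have {m'E} m''E' g : measurable_fun setT g -> (forall p, 0 <= g p) ->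
    \int[m'']_p g p = \int[m]_p g (p.1, c p.2).
  by move=> mg g0; rewrite -m'E//; apply: eq_measure_integral => A _ _; exact: m''E.
have [|k [mk kE]] := dZ _ X m'' m1.
  apply: integral_marginal => f mf f0; rewrite m''E'//.
    exact: marginal_integral.
  exact: measurableT_comp.
have [k' [mk' k'E]] := pkernel_image mk mr.
exists k'; split => // f mf f0.
transitivity (\int[m'']_p f (p.1, r p.2)).
  rewrite m''E'//=.
    by apply: eq_integral => -[x y] _ /=; rewrite crK.
  apply: measurableT_comp => //; apply/measurable_fun_pair; first exact: measurable_fst.
  exact: measurableT_comp.
rewrite kE//; last first.
  apply: measurableT_comp => //; apply/measurable_fun_pair; first exact: measurable_fst.
  exact: measurableT_comp.
by apply: eq_integral => x _; rewrite k'E//; exact: measurableT_comp.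
Qed.

Lemma disintegrable_prod d2 d3 (Y : measurableType d2) (Z : measurableType d3) :
  disintegrable Y -> disintegrable Z -> disintegrable (Y * Z)%type.
Proof.
move=> dY dZ d1 X m m1 mm1.
have mA : measurable_fun setT (fun p : X * (Y * Z) => ((p.1, p.2.1), p.2.2)).
  apply/measurable_fun_pair; last exact: measurableT_comp.
  by apply/measurable_fun_pair; [exact: measurable_fst|exact: measurableT_comp].
have mB : measurable_fun setT (fun p : X * (Y * Z) => (p.1, p.2.1)).
  by apply/measurable_fun_pair; [exact: measurable_fst|exact: measurableT_comp].
have mC : measurable_fun setT (fun p : X * Y * Z => (p.1.1, (p.1.2, p.2))).
  apply/measurable_fun_pair; first exact: measurableT_comp.
  by apply/measurable_fun_pair; [exact: measurableT_comp|exact: measurable_snd].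
have [M ME] := pushforward_measure m mA.
have [|M' M'E] := @finite_version _ _ _ M.
  by rewrite measure_setTE ME// integral_cst// mul1e ltey_eq fin_num_measure.
have {ME} {}M'E g : measurable_fun setT g -> (forall p, 0 <= g p) ->
    \int[M']_p g p = \int[m]_p g ((p.1, p.2.1), p.2.2).
  by move=> mg g0; rewrite -ME//; apply: eq_measure_integral => A _ _; exact: M'E.
have [N NE] := pushforward_measure m mB.
have [|N' N'E] := @finite_version _ _ _ N.
  by rewrite measure_setTE NE// integral_cst// mul1e ltey_eq fin_num_measure.
have {NE} {}N'E g : measurable_fun setT g -> (forall p, 0 <= g p) ->
    \int[N']_p g p = \int[m]_p g (p.1, p.2.1).
  by move=> mg g0; rewrite -NE//; apply: eq_measure_integral => A _ _; exact: N'E.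
have [|k2 [mk2 k2E]] := dZ _ (X * Y)%type M' N'.
  apply: integral_marginal => f mf f0; rewrite M'E ?N'E//.
  exact: measurableT_comp.
have [|k1 [mk1 k1E]] := dY _ X N' m1.
  apply: integral_marginal => f mf f0; rewrite N'E//; last exact: measurableT_comp.
  exact: marginal_integral.
have mk2x x : pkernel (fun y => k2 (x, y)).
  move=> U mU; have := mk2 U mU => /measurable_fun_pair2; exact.
have /choice[k kE] x : exists P : probability (Y * Z)%type R,
    forall f, measurable_fun setT f -> (forall p, 0 <= f p) ->
      \int[P]_p f p = \int[k1 x]_y \int[k2 (x, y)]_z f (y, z).
  have [Q QE] := pkernel_product (mk2x x) (k1 x).
  have [|P PE] := @probability_version _ _ _ Q.
    rewrite measure_setTE QE// (eq_integral (cst 1)) => [|y _].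
      by rewrite integral_cst// mul1e; exact: probability_setT.
    by rewrite integral_cst// mul1e; exact: probability_setT.
  by exists P => f mf f0; rewrite -QE//; apply: eq_measure_integral => A _ _; exact: PE.
exists k; split=> [U mU|f mf f0].
  have mUf : measurable_fun setT (fun p : X * Y * Z => (\1_U (p.1.2, p.2))%:E : \bar R).
    have mD : measurable_fun setT (fun p : X * Y * Z => (p.1.2, p.2)).
      by apply/measurable_fun_pair; [exact: measurableT_comp|exact: measurable_snd].
    rewrite (_ : (fun p => _) = (fun q => (\1_U q)%:E) \o
      (fun p : X * Y * Z => (p.1.2, p.2)))//.
    apply: measurableT_comp => //; exact: measurable_EFin_indic.
  rewrite (_ : (fun x => _) =
      fun x => \int[k1 x]_y \int[k2 (x, y)]_z (\1_U (y, z))%:E).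
    apply: (measurable_pkernel_integral mk1
      (f := fun p => \int[k2 p]_z (\1_U (p.2, z))%:E)) => [|p].
      apply: (measurable_pkernel_integral mk2
        (f := fun p : X * Y * Z => (\1_U (p.1.2, p.2))%:E)) => //.
    by apply: integral_ge0 => z _; rewrite lee_fin.
  apply/funext => x; rewrite -integral_indicT// kE//.
  exact: measurable_EFin_indic.
transitivity (\int[M']_p f (p.1.1, (p.1.2, p.2))).
  rewrite M'E//; last exact: measurableT_comp mC.
  by apply: eq_integral => -[x [y z]].
rewrite k2E//; last exact: measurableT_comp mC.
rewrite k1E; last 2 first.
- apply: (measurable_pkernel_integral mk2
    (f := fun p : X * Y * Z => f (p.1.1, (p.1.2, p.2)))) => //.
  exact: measurableT_comp mC.
- by move=> p; exact: integral_ge0.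
apply: eq_integral => x _ /=; rewrite kE//.
exact: measurable_fun_pair2.
Qed.

Let RR := measurableTypeR R.

Let Gray (B : set RR) := B = setT \/ exists t : R, B = `]-oo, t]%classic.

Let Gray_generates : @measurable _ RR = <<s Gray >>.
Proof.
apply/seteqP; split.
  apply: smallest_sub; first exact: smallest_sigma_algebra.
  move=> _ [[a b] _ <-]; have -> : `]a, b]%classic = `]-oo, b]%classic `\` `]-oo, a]%classic.
    apply/seteqP; split=> y; rewrite /= !in_itv/=.
      by move=> /andP[ay yb]; split => //; apply/negP; rewrite -ltNge.
    by move=> [-> /negP]; rewrite -ltNge andbT.
  by apply: (@measurableD _ (g_sigma_algebraType Gray));
    apply: sub_sigma_algebra; right; eexists.
apply: smallest_sub; first exact: sigma_algebra_measurable.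
by move=> _ [->//|[t ->]]; exact: measurable_itv.
Qed.

Let Gray_setI : setI_closed Gray.
Proof.
move=> _ _ [->|[s ->]] [->|[t ->]]; rewrite ?setTI ?setIT.
- by left.
- by right; exists t.
- by right; exists s.
right; exists (Num.min s t); apply/seteqP.
by split=> y; rewrite /= !in_itv/= le_min => /andP.
Qed.

Lemma disintegrable_RR : disintegrable RR.
Proof.
move=> d1 X m0 m1 mm01.
pose c (y : RR) : RR := (y / (1 + `|y|))%R.
pose r (y : RR) : RR := (y / (1 - `|y|))%R.
have c1 y : (`|c y| < 1)%R.
  rewrite /c normrM normfV (ger0_norm (_ : 0 <= 1 + `|y|)%R) ?addr_ge0//.
  by rewrite ltr_pdivrMr ?ltr_pwDl// mul1r ltrDr.
have crK : cancel c r.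
  move=> y; rewrite /r /c normrM normfV (ger0_norm (_ : 0 <= 1 + `|y|)%R) ?addr_ge0//.
  have y0 : (1 + `|y| != 0)%R by rewrite gt_eqF// ltr_pwDl.
  have -> : (1 - `|y| / (1 + `|y|) = (1 + `|y|)^-1)%R by field.
  by rewrite invrK divfK.
have mc : measurable_fun setT c.
  apply: measurable_funM => //; apply: (measurableT_comp (@measurable_fun_invr R)).
  by apply: measurable_funD => //; exact: normr_measurable.
have mr : measurable_fun setT r.
  apply: measurable_funM => //; apply: (measurableT_comp (@measurable_fun_invr R)).
  by apply: measurable_funB => //; exact: normr_measurable.
have mic : measurable_fun setT (fun p : X * RR => (p.1, c p.2)).
  apply/measurable_fun_pair; first exact: measurable_fst.
  exact: measurableT_comp.
have [m' m'E] := pushforward_measure m0 mic.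
have [|m m''E] := @finite_version _ _ _ m'.
  by rewrite measure_setTE m'E// integral_cst// mul1e ltey_eq fin_num_measure.
have {m'E m''E} mE g : measurable_fun setT g -> (forall p, 0 <= g p) ->
    \int[m]_p g p = \int[m0]_p g (p.1, c p.2).
  by move=> mg g0; rewrite -m'E//; apply: eq_measure_integral => A _ _; exact: m''E.
have mm1 : marginal m m1.
  apply: integral_marginal => f mf f0; rewrite mE//; last exact: measurableT_comp.
  exact: marginal_integral.
have mindic A : measurable A -> m A = m0 ((fun p => (p.1, c p.2)) @^-1` A).
  move=> mA; rewrite -integral_indicT// mE.
  - rewrite -[RHS]integral_indicT//.
    by rewrite -[X in measurable X]setTI; exact: mic.
  - exact: measurable_EFin_indic.
  - by move=> p; rewrite lee_fin.
have mitv t : measurable (`]-oo, t]%classic : set RR) by exact: measurable_itv.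
have low A t : measurable A -> (t < -1)%R -> slice m t A = 0.
  move=> mA t1; rewrite /slice mindic; last exact: measurableX.
  rewrite (_ : _ @^-1` _ = set0) ?measure0//.
  apply/seteqP; split => // -[x y] [_]; rewrite /= in_itv/=.
  by have := c1 y; rewrite ltr_norml => /andP[h _]; lra.
have high A t : measurable A -> (1 <= t)%R -> slice m t A = m1 A.
  move=> mA t1; rewrite mm1// /slice.
  rewrite [LHS]mindic ?[RHS]mindic//; [|exact: measurableX..].
  congr (m0 _); apply/seteqP; split => -[x y] [/= Ax] _ //; split => //=.
  by rewrite in_itv/=; have := c1 y; rewrite ltr_norml => /andP[_ h]; lra.
have kE := cond_cdf_integral mm1 low high.
have mk : pkernel (cond_kernel mm1).
  apply: (pkernelS Gray_generates Gray_setI) => _ [->|[t ->]].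
    rewrite (_ : (fun x => _) = cst 1)//; apply/funext => x; exact: probability_setT.
  rewrite (_ : (fun x => _) = EFin \o (fun x => cond_cdf m m1 x t)).
    by apply/measurable_EFinP; exact: measurable_cond_cdf.
  by apply/funext => x; exact: cond_kernel_cdf.
have dis : disintegrates m m1 (cond_kernel mm1).
  apply: (disintegrates_rectangle Gray_generates Gray_setI) => //; first by left.
  move=> A _ mA [->|[t ->]].
    rewrite -mm1// -[LHS]mul1e -integral_cst//.
    by apply: eq_integral => x _; rewrite probability_setT.
  rewrite -[LHS]kE//; apply: eq_integral => x _; exact/esym/cond_kernel_cdf.
have {mk} [k' [mk' k'E]] := pkernel_image mk mr.
exists k'; split => // f mf f0.
have mfr : measurable_fun setT (fun p : X * RR => f (p.1, r p.2)).
  apply: measurableT_comp => //; apply/measurable_fun_pair; first exact: measurable_fst.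
  exact: measurableT_comp.
transitivity (\int[m]_p f (p.1, r p.2)).
  by rewrite mE//=; apply: eq_integral => -[x y] _ /=; rewrite crK.
rewrite dis.2//.
by apply: eq_integral => x _; rewrite k'E//; exact: measurableT_comp.
Qed.

Lemma disintegrable_rV n : disintegrable (borel 'rV[R]_n).
Proof.
elim: n => [|n IH].
  move=> d1 X m m1 mm1; exists (fun=> \d_(0 : borel 'rV[R]_0))%R; split.
    by move=> U mU; exact: measurable_cst.
  move=> f mf f0; rewrite (eq_integral (fun p => f (p.1, 0%R))); last first.
    by move=> [x y] _ /=; congr (f (_, _)); apply/rowP; case.
  have mf0 : measurable_fun setT (fun x => f (x, 0%R : borel 'rV[R]_0)).
    by apply: measurableT_comp => //; exact: measurable_fun_pair.
  rewrite (marginal_integral mm1 mf0)//.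
  apply: eq_integral => x _; rewrite integral_dirac ?diracT ?mul1e//.
  exact: measurableT_comp.
apply: (disintegrable_retract (@measurable_uncons_rV R n) (@measurable_cons_rV R n)).
  exact: uncons_rVK.
exact: disintegrable_prod disintegrable_RR IH.
Qed.

End disintegrable.

HB.instance Definition _ (T1 T2 : ptopologicalType) := Pointed.on (T1 * T2)%type.

Section row_vectors.
Context (R : realType).

Lemma continuous_rV (T : topologicalType) n (f : T -> 'rV[R]_n) :
  (forall i, continuous (fun x => f x 0 i)) -> continuous f.
Proof.
move=> fc x U /nbhs_ballP[e /= e0 eU].
have : \forall y \near x, forall i, ball (f x 0 i) e (f y 0 i).
  apply: filter_forall => i.
  by have /cvg_ballP/(_ e e0) := fc i x.
by apply: filterS => y xy; apply: eU; split => // i j; rewrite ord1; exact: xy.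
Qed.

Lemma measurable_rV d (T : measurableType d) n (f : T -> borel 'rV[R]_n) :
  (forall i, measurable_fun setT (fun x => f x 0 i : measurableTypeR R)) ->
  measurable_fun setT f.
Proof.
elim: n f => [|n IH] f mf.
  rewrite (_ : f = cst (0 : 'rV_0)); first exact: measurable_cst.
  by apply/funext => x; apply/rowP; case.
rewrite (_ : f = @cons_rV R n \o (fun x => (f x 0 0, \row_j f x 0 (lift 0 j)))).
  apply: measurableT_comp; first exact: measurable_cons_rV.
  apply/measurable_fun_pair; first exact: mf.
  by apply: IH => i; under eq_fun do rewrite mxE; exact: mf.
by apply/funext => x; rewrite /= -[LHS](@uncons_rVK R n).
Qed.

End row_vectors.

(* Spaces embedded in some R^N by a continuous map c with a Borel left inverse:
   Borel structure, disintegrations and test functions are inherited from R^N.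
   The factor rho \o s makes the notion stable under products. *)
Definition borel_retract (R : realType) (T : ptopologicalType) :=
  exists N M (c : T -> 'rV[R]_N) (s : borel 'rV[R]_N -> borel 'rV[R]_M)
    (rho : 'rV[R]_M -> T),
  [/\ continuous c, measurable_fun setT s, continuous rho &
      forall x, rho (s (c x)) = x].

Lemma continuous_pairing (T U1 U2 : topologicalType) (f : T -> U1) (g : T -> U2) :
  continuous f -> continuous g -> continuous (fun x => (f x, g x)).
Proof. by move=> cf cg x; exact: (cvg_pair (cf x) (cg x)). Qed.

Lemma continuous_lsubmx (R : realType) m n :
  continuous (lsubmx : 'rV[R]_(m + n) -> 'rV[R]_m).
Proof.
by apply: continuous_rV => i; under eq_fun do rewrite mxE; exact: coord_continuous.
Qed.

Lemma continuous_rsubmx (R : realType) m n :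
  continuous (rsubmx : 'rV[R]_(m + n) -> 'rV[R]_n).
Proof.
by apply: continuous_rV => i; under eq_fun do rewrite mxE; exact: coord_continuous.
Qed.

Lemma continuous_submx (R : realType) (T1 T2 : topologicalType) m n
    (r1 : 'rV[R]_m -> T1) (r2 : 'rV[R]_n -> T2) : continuous r1 -> continuous r2 ->
  continuous (fun v : 'rV[R]_(m + n) => (r1 (lsubmx v), r2 (rsubmx v))).
Proof.
move=> cr1 cr2; apply: continuous_pairing => v.
  by apply: continuous_comp; [exact: continuous_lsubmx|exact: cr1].
by apply: continuous_comp; [exact: continuous_rsubmx|exact: cr2].
Qed.

Lemma borel_retract_prod (R : realType) (T1 T2 : ptopologicalType) :
  borel_retract R T1 -> borel_retract R T2 -> borel_retract R (T1 * T2)%type.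
Proof.
move=> [N1 [M1 [c1 [s1 [r1 [cc1 ms1 cr1 K1]]]]]].
move=> [N2 [M2 [c2 [s2 [r2 [cc2 ms2 cr2 K2]]]]]].
have ml m n : measurable_fun setT (lsubmx : borel 'rV[R]_(m + n) -> borel 'rV[R]_m).
  by apply: measurable_rV => i; under eq_fun do rewrite mxE; exact: measurable_coord.
have mr m n : measurable_fun setT (rsubmx : borel 'rV[R]_(m + n) -> borel 'rV[R]_n).
  by apply: measurable_rV => i; under eq_fun do rewrite mxE; exact: measurable_coord.
exists (N1 + N2)%N, (M1 + M2)%N, (fun p => row_mx (c1 p.1) (c2 p.2)),
  (fun v => row_mx (s1 (lsubmx v)) (s2 (rsubmx v))),
  (fun v => (r1 (lsubmx v), r2 (rsubmx v))); split.
- apply: continuous_rV => i; case: (split_ordP i) => j ->.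
    under eq_fun do rewrite row_mxEl.
    move=> p; apply: (@continuous_comp _ _ _ (fun p => c1 p.1) (fun v => v 0 j)).
      by apply: continuous_comp; [exact: cvg_fst|exact: cc1].
    exact: coord_continuous.
  under eq_fun do rewrite row_mxEr.
  move=> p; apply: (@continuous_comp _ _ _ (fun p => c2 p.2) (fun v => v 0 j)).
    by apply: continuous_comp; [exact: cvg_snd|exact: cc2].
  exact: coord_continuous.
- apply: measurable_rV => i; case: (split_ordP i) => j ->.
    under eq_fun do rewrite row_mxEl.
    apply: (measurableT_comp (measurable_coord j)).
    exact: (measurableT_comp ms1 (ml _ _)).
  under eq_fun do rewrite row_mxEr.
  apply: (measurableT_comp (measurable_coord j)).
  exact: (measurableT_comp ms2 (mr _ _)).
- exact: continuous_submx.
- by move=> [x y] /=; rewrite !row_mxKl !row_mxKr K1 K2.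
Qed.

Lemma borel_retract_rV (R : realType) n : borel_retract R 'rV[R]_n.
Proof.
by exists n, n, id, id, id; split => // x; exact: cvg_id.
Qed.

Section borel_retract_theory.
Context (R : realType).

Lemma borel_retract_disintegrable (T : ptopologicalType) :
  borel_retract R T -> disintegrable R (borel T).
Proof.
move=> [N [M [c [s [rho [cc ms crho K]]]]]].
apply: (@disintegrable_retract R _ _ (borel T) (borel 'rV[R]_N) c (rho \o s)).
- exact: continuous_measurable_borel.
- by apply: measurableT_comp => //; exact: continuous_measurable_borel.
- exact: K.
- exact: disintegrable_rV.
Qed.

Lemma borel_retract_pair (T1 T2 : ptopologicalType) :
  borel_retract R T1 -> borel_retract R T2 ->
  measurable_fun setT (id : (borel T1 * borel T2)%type -> borel (T1 * T2)%type).
Proof.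
move=> [N1 [M1 [c1 [s1 [r1 [cc1 ms1 cr1 K1]]]]]].
move=> [N2 [M2 [c2 [s2 [r2 [cc2 ms2 cr2 K2]]]]]].
pose f (p : borel T1 * borel T2) : borel 'rV[R]_(M1 + M2) :=
  row_mx (s1 (c1 p.1)) (s2 (c2 p.2)).
pose g (v : 'rV[R]_(M1 + M2)) : T1 * T2 := (r1 (lsubmx v), r2 (rsubmx v)).
have -> : (id : borel T1 * borel T2 -> borel (T1 * T2)%type) = g \o f.
  by apply/funext => -[x y]; rewrite /g /f /= row_mxKl row_mxKr K1 K2.
apply: measurableT_comp.
  by apply: continuous_measurable_borel; exact: continuous_submx.
apply: measurable_rV => i; case: (split_ordP i) => j ->.
  under eq_fun do rewrite row_mxEl.
  apply: (measurableT_comp (measurable_coord j)).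
  exact: (measurableT_comp ms1
    (measurableT_comp (continuous_measurable_borel cc1) measurable_fst)).
under eq_fun do rewrite row_mxEr.
apply: (measurableT_comp (measurable_coord j)).
exact: (measurableT_comp ms2
  (measurableT_comp (continuous_measurable_borel cc2) measurable_snd)).
Qed.

Definition lower_set (T : Type) N (c : T -> 'rV[R]_N) (q : 'rV[rat]_N) : set T :=
  [set x | forall i, c x 0 i < ratr (q 0 i)].

Definition lower_sets (T : Type) N (c : T -> 'rV[R]_N) : set (set T) :=
  [set B | B = setT \/ exists q, B = lower_set c q].

Lemma lower_sets_setI T N (c : T -> 'rV[R]_N) : setI_closed (lower_sets c).
Proof.
move=> _ _ [->|[p ->]] [->|[q ->]]; rewrite ?setTI ?setIT.
- by left.
- by right; exists q.
- by right; exists p.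
right; exists (\row_i Num.min (p 0 i) (q 0 i)); apply/seteqP; split=> x.
  move=> [xp xq] i; rewrite mxE; have := xp i; have := xq i.
  by rewrite minEle; case: ifP.
move=> xpq; split=> i; have := xpq i; rewrite mxE => /lt_le_trans; apply;
  by rewrite ler_rat ge_min lexx ?orbT.
Qed.

Lemma lower_sets_generate (T : ptopologicalType) N M (c : T -> 'rV[R]_N)
    (s : borel 'rV[R]_N -> borel 'rV[R]_M) (rho : 'rV[R]_M -> T) :
  continuous c -> measurable_fun setT s -> continuous rho ->
  (forall x, rho (s (c x)) = x) ->
  @measurable _ (borel T) = <<s lower_sets c >>.
Proof.
move=> cc ms crho K; apply/seteqP; split; last first.
  apply: smallest_sub; first exact: sigma_algebra_measurable.
  move=> _ [->|[q ->]]; first exact: measurableT.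
  rewrite (_ : lower_set _ _ = \bigcap_(i in [set: 'I_N])
      (fun x => c x 0 i) @^-1` [set y | y < ratr (q 0 i)]); last first.
    by apply/seteqP; split=> x h i; [move=> _|]; exact: h.
  apply: fin_bigcap_measurable => // i _.
  apply: borel_open; apply: open_comp; last exact: open_lt.
  move=> x _; apply: (@continuous_comp _ _ _ c (fun v => v 0 i)); first exact: cc.
  exact: coord_continuous.
apply: smallest_sub; first exact: smallest_sigma_algebra.
pose TG := g_sigma_algebraType (lower_sets c).
have mc i : measurable_fun setT (fun x : TG => c x 0 i : measurableTypeR R).
  apply: (measurability _ (RGenInftyO.measurableE R)).
  move=> _ [_ [a ->] <-]; rewrite setTI.
  pose B (p : rat * nat) := lower_set c (\row_j if j == i then p.1 else p.2%:R).
  have -> : (fun x : TG => c x 0 i) @^-1` `]-oo, a[%classic =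
      \bigcup_(p in [set p | ratr p.1 < a]) B p.
    apply/seteqP; split=> x /=; rewrite in_itv/=.
      move=> xa; have [q /[!in_itv]/= /andP[xq qa]] := rat_in_itvoo xa.
      have s0 : 0 <= \sum_j `|c x 0 j| by exact: sumr_ge0.
      exists (q, Num.bound (\sum_j `|c x 0 j|)) => //= j; rewrite mxE /=.
      case: eqP => [->//|_]; rewrite ratr_nat.
      apply: le_lt_trans (archi_boundP s0); apply: le_trans (ler_norm _) _.
      by rewrite (bigD1 j)//= lerDl sumr_ge0.
    move=> [p /= pa] /(_ i); rewrite mxE eqxx => xp; exact: lt_trans xp pa.
  rewrite bigcup_mkcond; apply: countable_bigcupT_measurable; first exact: countableP.
  move=> p; case: ifPn => _; last exact: measurable0.
  by apply: sub_sigma_algebra; right; eexists.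
have mcs : measurable_fun setT (fun x : TG => s (c x)).
  exact: (measurableT_comp ms (measurable_rV mc)).
move=> U oU; have -> : U = (fun x : TG => s (c x)) @^-1` (rho @^-1` U).
  by apply/seteqP; split=> x /=; rewrite K.
have := mcs measurableT (rho @^-1` U); rewrite setTI; apply.
by apply: borel_open; apply: open_comp => // x _; exact: crho.
Qed.

Definition lower_approx (T : Type) N (c : T -> 'rV[R]_N) (q : 'rV[rat]_N) (n : nat)
  (x : T) : R := \prod_i Num.min 1 (n%:R * Num.max 0 (ratr (q 0 i) - c x 0 i)).

Lemma lower_approx_continuous (T : topologicalType) N (c : T -> 'rV[R]_N) q n :
  continuous c -> continuous (lower_approx c q n).
Proof.
move=> cc; rewrite /lower_approx; elim: (index_enum _) => [|i s IH].
  by under eq_fun do rewrite big_nil; move=> x; exact: cvg_cst.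
under eq_fun do rewrite big_cons; move=> x; apply: cvgM; last exact: IH.
apply: (@continuous_min R T (fun=> 1)); first exact: cvg_cst.
apply: continuousM; first exact: cvg_cst.
apply: (@continuous_max R T (fun=> 0)); first exact: cvg_cst.
apply: continuousB; first exact: cvg_cst.
apply: (@continuous_comp _ _ _ c (fun v => v 0 i)); first exact: cc.
exact: coord_continuous.
Qed.

Lemma lower_approx_itv T N (c : T -> 'rV[R]_N) q n x :
  0 <= lower_approx c q n x <= 1.
Proof.
rewrite /lower_approx; apply/andP; split.
  by apply: prodr_ge0 => i _; rewrite le_min ler01/= mulr_ge0// le_max lexx.
apply: prodr_ile1 => i _.
by rewrite le_min ler01/= mulr_ge0//= ?le_max ?lexx// ge_min lexx.
Qed.

Lemma lower_approx_cvg T N (c : T -> 'rV[R]_N) q x :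
  lower_approx c q n x @[n --> \oo] --> (\1_(lower_set c q) x : R).
Proof.
apply: cvg_near_cst; rewrite indicE.
have [xq|xq] := boolP (x \in lower_set c q).
  have : \forall n \near \oo, forall i, 1 <= n%:R * Num.max 0 (ratr (q 0 i) - c x 0 i).
    apply: filter_forall => i; move/set_mem : xq => /(_ i); rewrite -subr_gt0 => h.
    apply: filterS (nbhs_infty_ger (ratr (q 0 i) - c x 0 i)^-1) => n nh.
    have := ler_wpM2r (ltW h) nh; rewrite mulVf ?lt0r_neq0//.
    by rewrite (max_r (ltW h)).
  apply: filterS => n h; rewrite /lower_approx big1// => i _.
  by apply/min_idPl; exact: h.
apply: nearW => n; move/negP: xq => xq.
have [i /negP qi] : exists i, ~ c x 0 i < ratr (q 0 i).
  by apply/existsNP => h; apply: xq; exact/mem_set.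
rewrite /lower_approx (bigD1 i)//= (_ : Num.min _ _ = 0) ?mul0r//.
have -> : Num.max 0 (ratr (q 0 i) - c x 0 i) = 0.
  by apply/max_idPl; rewrite subr_le0 leNgt.
by rewrite mulr0; apply/min_idPr.
Qed.

Lemma bounded_cvg d (T : measurableType d) (m : {finite_measure set T -> \bar R})
    (h : nat -> T -> R) (f : T -> R) :
  (forall n, measurable_fun setT (h n)) -> (forall n x, 0 <= h n x <= 1) ->
  (forall x, h n x @[n --> \oo] --> f x) ->
  (\int[m]_x (h n x)%:E @[n --> \oo] --> \int[m]_x (f x)%:E)%E.
Proof.
move=> mh h01 hf.
have mf : measurable_fun setT f by apply: measurable_fun_cvg mh _ => x _; exact: hf.
have [] := @dominated_convergence _ T R m setT measurableT (fun n x => (h n x)%:E)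
  (fun x => (f x)%:E) (cst 1%E) => //.
- by move=> n; exact/measurable_EFinP.
- exact/measurable_EFinP.
- by apply: aeW => x _; apply: cvg_EFin; [exact: nearW|exact: hf].
- exact: finite_measure_integrable_cst.
- apply: aeW => x n _; have /andP[h0 h1] := h01 n x.
  by rewrite /= lee_fin ger0_norm.
Qed.

Lemma bounded_cvg_indic d (T : measurableType d) (m : {finite_measure set T -> \bar R})
    (h : nat -> T -> R) (U : set T) : measurable U ->
  (forall n, measurable_fun setT (h n)) -> (forall n x, 0 <= h n x <= 1) ->
  (forall x, h n x @[n --> \oo] --> (\1_U x : R)) ->
  (\int[m]_x (h n x)%:E @[n --> \oo] --> m U)%E.
Proof. by move=> mU mh h01 hU; rewrite -integral_indicT//; exact: bounded_cvg. Qed.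

Lemma continuous_measurable_real (T : ptopologicalType) (h : T -> R) :
  continuous h -> measurable_fun setT (h : borel T -> R).
Proof.
move=> hc; apply: (measurability _ (RGenOpens.measurableE R)).
move=> _ [_ [a [b ->]] <-]; rewrite setTI; apply: borel_open.
by apply: open_comp => [x _|]; [exact: hc|exact: interval_open].
Qed.

Lemma finite_measure_eq_continuous (T : ptopologicalType)
    (m m' : {finite_measure set (borel T) -> \bar R}) : borel_retract R T ->
  (forall h : T -> R, continuous h -> (forall x, 0 <= h x <= 1) ->
    (\int[m]_x (h x)%:E = \int[m']_x (h x)%:E)%E) ->
  forall A, measurable A -> m A = m' A.
Proof.
move=> [N [M [c [s [rho [cc ms crho K]]]]]] mm'.
have mG := lower_sets_generate cc ms crho K.
apply: (@measure_unique _ R (borel T) (lower_sets c) (fun=> setT) mG _ _ _ m m') => //.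
- exact: lower_sets_setI.
- by move=> _; left.
- by rewrite bigcup_const//; exists 0%N.
- move=> _ [->|[q ->]].
    by rewrite !measure_setTE; apply: (mm' (fun=> 1)) => [x|x]; [exact: cvg_cst|rewrite ler01 lexx].
  have mU : measurable (lower_set c q : set (borel T)).
    by rewrite mG; apply: sub_sigma_algebra; right; exists q.
  have mh n : measurable_fun setT (lower_approx c q n : borel T -> R).
    by apply: continuous_measurable_real; exact: lower_approx_continuous.
  have h01 n x := lower_approx_itv c q n x.
  have hU x : lower_approx c q n x @[n --> \oo] --> (\1_(lower_set c q) x : R).
    exact: lower_approx_cvg.
  have c1 := bounded_cvg_indic (m := m) mU mh h01 hU.
  have c2 := bounded_cvg_indic (m := m') mU mh h01 hU.
  apply: cvg_unique c1 _ => //.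
  rewrite (_ : (fun n => _) = (fun n => (\int[m']_x (lower_approx c q n x)%:E)%E))//.
  by apply/funext => n; apply: mm' => //; exact: lower_approx_continuous.
- by move=> _; rewrite ltey_eq fin_num_measure.
Qed.

End borel_retract_theory.

Section torus_retract.
Context (R : realType).

Definition dist_int (x : R) : R :=
  Num.min (x - (Num.floor x)%:~R) ((Num.floor x + 1)%:~R - x).

Lemma dist_int_le x (k : int) : dist_int x <= `|x - k%:~R|.
Proof.
have /andP[f1 f2] := floor_itv x; rewrite /dist_int.
have [xk|kx] := leP k (Num.floor x).
  rewrite ge_min; apply/orP; left; apply: le_trans (ler_norm _).
  by rewrite lerD2l lerN2 ler_int.
rewrite ge_min; apply/orP; right; rewrite distrC; apply: le_trans (ler_norm _).
by rewrite lerD2r ler_int lezD1.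
Qed.

Lemma dist_int_ex x : exists k : int, dist_int x = `|x - k%:~R|.
Proof.
have /andP[f1 f2] := floor_itv x; rewrite /dist_int.
have [h|h] := leP (x - (Num.floor x)%:~R) ((Num.floor x + 1)%:~R - x).
  by exists (Num.floor x); rewrite ger0_norm// subr_ge0.
by exists (Num.floor x + 1); rewrite distrC ger0_norm// subr_ge0 ltW.
Qed.

Lemma dist_int_lipschitz x y : `|dist_int x - dist_int y| <= `|x - y|.
Proof.
have le a b : dist_int a - dist_int b <= `|a - b|.
  have [k ->] := dist_int_ex b; rewrite lerBlDr.
  apply: le_trans (dist_int_le a k) _.
  by rewrite -(subrKA b a) ; exact: ler_normD.
by rewrite ler_norml lerNl opprB le andbT distrC le.
Qed.

Lemma dist_int_continuous a : continuous (fun x => dist_int (x - a)).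
Proof.
move=> x; apply/cvgrPdist_lt => e e0; near=> y.
apply: le_lt_trans (dist_int_lipschitz _ _) _; rewrite opprB addrA subrK.
by near: y; have /cvgrPdist_lt := @cvg_id _ (nbhs x); exact.
Unshelve. all: by end_near. Qed.

Lemma dist_int_continuous0 : continuous dist_int.
Proof.
have := @dist_int_continuous 0.
by rewrite (_ : (fun x => _) = dist_int)//; apply/funext => x; rewrite subr0.
Qed.

Lemma dist_int_cong x y : x - y \is a Num.int -> dist_int x = dist_int y.
Proof.
have le a b : a - b \is a Num.int -> dist_int a <= dist_int b.
  move=> /intrP[n ab]; have [k ->] := dist_int_ex b.
  have -> : b - k%:~R = a - (n + k)%:~R by rewrite intrD -ab; ring.
  exact: dist_int_le.
by move=> xy; apply/eqP; rewrite eq_le !le// -rpredN opprB.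
Qed.

Lemma dist_int_inj x y : dist_int x = dist_int y ->
  x - y \is a Num.int \/ x + y \is a Num.int.
Proof.
have [k ->] := dist_int_ex x; have [l ->] := dist_int_ex y.
move=> /eqP; rewrite eqr_norm2 => /orP[/eqP h|/eqP h].
  left; have -> : x - y = (k - l)%:~R by rewrite intrD mulrNz; lra.
  exact: intr_int.
right; have -> : x + y = (k + l)%:~R by rewrite intrD; lra.
exact: intr_int.
Qed.

(* A point x of the circle is recovered from its distances to 0 and 1/4: the
   first one determines it up to sign. *)
Definition circle_point (u v : R) : R := if dist_int (u - 4^-1) == v then u else - u.

Lemma circle_pointP x :
  circle_point (dist_int x) (dist_int (x - 4^-1)) - x \is a Num.int.
Proof.
rewrite /circle_point; set u := dist_int x.
have ux : u - x \is a Num.int \/ u + x \is a Num.int.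
  rewrite /u; have [k ->] := dist_int_ex x.
  have [h|h] := leP 0 (x - k%:~R).
    left; rewrite ger0_norm// addrAC subrr sub0r -intrN; exact: intr_int.
  right; rewrite ltr0_norm// opprB subrK; exact: intr_int.
case: eqP => [/dist_int_inj e|ne].
  case: ux => // ux'; case: e => e.
    by have -> : u - x = u - 4^-1 - (x - 4^-1) by ring.
  have : 2^-1 \is a @Num.int R.
    have -> : 2^-1 = (u + x) - (u - 4^-1 + (x - 4^-1)) :> R by field.
    by rewrite rpredB.
  move=> /intrP[n hn]; have : (n * 2)%:~R = 1%:~R :> R by rewrite intrM -hn mulVf.
  by move=> /intr_inj; case: n {hn} => -[|[|n]].
case: ux => [ux|ux]; last by rewrite -opprD rpredN.
by exfalso; apply: ne; apply: dist_int_cong; rewrite opprB addrA subrK.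
Qed.

Lemma borel_retract_torus d : borel_retract R (torus R d).
Proof.
pose c0 (x : 'rV[R]_d) : 'rV[R]_(d + d) :=
  row_mx (map_mx dist_int x) (\row_i dist_int (x 0 i - 4^-1)).
exists (d + d)%N, d, (c0 \o repr),
  (fun w : borel 'rV[R]_(d + d) => \row_i circle_point (w 0 (lshift d i)) (w 0 (rshift d i))),
  (\pi_(torus R d)%qT); split.
- apply: repr_comp_continuous.
    apply: continuous_rV => i; case: (split_ordP i) => j ->.
      under eq_fun do rewrite row_mxEl mxE.
      move=> x; apply: (@continuous_comp _ _ _ (fun v : 'rV[R]_d => v 0 j) dist_int).
        exact: coord_continuous.
      exact: dist_int_continuous0.
    under eq_fun do rewrite row_mxEr mxE.
    move=> x.
    apply: (@continuous_comp _ _ _ (fun v : 'rV[R]_d => v 0 j)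
      (fun t => dist_int (t - 4^-1))); first exact: coord_continuous.
    exact: dist_int_continuous.
  move=> x y /eqP xy; apply/eqP.
  have /eqmodP/forallP xy' := xy.
  rewrite /c0; congr row_mx; apply/rowP => i; rewrite !mxE; apply: dist_int_cong.
    exact: xy'.
  by rewrite opprB addrA subrK; exact: xy'.
- apply: measurable_rV => i; under eq_fun do rewrite mxE.
  have mD : measurable_fun setT (dist_int : measurableTypeR R -> measurableTypeR R).
    exact: continuous_measurable_fun dist_int_continuous0.
  have mu : measurable_fun setT (fun w : borel 'rV[R]_(d + d) =>
      w 0 (lshift d i) : measurableTypeR R) := measurable_coord _.
  have mv : measurable_fun setT (fun w : borel 'rV[R]_(d + d) =>
      w 0 (rshift d i) : measurableTypeR R) := measurable_coord _.
  rewrite /circle_point; apply: measurable_fun_ifT.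
  - apply: measurable_fun_eqr => //; apply: measurableT_comp mD _.
    by apply: measurable_funB.
  - exact: mu.
  - by apply: measurable_funN.
- exact: pi_continuous.
- move=> xi; rewrite -[RHS]reprK; apply/eqmodP/forallP => i.
  by rewrite mxE /= row_mxEl row_mxEr !mxE; exact: circle_pointP.
Qed.

End torus_retract.

Section euclidean.
Context (R : realType) (E : normedModType R).

(* Gram-Schmidt; only the expansion property of the family is recorded. *)
Lemma euclidean_coordinates : euclidean_space E ->
  exists N (c : E -> 'rV[R]_N) (b : 'I_N -> E),
    (forall x, x = \sum_i c x 0 i *: b i) /\
    (forall x y i, `|c x 0 i - c y 0 i| <= `|x - y|).
Proof.
move=> [[dot [dotl dotC dotn]] [n [b0 span]]].
have dot0 y : dot 0 y = 0.
  by have := dotl 1 0 0 y; rewrite scaler0 addr0 mul1r => h; lra.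
have dotD x y z : dot (x + y) z = dot x z + dot y z.
  by have := dotl 1 x y z; rewrite scale1r mul1r.
have dotZ a x z : dot (a *: x) z = a * dot x z.
  by have := dotl a x 0 z; rewrite !addr0 dot0 addr0.
have dotB x y z : dot (x - y) z = dot x z - dot y z.
  by rewrite -scaleN1r dotD dotZ mulN1r.
have dot_sum (J : Type) (s : seq J) (F : J -> E) z :
    dot (\sum_(i <- s) F i) z = \sum_(i <- s) dot (F i) z.
  elim: s => [|i s IH]; first by rewrite !big_nil.
  by rewrite !big_cons dotD IH.
pose P (t : seq E) x := \sum_(e <- t) dot x e *: e.
have PE t x y : dot (P t x) y = dot x (P t y).
  rewrite [RHS]dotC /P !dot_sum; apply: eq_bigr => e _.
  by rewrite !dotZ [dot e y]dotC [dot e x]dotC mulrC.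
have cs x e : dot e e = 1 -> `|dot x e| <= `|x|.
  move=> e1; have := dotn (x - dot x e *: e).
  have -> : dot (x - dot x e *: e) (x - dot x e *: e) = `|x| ^+ 2 - dot x e ^+ 2.
    rewrite dotB dotZ (dotC x) (dotC e) !dotB !dotZ e1 -dotn (dotC e x); ring.
  move=> h; have := sqr_ge0 `|x - dot x e *: e|; rewrite h subr_ge0 => h2.
  by rewrite -ler_sqr ?nnegrE// real_normK ?num_real.
have gs (s : seq E) : exists t : seq E, [/\ forall e, e \in t -> dot e e = 1,
    forall e, e \in t -> P t e = e & forall y, y \in s -> P t y = y].
  elim: s => [|y s [t [t1 t2 t3]]]; first by exists [::].
  pose w := y - P t y.
  have wt e : e \in t -> dot w e = 0.
    by move=> et; rewrite dotB PE t2// subrr.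
  have [w0|w0] := eqVneq w 0.
    exists t; split => // z; rewrite in_cons => /predU1P[->|]; last exact: t3.
    by apply/eqP; rewrite eq_sym -subr_eq0; exact/eqP.
  have nw : `|w| != 0 by rewrite normr_eq0.
  pose e' := `|w|^-1 *: w.
  have e'1 : dot e' e' = 1.
    by rewrite dotZ dotC dotZ -dotn; field.
  have e't e : e \in t -> dot e e' = 0.
    by move=> et; rewrite dotC dotZ wt// mulr0.
  have Pe' x : P t x = x -> dot x e' = 0.
    move=> <-; rewrite /P dot_sum big_seq big1// => e et.
    by rewrite dotZ e't// mulr0.
  have PC x : P (e' :: t) x = dot x e' *: e' + P t x by rewrite /P big_cons.
  exists (e' :: t); split.
  - by move=> e; rewrite in_cons => /predU1P[->|]; [|exact: t1].
  - move=> e; rewrite in_cons PC => /predU1P[->|et].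
      rewrite e'1 scale1r [P t e'](_ : _ = 0) ?addr0//.
      by rewrite /P big_seq big1// => f ft; rewrite dotC e't// scale0r.
    by rewrite e't// scale0r add0r t2.
  - move=> z; rewrite in_cons PC => /predU1P[->|zs]; last first.
      by rewrite Pe' ?t3// scale0r add0r.
    have -> : dot y e' = `|w|.
      have -> : y = w + P t y by rewrite subrK.
      rewrite dotD PE [P t e'](_ : _ = 0); last first.
        by rewrite /P big_seq big1// => e et; rewrite dotC e't// scale0r.
      rewrite (dotC y) dot0 addr0 dotC dotZ -dotn expr2 mulKf//.
    by rewrite /e' scalerA divff// scale1r subrK.
have [t [t1 t2 t3]] := gs (codom b0).
have PT x : P t x = x.
  have [a ->] := span x; rewrite /P.
  have Plin (J : Type) (s : seq J) (F : J -> E) : P t (\sum_(i <- s) F i) = \sum_(i <- s) P t (F i).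
    rewrite /P exchange_big/=; apply: eq_bigr => e _.
    by rewrite dot_sum scaler_suml.
  rewrite -/(P t _) Plin; apply: eq_bigr => i _.
  have {2}<- : P t (b0 i) = b0 i by apply: t3; exact: codom_f.
  by rewrite /P scaler_sumr; apply: eq_bigr => e _; rewrite dotZ scalerA.
exists (size t), (fun x => \row_i dot x (tnth (in_tuple t) i)), (tnth (in_tuple t)); split.
  move=> x; rewrite -{1}(PT x) /P big_tnth; apply: eq_bigr => i _.
  by rewrite mxE.
move=> x y i; rewrite !mxE -dotB; apply: cs; apply: t1; exact: mem_tnth.
Qed.

Lemma continuous_lincomb N (b : 'I_N -> E) :
  continuous (fun v : 'rV[R]_N => \sum_i v 0 i *: b i).
Proof.
elim: (index_enum _) => [|i s IH].
  rewrite (_ : (fun v => _) = cst 0); first exact: cst_continuous.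
  by apply/funext => v; rewrite big_nil.
rewrite (_ : (fun v : 'rV[R]_N => _) =
  fun v : 'rV[R]_N => v 0 i *: b i + \sum_(j <- s) v 0 j *: b j).
  move=> x; have h : (fun v : 'rV[R]_N => v 0 i) @ x --> x 0 i.
    exact: coord_continuous.
  have h1 : v 0 i *: b i @[v --> x] --> x 0 i *: b i by exact: cvgZr_tmp h.
  exact: (@cvgD _ _ _ (nbhs x) _ (fun v : 'rV[R]_N => v 0 i *: b i)
    (fun v : 'rV[R]_N => \sum_(j <- s) v 0 j *: b j) _ _ h1 (IH x)).
by apply/funext => v; rewrite big_cons.
Qed.

Lemma borel_retract_euclidean : euclidean_space E -> borel_retract R E.
Proof.
move=> /euclidean_coordinates[N [c [b [cE cl]]]].
exists N, N, c, id, (fun v => \sum_i v 0 i *: b i); split.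
- apply: continuous_rV => i x; apply/cvgrPdist_lt => e e0; near=> y.
  apply: le_lt_trans (cl x y i) _.
  by near: y; have /cvgrPdist_lt := @cvg_id _ (nbhs x); exact.
- exact: measurable_id.
- exact: continuous_lincomb.
- by move=> x; rewrite -cE.
Unshelve. all: by end_near. Qed.

Lemma closed_unit_ball : closed [set z : E | `|z| <= 1].
Proof.
rewrite (_ : [set z | _] = (fun z : E => `|z|) @^-1` [set r | r <= 1])//.
by apply: closed_comp; [move=> z _; exact: norm_continuous|exact: closed_le].
Qed.

Lemma compact_unit_ball : euclidean_space E -> compact [set z : E | `|z| <= 1].
Proof.
move=> /euclidean_coordinates[N [c [b [cE cl]]]].
pose C := [set v : 'rV[R]_N | forall i, `[- (`|c 0 0 i| + 1), `|c 0 0 i| + 1]%classic (v ord0 i)].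
have cC : compact C.
  by apply: (@rV_compact R N (fun i => `[- (`|c 0 0 i| + 1), `|c 0 0 i| + 1]%classic)) => i;
    exact: segment_compact.
have cF : compact ((fun v : 'rV[R]_N => \sum_i v 0 i *: b i) @` C).
  apply: continuous_compact => //; apply: continuous_subspaceT.
  exact: continuous_lincomb.
apply: (subclosed_compact closed_unit_ball cF) => z /= z1; exists (c z) => //.
move=> i; rewrite /= in_itv/= -ler_norml -(subrK (c 0 0 i) (c z 0 i)) addrC.
apply: le_trans (ler_normD _ _) _; rewrite lerD2l.
by apply: le_trans (cl _ _ _) _; rewrite subr0.
Qed.

Lemma frontier_unit_ball : frontier (@unit_ball R E) = [set z | `|z| = 1].
Proof.
rewrite /frontier /unit_ball closure_ballE closed_ballE//.
have /interior_id -> : open (ball (0 : E) 1) by exact: ball_open.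
apply/seteqP; split=> z; rewrite /closed_ball_ -ball_normE/= sub0r normrN.
  by move=> [z1 /negP]; rewrite -leNgt => z2; apply/le_anti/andP.
by move=> ->; split => //; rewrite ltxx.
Qed.

End euclidean.

Section charge_integrals.
Context d (T : measurableType d) (R : realType).
Local Open Scope ereal_scope.
Implicit Types (mu : {charge set T -> \bar R}).

Lemma charge_integralP mu : exists p n : {finite_measure set T -> \bar R},
  [/\ forall A, measurable A -> mu A = p A - n A,
      forall A, measurable A -> (forall B, measurable B -> B `<=` A -> mu B = 0) ->
        p A = 0 /\ n A = 0,
      (forall A, measurable A -> 0 <= mu A) -> forall A, measurable A -> n A = 0 &
      forall D f, charge_integral mu D f = (\int[p]_(x in D) f x - \int[n]_(x in D) f x)%R].
Proof.
rewrite /charge_integral; case: cid => P /= hP; case: (cid _) => N /= PN.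
exists (jordan_pos PN), (jordan_neg PN).
have [[mP _] [mN Nneg] _ _] := PN.
have posE A : measurable A -> jordan_pos PN A = mu (A `&` P).
  by move=> mA; rewrite jordan_posE /= /crestr0 mem_set.
have negE A : measurable A -> jordan_neg PN A = - mu (A `&` N).
  by move=> mA; rewrite jordan_negE cjordan_negE /= /crestr0 mem_set.
split=> //.
- move=> A mA; rewrite (jordan_decomp PN mA) /cadd/= cscaleN1.
  by [].
- move=> A mA A0; split; [apply: etrans (posE _ mA) _|apply: etrans (negE _ mA) _].
    by apply: A0; [exact: measurableI|exact: subIsetl].
  by rewrite A0 ?oppe0//; exact: measurableI.
- move=> mu0 A mA; apply: etrans (negE _ mA) _; apply/eqP; rewrite eq_le; apply/andP; split.
    by rewrite leeNl oppe0 mu0//; exact: measurableI.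
  by rewrite leeNr oppe0; apply: Nneg; [exact: measurableI|exact: subIsetr].
Qed.

Lemma charge_integralE mu (m : {finite_measure set T -> \bar R}) :
  (forall A, measurable A -> mu A = m A) ->
  forall D f, charge_integral mu D f = (\int[m]_(x in D) f x)%R.
Proof.
move=> mum D f; have [p [n [mupn _ n0 ->]]] := charge_integralP mu.
have {}n0 A : measurable A -> n A = 0 by apply: n0 => B mB; rewrite mum.
rewrite /Rintegral [X in (_ - fine X)%R](_ : _ = 0) ?subr0.
  congr fine; apply: eq_measure_integral => A mA _.
  by have := mupn A mA; rewrite mum// n0// sube0 => /esym.
rewrite (@eq_measure_integral _ _ _ _ mzero); last by move=> A mA _; exact: n0.
exact: integral_measure_zero.
Qed.

End charge_integrals.

Section charge_uniqueness.
Context (R : realType) (T : ptopologicalType).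
Local Open Scope ereal_scope.

Lemma charge_eq_continuous (mu mu' : {charge set (borel T) -> \bar R}) (K : set T) :
  borel_retract R T -> closed K ->
  (forall A : set (borel T), measurable A -> K `&` A = set0 -> mu A = 0) ->
  (forall A : set (borel T), measurable A -> K `&` A = set0 -> mu' A = 0) ->
  (forall h : T -> R, continuous h -> (forall x, 0 <= h x <= 1)%R ->
    charge_integral mu K h = charge_integral mu' K h) ->
  forall A, measurable A -> mu A = mu' A.
Proof.
move=> Tr cK muK mu'K mumu'.
have [p [n [mupn pn0 _ mui]]] := charge_integralP mu.
have [p' [n' [mupn' pn0' _ mui']]] := charge_integralP mu'.
have mK : measurable (K : set (borel T)).
  by rewrite -(setCK K); apply: measurableC; apply: borel_open; exact: closed_openC.
have mKC : measurable (~` K : set (borel T)) by exact: measurableC.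
have K0 (nu : {charge set (borel T) -> \bar R}) :
    (forall A : set (borel T), measurable A -> K `&` A = set0 -> nu A = 0) ->
    forall B : set (borel T), measurable B -> B `<=` (~` K : set (borel T)) -> nu B = 0.
  move=> nuK B mB BK; apply: nuK => //.
  by apply/seteqP; split => // x [Kx /BK].
have [p0 n0] := pn0 _ mKC (K0 _ muK); have [p0' n0'] := pn0' _ mKC (K0 _ mu'K).
pose a := measure_add p n'; pose b := measure_add p' n.
have aE0 A : a A = p A + n' A by exact: measure_addE.
have bE0 A : b A = p' A + n A by exact: measure_addE.
have [|a' aE] := @finite_version _ _ _ a.
  suff : p setT + n' setT < +oo by rewrite -aE0.
  by rewrite lte_add_pinfty// ltey_eq fin_num_measure.
have [|b' bE] := @finite_version _ _ _ b.
  suff : p' setT + n setT < +oo by rewrite -bE0.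
  by rewrite lte_add_pinfty// ltey_eq fin_num_measure.
have h_int (q : {finite_measure set (borel T) -> \bar R}) (h : T -> R) :
    continuous h -> (forall x, 0 <= h x <= 1)%R -> q (~` K) = 0 ->
    \int[q]_x (h x)%:E = (\int[q]_(x in K) h x)%R%:E.
  move=> hc h01 q0.
  have mh : measurable_fun setT (EFin \o (h : borel T -> R)).
    by apply/measurable_EFinP; exact: continuous_measurable_real.
  have h0 x : 0 <= (h x)%:E by have /andP[] := h01 x; rewrite lee_fin.
  rewrite (ge0_negligible_integral mKC) ?setTD ?setCK//.
  rewrite /Rintegral fineK// ge0_fin_numE; last by exact: integral_ge0.
  apply: (@le_lt_trans _ _ (\int[q]_(x in K) 1)).
    apply: ge0_le_integral => //.
    - exact: measurable_funTS.
    - by move=> x _; have /andP[_] := h01 x; rewrite lee_fin.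
  by rewrite integral_cst// mul1e ltey_eq fin_num_measure.
have ab A : measurable A -> a' A = b' A.
  apply: (finite_measure_eq_continuous Tr) => h hc h01.
  have mh : measurable_fun setT (EFin \o (h : borel T -> R)).
    by apply/measurable_EFinP; exact: continuous_measurable_real.
  have h0 x : 0 <= (h x)%:E by have /andP[] := h01 x; rewrite lee_fin.
  transitivity (\int[a]_x (h x)%:E).
    by apply: eq_measure_integral => B _ _; exact: aE.
  transitivity (\int[b]_x (h x)%:E); last first.
    by apply: eq_measure_integral => B _ _; exact/esym/bE.
  rewrite !ge0_integral_measure_add// !h_int// -!EFinD; congr EFin.
  have := mumu' h hc h01; rewrite mui mui'; lra.
move=> A mA; have : p A + n' A = p' A + n A.
  by rewrite -aE0 -bE0; exact: etrans (etrans (esym (aE A)) (ab A mA)) (bE A).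
rewrite mupn// mupn'//.
have fin (q : {finite_measure set (borel T) -> \bar R}) : q A \is a fin_num.
  exact: fin_num_measure.
rewrite -(fineK (fin p)) -(fineK (fin n)) -(fineK (fin p')) -(fineK (fin n')).
by rewrite -!EFinB -!EFinD => -[h]; congr EFin; lra.
Qed.

End charge_uniqueness.

Lemma compact_closure_bounded (R : realType) d (Omega : set 'rV[R]_d) :
  bounded_set Omega -> compact (closure Omega).
Proof.
move=> Ob; apply: bounded_closed_compact; last exact: closed_closure.
have [M [Mr hM]] := Ob; exists M; split => // r Mr' x Ox.
have cB : closed [set x : 'rV[R]_d | `|x| <= r].
  rewrite (_ : [set x | _] = (fun z : 'rV[R]_d => `|z|) @^-1` [set r' | r' <= r])//.
  by apply: closed_comp; [move=> z _; exact: norm_continuous|exact: closed_le].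
move/closure_id : cB => /= cB; suff : [set x : 'rV[R]_d | `|x| <= r] x by [].
rewrite cB; apply: closure_subset Ox => y Oy; exact: hM.
Qed.

Lemma compact_torus (R : realType) d : compact [set: torus R d].
Proof.
have cC := @rV_compact R d (fun=> `[0, 1]%classic) (fun=> @segment_compact R 0 1).
rewrite (_ : setT = (\pi_(torus R d)%qT : 'rV[R]_d -> torus R d) @`
    [set v : 'rV[R]_d | forall i, `[0, 1]%classic (v ord0 i)]).
  by apply: continuous_compact => //; apply: continuous_subspaceT; exact: pi_continuous.
apply/seteqP; split => // xi _.
exists (\row_i (repr xi 0 i - (Num.floor (repr xi 0 i))%:~R)).
  move=> i; rewrite /= in_itv/= mxE; have /andP[f1 f2] := floor_itv (repr xi 0 i).
  by rewrite subr_ge0 f1/= lerBlDr addrC ltW// -[1]/(1%:~R) -intrD.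
rewrite -[RHS]reprK; apply/eqmodP/forallP => i; rewrite mxE.
by rewrite addrAC subrr sub0r rpredN; exact: intr_int.
Qed.

Section compactification.
Context (R : realType) (d : nat) (E : normedModType R) (Omega : set 'rV[R]_d).
Local Notation V := 'rV[R]_d.
Local Notation Z := (torus R d).
Local Notation K := (compactification E Omega).

Lemma nbhs_prod3 (T1 T2 T3 : topologicalType) (x : T1) (y : T2) (z : T3) U1 U2 U3 :
  nbhs x U1 -> nbhs y U2 -> nbhs z U3 -> nbhs (x, y, z) (U1 `*` U2 `*` U3).
Proof. by move=> *; exists (U1 `*` U2, U3) => //; split => //; exists (U1, U2). Qed.

Lemma compactificationE : K = [set p | closure Omega p.1.1 /\ `|p.2| <= 1].
Proof.
apply/seteqP; split=> [[[x xi] z] Kp|[[x xi] z] [/= Ox z1]].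
  split=> /=.
    move=> U Ux.
    have /Kp[[[y zeta] w] [[[/= Oy _] _] [[/= Uy _] _]]] :
      nbhs (x, xi, z) (U `*` setT `*` setT) by apply: nbhs_prod3 => //; exact: filterT.
    by exists y.
  apply/ler_addgt0Pr => e e0.
  have /Kp[[[y zeta] w] [[_ /= wB] [_ /= zw]]] :
      nbhs (x, xi, z) (setT `*` setT `*` ball z e).
    by apply: nbhs_prod3; [exact: filterT|exact: filterT|exact: nbhsx_ballx].
  move: wB zw; rewrite /unit_ball -ball_normE/= sub0r normrN => w1 zw.
  rewrite -(subrK w z); apply: le_trans (ler_normD _ _) _.
  by rewrite addrC lerD// ltW.
move=> U [[U1 U2] /= [[[U11 U12] /= [U11x U12x] U1112] U2z] UU].
have [x' [Ox' Ux']] := Ox _ U11x.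
have : closure (@unit_ball R E) z.
  by rewrite /unit_ball closure_ballE closed_ballE// /closed_ball_/= sub0r normrN.
move=> /(_ _ U2z)[z' [Bz' Uz']].
exists (x', xi, z'); split => //; apply: UU; split => //=.
by apply: U1112; split => //=; exact: nbhs_singleton.
Qed.

Lemma compactification_closed : closed K.
Proof. exact: closed_closure. Qed.

Lemma compactification_compact : euclidean_space E -> bounded_set Omega -> compact K.
Proof.
move=> Ee Ob.
have cO := compact_closure_bounded Ob; have cZ := @compact_torus R d.
have := compact_setX (compact_setX cO cZ) (compact_unit_ball Ee).
rewrite compactificationE; congr compact.
by apply/seteqP; split=> p; [case=> -[]|case].
Qed.

Lemma compactification_measurable : measurable (K : set (borel (V * Z * E)%type)).
Proof.
rewrite -(setCK K); apply: measurableC; apply: borel_open; apply: closed_openC.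
exact: closed_closure.
Qed.

End compactification.

Lemma within_continuous_measurable (R : realType) (T : ptopologicalType) (D : set (borel T))
    (g : T -> R) :
  measurable D -> {within (D : set T), continuous g} ->
  measurable_fun D (g : borel T -> R).
Proof.
move=> mD gc _; apply: (measurability _ (RGenOpens.measurableE R)) => //.
move=> _ [_ [a [b ->]] <-].
have /continuousP/(_ _ (@interval_open R (BRight a) (BLeft b) isT isT)) := gc.
move=> /open_subspaceP[U oU UD]; rewrite setIC -[X in measurable X]UD.
by apply: measurableI => //; exact: borel_open.
Qed.

Lemma measurable_assemble3 (R : realType) (T1 T2 T3 : ptopologicalType) :
  borel_retract R T1 -> borel_retract R T2 -> borel_retract R T3 ->
  measurable_fun setT (fun p : borel T1 * borel T2 * borel T3 =>
    (p.1.1, p.1.2, p.2) : borel (T1 * T2 * T3)%type).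
Proof.
move=> r1 r2 r3; have m1 := borel_retract_pair r1 r2.
have m2 := borel_retract_pair (borel_retract_prod r1 r2) r3.
rewrite (_ : (fun p => _) = id \o (fun p : borel T1 * borel T2 * borel T3 =>
  ((p.1 : borel (T1 * T2)%type), p.2))); last by apply/funext => -[[]].
apply: (measurableT_comp m2); apply/measurable_fun_pair.
  exact: (measurableT_comp m1 measurable_fst).
exact: measurable_snd.
Qed.

Lemma continuous_fst (T1 T2 : topologicalType) : continuous (fst : T1 * T2 -> T1).
Proof. by move=> p; exact: cvg_fst. Qed.

Lemma continuous_snd (T1 T2 : topologicalType) : continuous (snd : T1 * T2 -> T2).
Proof. by move=> p; exact: cvg_snd. Qed.

Lemma continuous_fst_fst (T1 T2 T3 : topologicalType) :
  continuous (fun w : T1 * T2 * T3 => w.1.1).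
Proof.
by move=> w; apply: (@continuous_comp _ _ _ fst fst); exact: continuous_fst.
Qed.

Lemma continuous_fst_snd (T1 T2 T3 : topologicalType) :
  continuous (fun w : T1 * T2 * T3 => w.1.2).
Proof.
move=> w; apply: (@continuous_comp _ _ _ fst snd); first exact: continuous_fst.
exact: continuous_snd.
Qed.

Lemma measurable_split3 (T1 T2 T3 : ptopologicalType) :
  measurable_fun setT (fun w : borel (T1 * T2 * T3)%type =>
    ((w.1.1, w.1.2), w.2) : borel T1 * borel T2 * borel T3).
Proof.
apply/measurable_fun_pair; last first.
  exact: (continuous_measurable_borel (@continuous_snd (T1 * T2)%type T3)).
apply/measurable_fun_pair.
  exact: (continuous_measurable_borel (@continuous_fst_fst T1 T2 T3)).
exact: (continuous_measurable_borel (@continuous_fst_snd T1 T2 T3)).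
Qed.

Section to_ball.
Context (R : realType) (d : nat) (E : normedModType R).
Hypothesis Ee : euclidean_space E.
Local Notation V := 'rV[R]_d.
Local Notation Z := (torus R d).
Local Notation W := (V * Z * E)%type.
Local Notation X := (borel V * borel Z)%type.

Lemma measurable_radial (phi : R -> R) : measurable_fun setT phi ->
  measurable_fun setT (fun z : borel E => phi `|z : E| *: (z : E) : borel E).
Proof.
move=> mphi; have [N [c [b [cE cl]]]] := euclidean_coordinates Ee.
pose r (v : 'rV[R]_N) : E := \sum_i v 0 i *: b i.
pose f (z : borel E) : borel 'rV[R]_N := \row_i (phi `|z : E| * c z 0 i).
rewrite (_ : (fun z => _) = (r : borel 'rV[R]_N -> borel E) \o f); last first.
  apply/funext => z; rewrite /r /f /= {2}(cE z) scaler_sumr.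
  by apply: eq_bigr => i _; rewrite mxE scalerA.
apply: measurableT_comp.
  by apply: continuous_measurable_borel; exact: continuous_lincomb.
apply: measurable_rV => i; rewrite (_ : (fun z => _) = fun z : borel E => phi `|z : E| * c z 0 i); last first.
  by apply/funext => z; rewrite mxE.
apply: measurable_funM.
  apply: measurableT_comp => //.
  by apply: continuous_measurable_real; exact: norm_continuous.
apply: continuous_measurable_real => x; apply/cvgrPdist_lt => e e0; near=> y.
apply: le_lt_trans (cl x y i) _.
by near: y; have /cvgrPdist_lt := @cvg_id _ (nbhs x); exact.
Unshelve. all: by end_near. Qed.

Lemma measurable_assemble :
  measurable_fun setT (fun p : X * borel E => (p.1.1, p.1.2, p.2) : borel W).
Proof.
exact: measurable_assemble3 (borel_retract_rV R d) (borel_retract_torus R d)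
  (borel_retract_euclidean Ee).
Qed.

Lemma measurable_split :
  measurable_fun setT (fun w : borel W => ((w.1.1, w.1.2), w.2) : X * borel E).
Proof. exact: measurable_split3. Qed.

Lemma norm_radial (a : R) (z : E) : 0 <= a -> `|a^-1 *: z| = `|z| / a.
Proof. by move=> a0; rewrite normrZ ger0_norm ?invr_ge0// mulrC. Qed.

(* to_ball and from_ball realize the homeomorphism z |-> z / (1 + |z|) of E onto
   its open unit ball and its inverse. *)
Definition to_ball (p : X * borel E) : borel W :=
  (p.1.1, p.1.2, (1 + `|p.2 : E|)^-1 *: (p.2 : E)).

Definition from_ball (w : borel W) : X * borel E :=
  ((w.1.1, w.1.2), (1 - `|w.2 : E|)^-1 *: (w.2 : E)).

Lemma measurable_to_ball : measurable_fun setT to_ball.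
Proof.
apply: (measurableT_comp measurable_assemble
  (g := fun p : X * borel E => (p.1, ((1 + `|p.2 : E|)^-1 *: (p.2 : E)) : borel E))).
apply/measurable_fun_pair; first exact: measurable_fst.
apply: (measurableT_comp (f := fun z : borel E => ((1 + `|z : E|)^-1 *: (z : E) : borel E))
  _ measurable_snd).
apply: (@measurable_radial (fun t => (1 + t)^-1)).
apply: (measurableT_comp (@measurable_fun_invr R)).
exact: measurable_funD.
Qed.

Lemma measurable_from_ball : measurable_fun setT from_ball.
Proof.
apply: (measurableT_comp (f := fun p : X * borel E =>
    (p.1, ((1 - `|p.2 : E|)^-1 *: (p.2 : E)) : borel E)) _ measurable_split).
apply/measurable_fun_pair; first exact: measurable_fst.
apply: (measurableT_comp (f := fun z : borel E => ((1 - `|z : E|)^-1 *: (z : E) : borel E))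
  _ measurable_snd).
apply: (@measurable_radial (fun t => (1 - t)^-1)).
apply: (measurableT_comp (@measurable_fun_invr R)).
exact: measurable_funB.
Qed.

Lemma to_ball_norm p : `|(to_ball p).2| = `|p.2 : E| / (1 + `|p.2 : E|).
Proof.
by apply: norm_radial; rewrite addr_ge0.
Qed.

Lemma to_ball_lt1 p : `|(to_ball p).2| < 1.
Proof. by rewrite to_ball_norm ltr_pdivrMr ?ltr_pwDl// mul1r ltrDr. Qed.

Lemma to_ball_weight p : (1 + `|p.2 : E|) * (1 - `|(to_ball p).2|) = 1.
Proof.
have p0 : 1 + `|p.2 : E| != 0 by rewrite gt_eqF// ltr_pwDl.
by rewrite to_ball_norm; field.
Qed.

Lemma from_ball_norm (w : borel W) : `|w.2| < 1 ->
  `|(from_ball w).2 : E| = `|w.2| / (1 - `|w.2|).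
Proof.
by move=> w1; apply: norm_radial; rewrite subr_ge0 ltW.
Qed.

Lemma from_ball_weight (w : borel W) : `|w.2| < 1 ->
  1 + `|(from_ball w).2 : E| = (1 - `|w.2|)^-1.
Proof.
move=> w1; have w0 : 1 - `|w.2| != 0 by rewrite gt_eqF// subr_gt0.
by rewrite from_ball_norm//; field.
Qed.

Lemma from_ballK (w : borel W) : `|w.2| < 1 -> to_ball (from_ball w) = w.
Proof.
move=> w1; have w0 : 1 - `|w.2| != 0 by rewrite gt_eqF// subr_gt0.
rewrite /to_ball -/(from_ball w) from_ball_weight// invrK /= scalerA divff// scale1r.
by case: w {w1 w0} => -[].
Qed.

End to_ball.

Section recession.
Context (R : realType) (d : nat) (E : normedModType R) (Omega : set 'rV[R]_d).
Local Notation V := 'rV[R]_d.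
Local Notation Z := (torus R d).
Local Notation K := (compactification E Omega).

Lemma recession_S_map (g : V * Z * E -> R) x xi z : {within K, continuous g} ->
  closure Omega x -> `|z| = 1 -> recession Omega (S_map g) (x, xi, z) = g (x, xi, z).
Proof.
move=> gc Ox z1; rewrite /recession/=.
pose F := filter_prod (filter_prod (within Omega (nbhs x)) (nbhs xi)) (@pinfty_nbhs R).
have FO : ProperFilter (within Omega (nbhs x)) by exact: within_nbhs_proper.
have PF : ProperFilter F by exact: filter_prod_proper.
have Kp : K (x, xi, z) by rewrite compactificationE /=; split => //; rewrite z1.
apply/cvg_lim => //.
pose phi (q : V * Z * R) : V * Z * E :=
  (q.1.1, q.1.2, (1 + `|q.2 *: z|)^-1 *: (q.2 *: z)).
have Ft r : F [set q | r < q.2].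
  have Fsnd : (snd : V * Z * R -> R) @ F --> @pinfty_nbhs R by exact: cvg_snd.
  by apply: (Fsnd [set t | r < t]); exists r; split => //; exact: num_real.
have F1 : (fun q => q.1.1) @ F --> nbhs x.
  apply: cvg_trans (@cvg_within _ (nbhs x) _ Omega).
  apply: (@cvg_comp _ _ _ (fst : V * Z * R -> V * Z) fst F
    (filter_prod (within Omega (nbhs x)) (nbhs xi))); exact: cvg_fst.
have FOm : F [set q | Omega q.1.1].
  have : (fun q => q.1.1) @ F --> within Omega (nbhs x).
    apply: (@cvg_comp _ _ _ (fst : V * Z * R -> V * Z) fst F
      (filter_prod (within Omega (nbhs x)) (nbhs xi))); exact: cvg_fst.
  move=> /(_ Omega); apply; apply: (@filterE _ (nbhs x)) => y.
  exact.
have F2 : (fun q => q.1.2) @ F --> nbhs xi.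
  by apply: (@cvg_comp _ _ _ (fst : V * Z * R -> V * Z) snd F
    (filter_prod (within Omega (nbhs x)) (nbhs xi))); [exact: cvg_fst|exact: cvg_snd].
have nz t : 0 < t -> `|t *: z| = t by move=> t0; rewrite normrZ z1 mulr1 gtr0_norm.
have F3 : (fun q : V * Z * R => (1 + `|q.2 *: z|)^-1 *: (q.2 *: z)) @ F --> z.
  apply/cvgrPdist_lt => e e0; near=> q.
  have q0 : 0 < q.2 by near: q; exact: Ft.
  have qe : e^-1 < q.2 by near: q; exact: Ft.
  have p0 : 1 + q.2 != 0 by rewrite gt_eqF// addr_gt0.
  rewrite nz// scalerA -{1}(scale1r z) -scalerBl normrZ z1 mulr1.
  have -> : 1 - (1 + q.2)^-1 * q.2 = (1 + q.2)^-1 by field.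
  rewrite gtr0_norm ?invr_gt0 ?addr_gt0// invf_plt ?posrE ?addr_gt0//.
  by apply: lt_trans qe _; rewrite ltrDr.
have Fphi : phi @ F --> within K (nbhs (x, xi, z)).
  move=> A; rewrite /within /= => nA.
  have pc : phi @ F --> nbhs (x, xi, z).
    exact: (cvg_pair (cvg_pair F1 F2) F3).
  have FK : F [set q | K (phi q)].
    apply: filterS FOm => q Oq; rewrite /= compactificationE/=; split.
      exact: subset_closure.
    rewrite normrZ ger0_norm ?invr_ge0 ?addr_ge0// mulrC ler_pdivrMr ?ltr_pwDl//.
    by rewrite mul1r lerDr.
  by apply: filterS2 FK (pc _ nA) => q Kq; exact.
have gphi : g \o phi @ F --> g (x, xi, z).
  apply: cvg_comp Fphi _.
  by move/subspace_continuousP : gc; exact.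
have w1 : (fun q : V * Z * R => (1 + `|q.2 *: z|) / q.2) @ F --> (1 : R).
  apply/cvgrPdist_lt => e e0; near=> q.
  have q0 : 0 < q.2 by near: q; exact: Ft.
  have qe : e^-1 < q.2 by near: q; exact: Ft.
  have p0 : q.2 != 0 by rewrite gt_eqF.
  rewrite nz//; have -> : 1 - (1 + q.2) / q.2 = - q.2^-1 by field.
  by rewrite normrN gtr0_norm ?invr_gt0// invf_plt ?posrE.
rewrite -[X in _ --> X]mul1r.
rewrite (_ : (fun q => _) = (fun q => (1 + `|q.2 *: z|) / q.2 * (g \o phi) q)); last first.
  by apply/funext => q; rewrite /S_map /phi /= mulrAC.
exact: cvgM.
Unshelve. all: by end_near. Qed.

End recession.

Section signed_transport.
Context (R : realType).
Local Open Scope ereal_scope.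

Lemma pkernel_Rintegrable d1 d2 (X : measurableType d1) (Y : measurableType d2)
    (k : X -> probability Y R) (m : {measure set X -> \bar R})
    (M : {measure set (X * Y)%type -> \bar R}) (f : X * Y -> R) :
  pkernel k ->
  (forall f, measurable_fun setT f -> (forall p, 0 <= f p) ->
      \int[M]_p f p = \int[m]_x \int[k x]_y f (x, y)) ->
  M.-integrable setT (EFin \o f) ->
  m.-integrable setT (fun x => (\int[k x]_y f (x, y))%R%:E).
Proof.
move=> mk ME intf.
have mf : measurable_fun setT (EFin \o f) by exact: measurable_int intf.
pose fp x := \int[k x]_y (EFin \o f)^\+ (x, y).
pose fn x := \int[k x]_y (EFin \o f)^\- (x, y).
have mfp : measurable_fun setT fp.
  by apply: measurable_pkernel_integral => //; exact: measurable_funepos.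
have mfn : measurable_fun setT fn.
  by apply: measurable_pkernel_integral => //; exact: measurable_funeneg.
have fp0 x : 0 <= fp x by exact: integral_ge0.
have fn0 x : 0 <= fn x by exact: integral_ge0.
have ifp : m.-integrable setT fp.
  apply/integrableP; split => //; under eq_integral do rewrite gee0_abs//.
  rewrite -ME//; last exact: measurable_funepos.
  exact: integral_funepos_lt_pinfty.
have ifn : m.-integrable setT fn.
  apply/integrableP; split => //; under eq_integral do rewrite gee0_abs//.
  rewrite -ME//; last exact: measurable_funeneg.
  exact: integral_funeneg_lt_pinfty.
rewrite (_ : (fun x => _) = EFin \o (fine \o (fun x => fp x - fn x))); last first.
  apply/funext => x /=; rewrite /Rintegral [in LHS]integralE.
  by congr ((fine (_ - _))%:E); apply: eq_integral => y _; rewrite ?funeposE ?funenegE.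
apply: (le_integrable measurableT _ _ (integrableD measurableT ifp ifn)).
  by apply/measurable_EFinP; apply: measurableT_comp => //; exact: emeasurable_funB.
move=> x _; rewrite [leRHS]gee0_abs; last exact: adde_ge0 (fp0 x) (fn0 x).
rewrite [X in `|X|](_ : _ = (fine (fp x - fn x))%:E)//.
move: (fp0 x) (fn0 x); move: (fp x) (fn x) => [a| |]// [b| |]//=.
- rewrite !lee_fin => a0 b0; rewrite ler_norml; apply/andP; split; lra.
- by rewrite normr0 leey.
- by rewrite normr0 leey.
- by rewrite normr0 leey.
Qed.

Lemma funepos_weight (T : Type) (w f : T -> R) x : (0 <= w x)%R ->
  (fun x => (w x * f x)%:E)^\+ x = (w x)%:E * (EFin \o f)^\+ x.
Proof.
move=> w0; rewrite !funeposE /= -!EFin_max -EFinM; congr EFin.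
by rewrite maxr_pMr// mulr0.
Qed.

Lemma funeneg_weight (T : Type) (w f : T -> R) x : (0 <= w x)%R ->
  (fun x => (w x * f x)%:E)^\- x = (w x)%:E * (EFin \o f)^\- x.
Proof.
move=> w0; rewrite !funenegE /= -!EFin_max -EFinM; congr EFin.
by rewrite maxr_pMr// mulr0 mulrN.
Qed.

Lemma fine_addB (a b a' b' : \bar R) : 0 <= a -> 0 <= b -> 0 <= a' -> 0 <= b' ->
  a + b < +oo -> a' + b' < +oo ->
  fine (a' + b' - (a + b)) = (fine (a' - a) + fine (b' - b))%R.
Proof.
by move: a b a' b' => [a| |] [b| |] [a'| |] [b'| |]//= _ _ _ _ _ _; lra.
Qed.

Lemma Rintegral_transport2 d0 d1 d2 (W : measurableType d0) (Y1 : measurableType d1)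
    (Y2 : measurableType d2) (m : {measure set W -> \bar R})
    (Q1 : {measure set Y1 -> \bar R}) (Q2 : {measure set Y2 -> \bar R})
    (D1 : set Y1) (D2 : set Y2) (w : Y1 -> R) (T1 : Y1 -> W) (T2 : Y2 -> W) (G : W -> R) :
  measurable D1 -> measurable D2 -> measurable_fun setT w -> (forall x, 0 <= w x)%R ->
  measurable_fun setT T1 -> measurable_fun setT T2 ->
  (forall f, measurable_fun setT f -> (forall x, 0 <= f x) ->
    \int[m]_x f x = \int[Q1]_(y in D1) ((w y)%:E * f (T1 y)) + \int[Q2]_(y in D2) f (T2 y)) ->
  m.-integrable setT (EFin \o G) ->
  [/\ Q1.-integrable D1 (fun y => (w y * G (T1 y))%:E),
      Q2.-integrable D2 (fun y => (G (T2 y))%:E) &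
      (\int[m]_x G x = \int[Q1]_(y in D1) (w y * G (T1 y)) +
        \int[Q2]_(y in D2) G (T2 y))%R].
Proof.
move=> mD1 mD2 mw w0 mT1 mT2 mE intG.
have mG : measurable_fun setT (EFin \o G) by exact: measurable_int intG.
have mG' : measurable_fun setT G by exact/measurable_EFinP.
have mwG : measurable_fun setT (fun y => (w y * G (T1 y))%R).
  by apply: measurable_funM => //; exact: measurableT_comp.
have mG2 : measurable_fun setT (fun y => G (T2 y)) by exact: measurableT_comp.
have [i1 i2] : Q1.-integrable D1 (fun y => (w y * G (T1 y))%:E) /\
    Q2.-integrable D2 (fun y => (G (T2 y))%:E).
  have [_ ] := integrableP _ _ _ intG.
  rewrite mE//; last exact: measurableT_comp.
  set a := (X in X + _); set b := (X in _ + X) => ab.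
  have a0 : 0 <= a by apply: integral_ge0 => y _; rewrite mule_ge0// lee_fin.
  have b0 : 0 <= b by apply: integral_ge0.
  split; apply/integrableP; split.
  - by apply: measurable_funTS; exact/measurable_EFinP.
  - apply: le_lt_trans (le_lt_trans (leeDl a b0) ab); rewrite /a le_eqVlt; apply/orP; left.
    apply/eqP; apply: eq_integral => y _.
    by rewrite EFinM abseM (gee0_abs (_ : 0 <= (w y)%:E))// lee_fin.
  - by apply: measurable_funTS; exact/measurable_EFinP.
  - exact: le_lt_trans (le_lt_trans (leeDr b a0) ab).
split => //.
have mp : measurable_fun setT (EFin \o G)^\+ by exact: measurable_funepos.
have mn : measurable_fun setT (EFin \o G)^\- by exact: measurable_funeneg.
rewrite /Rintegral [in LHS]integralE (mE _ mn)// (mE _ mp)//.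
rewrite [X in (_ = fine X + _)%R]integralE [X in (_ = _ + fine X)%R]integralE.
have ->: \int[Q1]_(y in D1) (fun y => (w y * G (T1 y))%:E)^\+ y =
    \int[Q1]_(y in D1) ((w y)%:E * (EFin \o G)^\+ (T1 y)).
  by apply: eq_integral => y _; rewrite (funepos_weight (fun y => G (T1 y)))// !funeposE.
have ->: \int[Q1]_(y in D1) (fun y => (w y * G (T1 y))%:E)^\- y =
    \int[Q1]_(y in D1) ((w y)%:E * (EFin \o G)^\- (T1 y)).
  by apply: eq_integral => y _; rewrite (funeneg_weight (fun y => G (T1 y)))// !funenegE.
have ->: \int[Q2]_(y in D2) (fun y => (G (T2 y))%:E)^\+ y =
    \int[Q2]_(y in D2) (EFin \o G)^\+ (T2 y).
  by apply: eq_integral => y _; rewrite !funeposE.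
have ->: \int[Q2]_(y in D2) (fun y => (G (T2 y))%:E)^\- y =
    \int[Q2]_(y in D2) (EFin \o G)^\- (T2 y).
  by apply: eq_integral => y _; rewrite !funenegE.
have Gp := integral_funepos_lt_pinfty measurableT intG.
have Gn := integral_funeneg_lt_pinfty measurableT intG.
rewrite (mE _ mp)// in Gp; rewrite (mE _ mn)// in Gn.
apply: fine_addB => //; apply: integral_ge0 => y _ //.
- by rewrite mule_ge0// lee_fin.
- by rewrite mule_ge0// lee_fin.
Qed.

End signed_transport.

Section representation.
Context (R : realType) (d : nat) (E : normedModType R) (Omega : set 'rV[R]_d).
Hypothesis Ee : euclidean_space E.
Hypothesis Omega_open : open Omega.
Hypothesis Omega_bounded : bounded_set Omega.
Local Notation V := 'rV[R]_d.
Local Notation Z := (torus R d).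
Local Notation W := (V * Z * E)%type.
Local Notation X := (borel V * borel Z)%type.
Local Notation K := (compactification E Omega).
Local Notation leb := (lebesgue_rV d \x (@torus_measure R d))%E.
Local Open Scope ereal_scope.

Definition weight (p : X * borel E) : R := (1 + `|p.2 : E|)%R.
Definition osc_domain : set (X * borel E) := (Omega `*` setT) `*` setT.
Definition conc_domain : set (X * borel E) :=
  (closure Omega `*` setT) `*` [set z : E | `|z|%R = 1%R].
Definition assemble (p : X * borel E) : borel W := (p.1.1, p.1.2, p.2).

Definition regular_quadruple (nu : young_quadruple E) := [/\
  pkernel (fun p : X => osc nu p.1 p.2),
  pkernel (conc_scale nu : borel V -> probability (borel Z) R),
  pkernel (fun p : X => conc_angle nu p.1 p.2) &
  \int[leb]_(p in Omega `*` setT) \int[osc nu p.1 p.2]_z `|z : E|%:E < +oo].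

(* m is the sum of the image of the oscillation part (Q1) under to_ball, with the
   density 1 + |z|, and of the concentration part (Q2). *)
Definition represents (nu : young_quadruple E) (m : {measure set (borel W) -> \bar R})
    (C : {measure set X -> \bar R}) (Q1 Q2 : {measure set (X * borel E)%type -> \bar R}) := [/\
  forall f : X * borel E -> \bar R, measurable_fun setT f -> (forall p, 0 <= f p) ->
    \int[Q1]_p f p = \int[leb]_p \int[osc nu p.1 p.2]_z f (p, z),
  forall f : X -> \bar R, measurable_fun setT f -> (forall p, 0 <= f p) ->
    \int[C]_p f p = \int[conc nu]_x \int[conc_scale nu x]_xi f (x, xi),
  forall f : X * borel E -> \bar R, measurable_fun setT f -> (forall p, 0 <= f p) ->
    \int[Q2]_p f p = \int[C]_p \int[conc_angle nu p.1 p.2]_z f (p, z) &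
  forall f : borel W -> \bar R, measurable_fun setT f -> (forall p, 0 <= f p) ->
    \int[m]_w f w = \int[Q1]_(p in osc_domain) ((weight p)%:E * f (to_ball p)) +
      \int[Q2]_(p in conc_domain) f (assemble p)].

Let mOmega : measurable (Omega : set (borel V)).
Proof. exact: borel_open. Qed.

Lemma measurable_closed (T : ptopologicalType) (A : set T) : closed A ->
  measurable (A : set (borel T)).
Proof.
by move=> cA; rewrite -(setCK A); apply: measurableC; apply: borel_open; exact: closed_openC.
Qed.

Lemma measurable_sphere : measurable ([set z : E | `|z|%R = 1%R] : set (borel E)).
Proof.
apply: measurable_closed.
rewrite (_ : [set z | _] = (fun z : E => `|z|%R) @^-1` [set r | r = 1%R])//.
by apply: closed_comp; [move=> z _; exact: norm_continuous|exact: closed_eq].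
Qed.

Lemma measurable_osc_domain : measurable osc_domain.
Proof. by apply: measurableX => //; exact: measurableX. Qed.

Lemma measurable_conc_domain : measurable conc_domain.
Proof.
apply: measurableX; last exact: measurable_sphere.
by apply: measurableX => //; apply: measurable_closed; exact: closed_closure.
Qed.

Lemma osc_domain_K p : osc_domain p -> K (to_ball p).
Proof.
move=> [[Op _] _]; rewrite compactificationE /=; split; first exact: subset_closure.
by rewrite ltW// to_ball_lt1.
Qed.

Lemma conc_domain_K p : conc_domain p -> K (assemble p).
Proof. by move=> [[Op _] /= p1]; rewrite compactificationE /= p1. Qed.

Lemma measurable_weight : measurable_fun setT weight.
Proof.
apply: measurable_funD => //.
apply: (measurableT_comp (f := fun z : borel E => `|z : E|%R) _ measurable_snd).
by apply: continuous_measurable_real; exact: norm_continuous.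
Qed.

Lemma represents_support nu m C Q1 Q2 : represents nu m C Q1 Q2 ->
  forall A : set (borel W), measurable A -> K `&` A = set0 -> m A = 0.
Proof.
move=> [_ _ _ mE] A mA KA; rewrite -integral_indicT// mE; last 2 first.
- exact: measurable_EFin_indic.
- by move=> p; rewrite lee_fin.
have notA w : K w -> \1_A w = 0%R :> R.
  by move=> Kw; rewrite indicE memNset// => Aw; have : (K `&` A) w by []; rewrite KA.
rewrite !integral0_eq ?adde0//.
- by move=> p Dp; rewrite notA//; exact: conc_domain_K.
- by move=> p Dp; rewrite notA ?mule0//; exact: osc_domain_K.
Qed.

Lemma represents_pairing nu (m : {measure set (borel W) -> \bar R}) C Q1 Q2 (g : W -> R) :
  m setT < +oo -> regular_quadruple nu -> represents nu m C Q1 Q2 ->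
  {within K, continuous g} ->
  (\int[m]_(w in K) g w = young_pairing Omega (S_map g) nu)%R.
Proof.
move=> mfin [mo ms ma _] [Q1E CE Q2E mE] gc.
have mK : measurable (K : set (borel W)) by apply: measurable_closed; exact: closed_closure.
pose G : W -> R := g \_ K.
have GK w : K w -> G w = g w by move=> Kw; rewrite /G patchE mem_set.
have mG : measurable_fun setT (G : borel W -> R).
  exact: (measurable_restrictT _ mK).1 (within_continuous_measurable mK gc).
have [B GB] : exists B : R, forall w, (`|G w| <= B)%R.
  have : bounded_set (g @` K).
    apply: compact_bounded; apply: continuous_compact => //.
    exact: compactification_compact.
  move=> [B [_ hB]]; exists (Num.max 0 (B + 1))%R => w; rewrite /G patchE.
  case: ifPn => [/set_mem Kw|_]; last by rewrite normr0 le_max lexx.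
  by rewrite le_max; apply/orP; right; apply: (hB (B + 1)%R); [rewrite ltrDl|exists w].
have iG : m.-integrable setT (EFin \o G).
  apply: measurable_bounded_integrable => //.
  exists B; split; first exact: num_real.
  by move=> r Br w _; apply: le_trans (GB w) (ltW Br).
have mD1 := measurable_osc_domain; have mD2 := measurable_conc_domain.
have w0 (p : X * borel E) : (0 <= weight p)%R by rewrite addr_ge0.
have [i1 i2 GE] := Rintegral_transport2 mD1 mD2 measurable_weight w0
  (measurable_to_ball Ee) (measurable_assemble Ee) mE iG.
rewrite Rintegral_mkcond -/G GE /young_pairing; congr (_ + _)%R.
  pose H1 := (fun p : X * borel E => weight p * G (to_ball p))%R \_ osc_domain.
  have iH1 : Q1.-integrable setT (EFin \o H1).
    move/(integrable_mkcond _ mD1) : i1; apply: eq_integrable => // p _.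
    by rewrite /H1 /= !patchE; case: ifP.
  rewrite Rintegral_mkcond -/H1 (pkernel_RintegralE mo Q1E iH1).
  have mt : pkernel (fun _ : borel V => @torus_measure R d : probability _ _).
    by move=> U mU; exact: measurable_cst.
  have LE f : measurable_fun setT f -> (forall p : X, 0 <= f p) ->
      \int[leb]_p f p = \int[lebesgue_rV d]_x \int[torus_measure]_xi f (x, xi).
    by move=> mf f0; exact: fubini_tonelli1.
  rewrite (pkernel_RintegralE mt LE (pkernel_Rintegrable mo Q1E iH1)).
  rewrite [RHS]Rintegral_mkcond; apply: eq_Rintegral => x _; rewrite patchE.
  case: ifPn => [/set_mem Ox|/negP Ox].
    apply: eq_Rintegral => xi _; apply: eq_Rintegral => z _.
    rewrite /H1 patchE mem_set//= GK//.
    exact: (@osc_domain_K (x, xi, z)).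
  rewrite /Rintegral integral0_eq// => xi _; rewrite integral0_eq// => z _.
  by rewrite /H1 patchE memNset// => -[[/= h _] _]; apply: Ox; exact/mem_set.
pose H2 := (fun p : X * borel E => G (assemble p)) \_ conc_domain.
have iH2 : Q2.-integrable setT (EFin \o H2).
  move/(integrable_mkcond _ mD2) : i2; apply: eq_integrable => // p _.
  by rewrite /H2 /= !patchE; case: ifP.
rewrite Rintegral_mkcond -/H2 (pkernel_RintegralE ma Q2E iH2).
rewrite (pkernel_RintegralE ms CE (pkernel_Rintegrable ma Q2E iH2)).
rewrite [RHS]Rintegral_mkcond; apply: eq_Rintegral => x _; rewrite patchE.
case: ifPn => [/set_mem Ox|/negP Ox].
  apply: eq_Rintegral => xi _; rewrite [RHS]Rintegral_mkcond.
  apply: eq_Rintegral => z _; rewrite patchE frontier_unit_ball.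
  rewrite /H2 patchE; case: ifPn => [/set_mem Dp|/negP Dp].
    have [_ /= z1] := Dp; rewrite ifT ?recession_S_map//; last exact/mem_set.
    by rewrite GK//; exact: (conc_domain_K Dp).
  by rewrite ifF//; apply/negP => /set_mem z1; apply: Dp; exact/mem_set.
rewrite /Rintegral integral0_eq// => xi _; rewrite integral0_eq// => z _.
by rewrite /H2 patchE memNset// => -[[/= h _] _]; apply: Ox; exact/mem_set.
Qed.

End representation.

Lemma integral_probability1 d (T : measurableType d) (R : realType) (P : probability T R) :
  (\int[P]_x 1 = 1)%E.
Proof. by rewrite -measure_setTE; exact: probability_setT. Qed.

Lemma charge_eq_continuous3 (R : realType) (T1 T2 T3 : ptopologicalType)
    (mu mu' : {charge set (borel (T1 * T2 * T3)%type) -> \bar R}) (K : set (T1 * T2 * T3)) :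
  borel_retract R T1 -> borel_retract R T2 -> borel_retract R T3 -> closed K ->
  (forall A : set (borel (T1 * T2 * T3)%type), measurable A -> K `&` A = set0 -> mu A = 0%E) ->
  (forall A : set (borel (T1 * T2 * T3)%type), measurable A -> K `&` A = set0 -> mu' A = 0%E) ->
  (forall h : T1 * T2 * T3 -> R, continuous h -> (forall x, 0 <= h x <= 1)%R ->
    charge_integral mu K h = charge_integral mu' K h) ->
  forall A : set (borel (T1 * T2 * T3)%type), measurable A -> mu A = mu' A.
Proof.
move=> r1 r2 r3; apply: charge_eq_continuous.
exact: borel_retract_prod (borel_retract_prod r1 r2) r3.
Qed.

Section realization.
Context (R : realType) (d : nat) (E : normedModType R) (Omega : set 'rV[R]_d).
Hypothesis Ee : euclidean_space E.
Hypothesis Omega_open : open Omega.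
Hypothesis Omega_bounded : bounded_set Omega.
Local Notation V := 'rV[R]_d.
Local Notation Z := (torus R d).
Local Notation W := (V * Z * E)%type.
Local Notation X := (borel V * borel Z)%type.
Local Notation K := (compactification E Omega).
Local Notation leb := (lebesgue_rV d \x (@torus_measure R d))%E.
Local Open Scope ereal_scope.

Lemma lebesgue_bounded : lebesgue_rV d Omega < +oo.
Proof.
have [M [_ OM]] := Omega_bounded.
pose r := (Num.max 0 M + 1)%R.
have r0 : (0 <= r)%R by rewrite addr_ge0// le_max lexx.
have Mr : (M < r)%R by rewrite /r ltr_pwDr// le_max lexx orbT.
have xr x : Omega x -> forall i, (`|x 0 i| <= r)%R.
  move=> Ox i; apply: le_trans (OM r Mr x Ox).
  by rewrite [leRHS]/Num.norm /= mx_normrE; apply/bigmax_geP; right => /=; exists (0%R : 'I_1, i).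
have Obox : lebesgue_rV d Omega <= lebesgue_rV d (box (const_mx (- r)) (const_mx (r + 1)))%R.
  apply: le_measure.
  - by apply/mem_set; exact: borel_open.
  - by apply/mem_set; exact: measurable_box.
  - move=> x Ox i; rewrite !mxE in_itv /=; have := xr x Ox i.
    by rewrite ler_norml => /andP[-> h] /=; rewrite (le_lt_trans h)// ltrDl.
apply: le_lt_trans Obox _.
by rewrite lebesgue_rV_box ?ltry// => i; rewrite !mxE; lra.
Qed.

Let mOmega : measurable (Omega : set (borel V)).
Proof. exact: borel_open. Qed.

Lemma leb_rectangle A : measurable A -> leb (A `*` setT) = lebesgue_rV d A.
Proof.
move=> mA; have := @product_measure1E _ _ _ _ R (lebesgue_rV d) (@torus_measure R d) A setT mA measurableT.
by move=> ->; rewrite [X in _ * X](_ : _ = 1) ?mule1//; exact: probability_setT.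
Qed.

Lemma exists_represents nu : regular_quadruple Omega nu ->
  exists (m : {measure set (borel W) -> \bar R}) C Q1 Q2,
    represents Omega nu m C Q1 Q2 /\ m setT < +oo.
Proof.
move=> [mo ms ma ofin].
have [Q1 Q1E] := pkernel_product mo leb.
have [C CE] := pkernel_product ms (conc nu).
have [Q2 Q2E] := pkernel_product ma C.
have mD1 := @measurable_osc_domain R d E Omega Omega_open.
have mD2 := @measurable_conc_domain _ _ E Omega.
have w0 (p : X * borel E) : (0 <= weight p)%R by rewrite addr_ge0.
have mw := @measurable_weight R d E.
have [m1 m1E] := transport_measure Q1 mD1 mw w0 (measurable_to_ball Ee).
have mc : measurable_fun setT (fun _ : X * borel E => 1%R : R) by [].
have c0 (p : X * borel E) : (0 <= 1 :> R)%R by [].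
have [m2 m2E] := transport_measure Q2 mD2 mc c0 (measurable_assemble Ee).
have mE (f : borel W -> \bar R) : measurable_fun setT f -> (forall w, 0 <= f w) ->
    \int[measure_add m1 m2]_w f w =
    \int[Q1]_(p in osc_domain Omega) ((weight p)%:E * f (to_ball p)) +
    \int[Q2]_(p in conc_domain Omega) f (assemble p).
  move=> mf f0; rewrite ge0_integral_measure_add// m1E// m2E//; congr (_ + _).
  by apply: eq_integral => p _; rewrite mul1e.
exists (measure_add m1 m2), C, Q1, Q2; split; first by split.
rewrite measure_setTE mE//; apply: lte_add_pinfty; last first.
  apply: (@le_lt_trans _ _ (\int[Q2]_p 1)).
    by apply: ge0_subset_integral.
  rewrite Q2E//; under eq_integral do rewrite integral_probability1.
  rewrite CE//; under eq_integral do rewrite integral_probability1.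
  by rewrite -measure_setTE ltey_eq fin_num_measure.
rewrite integral_mkcond Q1E; last 2 first.
- have mw1 : measurable_fun (osc_domain Omega) (fun p : X * borel E => (weight p)%:E * 1).
    apply: measurable_funTS.
    by under eq_fun do rewrite mule1; exact/measurable_EFinP.
  exact: (measurable_restrictT _ mD1).1 mw1.
- by move=> p; rewrite patchE; case: ifP => // _; rewrite mule1 lee_fin.
have mO : measurable (Omega `*` setT : set X) by exact: measurableX.
have mz : measurable_fun setT (fun p : X => \int[osc nu p.1 p.2]_z `|z : E|%:E).
  apply: (measurable_pkernel_integral mo (f := fun q : X * borel E => `|q.2 : E|%:E)) => //.
  apply/measurable_EFinP.
  apply: (measurableT_comp (f := fun z : borel E => `|z : E|%R) _ measurable_snd).
  by apply: continuous_measurable_real; exact: norm_continuous.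
apply: (@le_lt_trans _ _
  (\int[leb]_(p in Omega `*` setT) (1 + \int[osc nu p.1 p.2]_z `|z : E|%:E))).
  rewrite [leRHS]integral_mkcond le_eqVlt; apply/orP; left; apply/eqP.
  apply: eq_integral => p _; rewrite patchE; case: ifPn => [/set_mem Op|/negP Op].
    rewrite [X in X + _](_ : _ = \int[osc nu p.1 p.2]_z 1); last first.
      by rewrite integral_probability1.
    rewrite -ge0_integralD//.
      by apply: eq_integral => z _; rewrite patchE mem_set//= mule1.
    apply/measurable_EFinP.
    by apply: continuous_measurable_real; exact: norm_continuous.
  apply: integral0_eq => z _; rewrite patchE memNset// => -[h _].
  by apply: Op; exact/mem_set.
rewrite ge0_integralD//; last 2 first.
- by move=> p _; apply: integral_ge0.
- exact: measurable_funTS.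
apply: lte_add_pinfty => //.
rewrite integral_cst// mul1e [X in X < _](_ : _ = lebesgue_rV d Omega).
  exact: lebesgue_bounded.
exact: leb_rectangle.
Qed.

Definition realizes (nu : young_quadruple E) (m : {finite_measure set (borel W) -> \bar R}) :=
  (forall A : set (borel W), measurable A -> K `&` A = set0 -> m A = 0) /\
  forall g : W -> R, {within K, continuous g} ->
    (\int[m]_(w in K) g w = young_pairing Omega (S_map g) nu)%R.

Lemma represents_realizes nu (m : {finite_measure set (borel W) -> \bar R}) C Q1 Q2 :
  regular_quadruple Omega nu -> represents Omega nu m C Q1 Q2 -> realizes nu m.
Proof.
move=> rnu rep; split; first exact: represents_support rep.
move=> g gc; apply: (represents_pairing _ _ _ _ _ rep) => //.
by rewrite ltey_eq fin_num_measure.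
Qed.

Lemma regular_realizes nu : regular_quadruple Omega nu -> exists m, realizes nu m.
Proof.
move=> rnu; have [m [C [Q1 [Q2 [[Q1E CE Q2E mE] mfin]]]]] := exists_represents rnu.
have [m' m'E] := finite_version mfin.
exists m'; apply: (represents_realizes (C := C) (Q1 := Q1) (Q2 := Q2)) => //.
split => // f mf f0; rewrite -mE//; apply: eq_measure_integral => A mA _.
exact: m'E.
Qed.

Lemma Sstar_realizes nu m : realizes nu m ->
  is_Sstar Omega nu (Sstar Omega nu) /\
  forall A : set (borel W), measurable A -> Sstar Omega nu A = m A.
Proof.
move=> [m0 mE]; pose mu : {charge set (borel W) -> \bar R} := charge_of_finite_measure m.
have muS : is_Sstar Omega nu mu.
  split; first by move=> A mA KA; exact: m0.
  by move=> g gc; rewrite (@charge_integralE _ _ _ mu m)//; exact: mE.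
have SS : is_Sstar Omega nu (Sstar Omega nu).
  rewrite /Sstar; case: pselect => [ex|[]]; last by exists mu.
  exact: projT2 (cid ex).
split => //; have [S0 SE] := SS; have [mu0 muE] := muS.
have agree (h : W -> R) : continuous h -> (forall x, 0 <= h x <= 1)%R ->
    charge_integral (Sstar Omega nu) K h = charge_integral mu K h.
  move=> hc _; have hc' : {within K, continuous h} by exact: continuous_subspaceT.
  by rewrite SE// muE.
move=> A mA; have -> : m A = mu A by [].
exact: (@charge_eq_continuous3 R V Z E (Sstar Omega nu) mu K (borel_retract_rV R d)
  (borel_retract_torus R d) (borel_retract_euclidean Ee)
  (@compactification_closed R d E Omega) S0 mu0 agree A mA).
Qed.

End realization.

Lemma finite_transport d1 d2 (T1 : measurableType d1) (T2 : measurableType d2) (R : realType)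
    (m : {measure set T1 -> \bar R}) (D : set T1) (w : T1 -> R) (f : T1 -> T2) :
  measurable D -> measurable_fun setT w -> (forall x, 0 <= w x) -> measurable_fun setT f ->
  (\int[m]_(x in D) (w x)%:E < +oo)%E ->
  exists m' : {finite_measure set T2 -> \bar R}, forall g, measurable_fun setT g ->
    (forall y, 0 <= g y)%E -> (\int[m']_y g y = \int[m]_(x in D) ((w x)%:E * g (f x)))%E.
Proof.
move=> mD mw w0 mf wfin; have [m' m'E] := transport_measure m mD mw w0 mf.
have m'fin : (m' setT < +oo)%E.
  by rewrite measure_setTE m'E//; under eq_integral do rewrite mule1.
have [m2 m2E] := finite_version m'fin; exists m2 => g mg g0; rewrite -m'E//.
by apply: eq_measure_integral => A mA _; exact: m2E.
Qed.

Lemma finite_pushforward d1 d2 (T1 : measurableType d1) (T2 : measurableType d2) (R : realType)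
    (m : {measure set T1 -> \bar R}) (D : set T1) (f : T1 -> T2) :
  measurable D -> measurable_fun setT f -> (m D < +oo)%E ->
  exists m' : {finite_measure set T2 -> \bar R}, forall g, measurable_fun setT g ->
    (forall y, 0 <= g y)%E -> (\int[m']_y g y = \int[m]_(x in D) g (f x))%E.
Proof.
move=> mD mf Dfin.
have [//|//||m' m'E] := @finite_transport _ _ T1 T2 R m D (fun=> 1) f mD _ _ mf.
  by rewrite integral_cst// mul1e.
exists m' => g mg g0; rewrite m'E//.
by apply: eq_integral => x _; rewrite mul1e.
Qed.

Lemma EFin_Rintegral d (T : measurableType d) (R : realType) (m : {measure set T -> \bar R})
    (D : set T) (f : T -> R) : (forall x, 0 <= f x) -> (\int[m]_(x in D) (f x)%:E < +oo)%E ->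
  ((\int[m]_(x in D) f x)%:E = \int[m]_(x in D) (f x)%:E)%E.
Proof.
move=> f0 ffin; rewrite /Rintegral fineK// ge0_fin_numE//.
by apply: integral_ge0 => x _; rewrite lee_fin.
Qed.

Lemma integral_le1_fin d (T : measurableType d) (R : realType)
    (m : {measure set T -> \bar R}) (D : set T) (f : T -> R) : measurable D ->
  measurable_fun D f -> (m D < +oo)%E -> (forall x, 0 <= f x <= 1) ->
  (\int[m]_(x in D) (f x)%:E < +oo)%E.
Proof.
move=> mD mf Dfin f01; apply: (@le_lt_trans _ _ (\int[m]_(x in D) 1)%E).
  apply: ge0_le_integral => //.
  - by move=> x _; rewrite lee_fin; case/andP: (f01 x).
  - exact/measurable_EFinP.
  - by move=> x _; rewrite lee_fin; case/andP: (f01 x).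
by rewrite integral_cst// mul1e.
Qed.

Section product_test.
Context (R : realType) (T1 T2 : ptopologicalType).
Hypotheses (r1 : borel_retract R T1) (r2 : borel_retract R T2).
Context (M : {finite_measure set (borel T1 * borel T2)%type -> \bar R})
  (m1 : {finite_measure set (borel T1) -> \bar R}) (P : probability (borel T2) R).
Local Open Scope ereal_scope.

Hypothesis test : forall (phi : T1 -> R) (g : T2 -> R), continuous phi -> continuous g ->
  (forall x, 0 <= phi x <= 1)%R -> (forall x, 0 <= g x <= 1)%R ->
  \int[M]_p (phi p.1 * g p.2)%:E = \int[m1]_x (phi x)%:E * \int[P]_y (g y)%:E.

Let prod01 (a b : R) : (0 <= a <= 1)%R -> (0 <= b <= 1)%R -> (0 <= a * b <= 1)%R.
Proof. by move=> /andP[a0 a1] /andP[b0 b1]; rewrite mulr_ge0// mulr_ile1. Qed.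

Let rectangle (B : set (borel T2)) (h : nat -> T2 -> R) : measurable B ->
  (forall n, continuous (h n)) -> (forall n y, 0 <= h n y <= 1)%R ->
  (forall y, h n y @[n --> \oo] --> (\1_B y : R)) ->
  forall A, measurable A -> M (A `*` B) = \int[m1]_(x in A) P B.
Proof.
move=> mB hc h01 hB.
have mTB : measurable (setT `*` B : set (borel T1 * borel T2)%type) by exact: measurableX.
have MTB : M (setT `*` B) < +oo by rewrite ltey_eq fin_num_measure.
have [mu1 mu1E] := finite_pushforward mTB (@measurable_fst _ _ (borel T1) (borel T2)) MTB.
pose b := fine (P B).
have bE : P B = b%:E by rewrite fineK// fin_num_measure.
have b0 : (0 <= b)%R by exact: fine_ge0.
have [//|//||mu2 mu2E] := @finite_transport _ _ (borel T1) (borel T1) R m1 setT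
  (fun=> b) id measurableT _ _ (@measurable_id _ _ _).
  by rewrite integral_cst// lte_mul_pinfty// ltey_eq fin_num_measure.
have agree (phi : T1 -> R) : continuous phi -> (forall x, 0 <= phi x <= 1)%R ->
    \int[mu1]_x (phi x)%:E = \int[mu2]_x (phi x)%:E.
  move=> phic phi01.
  have mphi : measurable_fun setT (phi : borel T1 -> R) by exact: continuous_measurable_real.
  have phi0 x : (0 <= phi x)%R by case/andP: (phi01 x).
  rewrite mu1E; last 2 first.
  - exact/measurable_EFinP.
  - by move=> x; rewrite lee_fin.
  rewrite mu2E; last 2 first.
  - exact/measurable_EFinP.
  - by move=> x; rewrite lee_fin.
  rewrite ge0_integralZl//; last 2 first.
  - exact/measurable_EFinP.
  - by move=> x _; rewrite lee_fin.
  have mh n : measurable_fun setT (h n : borel T2 -> R) by exact: continuous_measurable_real.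
  have c1 : \int[M]_p (phi p.1 * h n p.2)%:E @[n --> \oo] -->
      \int[M]_p (phi p.1 * \1_B p.2)%:E.
    apply: (@bounded_cvg R _ _ M (fun n p => phi p.1 * h n p.2)%R
      (fun p => phi p.1 * \1_B p.2)%R).
    - by move=> n; apply: measurable_funM; exact: measurableT_comp.
    - by move=> n p; exact: prod01.
    - by move=> p; apply: cvgM; [exact: cvg_cst|exact: hB].
  have c2 : \int[M]_p (phi p.1 * h n p.2)%:E @[n --> \oo] -->
      \int[m1]_x (phi x)%:E * P B.
    under eq_fun do rewrite (test phic (hc _) phi01 (h01 _)).
    apply: cvgeMl; last exact: (bounded_cvg_indic (m := P) mB mh h01 hB).
    rewrite ge0_fin_numE; last by apply: integral_ge0 => x _; rewrite lee_fin.
    by apply: integral_le1_fin => //; rewrite ltey_eq fin_num_measure.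
  have := cvg_unique _ c1 c2; rewrite -bE muleC => <- //.
  rewrite [LHS]integral_mkcond; apply: eq_integral => p _; rewrite patchE indicE.
  case: ifPn => [/set_mem[_ Bp]|/negP pB]; first by rewrite mem_set// mulr1.
  by rewrite memNset ?mulr0// => Bp; apply: pB; exact/mem_set.
move=> A mA; rewrite integral_cst// bE.
have mu12 := finite_measure_eq_continuous r1 agree mA.
have indA x : 0 <= (\1_A x : R)%:E by rewrite lee_fin.
have mindA := @measurable_EFin_indic _ _ R A mA.
rewrite -(integral_indicT mu1 mA) -(integral_indicT mu2 mA) in mu12.
rewrite mu1E// mu2E// in mu12.
rewrite ge0_integralZl// integral_indicT// in mu12.
rewrite -mu12 [in RHS]integral_mkcond -integral_indicT; last exact: measurableX.
apply: eq_integral => p _; rewrite patchE indicE.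
case: ifPn => [/set_mem[_ Bp]|/negP pB].
  by rewrite indicE; congr ((nat_of_bool _)%:R%:E); apply/idP/idP => /set_mem;
    [move=> -[Ap _]|move=> Ap]; apply/mem_set.
by rewrite memNset// => -[_ Bp]; apply: pB; exact/mem_set.
Qed.

Lemma product_test f : measurable_fun setT f -> (forall p, 0 <= f p) ->
  \int[M]_p f p = \int[m1]_x \int[P]_y f (x, y).
Proof.
have [N [N' [c [s [rho [cc ms rc cK]]]]]] := r2.
have mP : pkernel (fun _ : borel T1 => P) by move=> U mU; exact: measurable_cst.
suff [_ H] : disintegrates M m1 (fun=> P) by exact: H.
apply: (disintegrates_rectangle (lower_sets_generate cc ms rc cK)) => //.
- exact: lower_sets_setI.
- by left.
- move=> A B mA [->|[q ->]].
    apply: (rectangle (h := fun _ _ => 1%R)) => //.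
    + by move=> n; exact: cst_continuous.
    + by move=> _ _; rewrite ler01 lexx.
    + by move=> y; rewrite indicE mem_set//; exact: cvg_cst.
  apply: (rectangle (h := lower_approx c q)) => //.
  + rewrite (lower_sets_generate cc ms rc cK); apply: sub_sigma_algebra.
    by right; exists q.
  + by move=> n; exact: lower_approx_continuous.
  + by move=> n y; exact: lower_approx_itv.
  + by move=> y; exact: lower_approx_cvg.
Qed.

End product_test.

Lemma ae_of_null d (T : measurableType d) (R : realType) (mu : set T -> \bar R) (N : set T)
    (P : T -> Prop) : measurable N -> mu N = 0%E -> (forall x, ~ N x -> P x) ->
  {ae mu, forall x, P x}.
Proof.
move=> mN N0 NP; exists N; split => // x /= nPx.
by apply: contrapT => /NP.
Qed.

Lemma ae_sub d (T : measurableType d) (R : realType) (mu : set T -> \bar R)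
    (P Q : T -> Prop) : (forall x, P x -> Q x) ->
  {ae mu, forall x, P x} -> {ae mu, forall x, Q x}.
Proof.
by move=> PQ [N [mN N0 PN]]; exists N; split => // x nQ; apply: PN => /PQ.
Qed.

Lemma double_disintegration (R : realType) d1 (T1 : measurableType d1) (T2 T3 : ptopologicalType) :
  borel_retract R T2 -> borel_retract R T3 ->
  forall Q : {finite_measure set (T1 * borel T2 * borel T3)%type -> \bar R},
  exists (lam : {finite_measure set T1 -> \bar R})
    (ks : T1 -> probability (borel T2) R) (ka : T1 * borel T2 -> probability (borel T3) R)
    (C : {finite_measure set (T1 * borel T2)%type -> \bar R}),
  disintegrates C lam ks /\ disintegrates Q C ka.
Proof.
move=> r2 r3 Q.
have Qfin : (Q setT < +oo)%E by rewrite ltey_eq fin_num_measure.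
have [C CE] := finite_pushforward measurableT (@measurable_fst _ _ (T1 * borel T2)%type (borel T3)) Qfin.
have Cfin : (C setT < +oo)%E by rewrite ltey_eq fin_num_measure.
have [lam lamE] := finite_pushforward measurableT (@measurable_fst _ _ T1 (borel T2)) Cfin.
have mC : marginal Q C by apply: integral_marginal => f mf f0; rewrite CE.
have ml : marginal C lam by apply: integral_marginal => f mf f0; rewrite lamE.
have [ka dka] := borel_retract_disintegrable r3 mC.
have [ks dks] := borel_retract_disintegrable r2 ml.
by exists lam, ks, ka, C; split.
Qed.

Section decomposition.
Context (R : realType) (d : nat) (E : normedModType R) (Omega : set 'rV[R]_d).
Hypothesis Ee : euclidean_space E.
Hypothesis Omega_open : open Omega.
Hypothesis Omega_bounded : bounded_set Omega.
Local Notation V := 'rV[R]_d.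
Local Notation Z := (torus R d).
Local Notation W := (V * Z * E)%type.
Local Notation X := (borel V * borel Z)%type.
Local Notation K := (compactification E Omega).
Local Notation leb := (lebesgue_rV d \x (@torus_measure R d))%E.
Local Open Scope ereal_scope.

Let mOmega : measurable (Omega : set (borel V)).
Proof. exact: borel_open. Qed.

Definition inner : set (borel W) := [set w | (`|w.2| < 1)%R].
Definition outer : set (borel W) := [set w | (`|w.2| = 1)%R].

Lemma measurable_norm_snd : measurable_fun setT (fun w : borel W => `|w.2|%R).
Proof.
have m2 : measurable_fun setT (fun w : borel W => w.2 : borel E).
  exact: (measurableT_comp measurable_snd (@measurable_split R d E)).
apply: (measurableT_comp (f := fun z : borel E => `|z : E|%R) _ m2).
by apply: continuous_measurable_real; exact: norm_continuous.
Qed.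

Lemma measurable_inner : measurable inner.
Proof.
have := measurable_norm_snd measurableT (measurable_itv `]-oo, 1%R[).
rewrite setTI (_ : _ @^-1` _ = inner)//.
Qed.

Lemma measurable_outer : measurable outer.
Proof.
have := measurable_norm_snd measurableT (measurable_set1 (1%R : R)).
by rewrite setTI.
Qed.

Lemma integral_leb_slab (H : X -> \bar R) : measurable_fun setT H -> (forall p, 0 <= H p) ->
  \int[leb]_(p in Omega `*` setT) H p =
  \int[lebesgue_rV d]_(x in Omega) \int[torus_measure]_xi H (x, xi).
Proof.
move=> mH H0; have mO : measurable (Omega `*` setT : set X) by exact: measurableX.
rewrite integral_mkcond [RHS]integral_mkcond.
have -> : \int[leb]_p (H \_ (Omega `*` setT)) p = \int[lebesgue_rV d]_x
    \int[torus_measure]_xi (H \_ (Omega `*` setT)) (x, xi).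
  apply: fubini_tonelli1.
    exact: (measurable_restrictT _ mO).1 (measurable_funTS mH).
  by move=> p; rewrite patchE; case: ifP.
apply: eq_integral => x _; rewrite patchE; case: ifPn => [/set_mem Ox|/negP Ox].
  by apply: eq_integral => xi _; rewrite patchE mem_set.
apply: integral0_eq => xi _; rewrite patchE memNset// => -[h _].
by apply: Ox; exact/mem_set.
Qed.

Context (m : {finite_measure set (borel W) -> \bar R}).
Hypothesis m_supp : forall A : set (borel W), measurable A -> K `&` A = set0 -> m A = 0.

Lemma ae_compactification : {ae m, forall w, K w}.
Proof.
have mK : measurable (K : set (borel W)) by exact: compactification_measurable.
apply: (ae_of_null (measurableC mK)).
  by apply: m_supp; [exact: measurableC|exact: setICr].
by move=> w; apply: contrapT.
Qed.

Lemma integral_inner_outer (f : borel W -> \bar R) : measurable_fun setT f ->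
  (forall w, 0 <= f w) -> \int[m]_w f w = \int[m]_(w in inner) f w + \int[m]_(w in outer) f w.
Proof.
move=> mf f0; rewrite -ge0_integral_setU//; last 4 first.
- exact: measurable_inner.
- exact: measurable_outer.
- exact: measurable_funTS.
- apply/disj_setPS => w [w1 w2]; have {}w1 : (`|w.2| < 1)%R := w1.
  have {}w2 : (`|w.2| = 1)%R := w2.
  by move: w1; rewrite w2 ltxx.
rewrite [RHS]integral_mkcond; apply: ge0_ae_eq_integral_nomeas => //.
  by move=> w; rewrite patchE; case: ifP.
apply: ae_sub ae_compactification => w.
rewrite compactificationE => -[_ w1]; rewrite patchE mem_set//.
by move: w1; rewrite le_eqVlt => /orP[/eqP|]; [right|left].
Qed.

Lemma outer_part : exists (lam : {finite_measure set (borel V) -> \bar R})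
    (ks : borel V -> probability (borel Z) R) (ka : X -> probability (borel E) R)
    (C : {finite_measure set X -> \bar R})
    (Q2 : {finite_measure set (X * borel E)%type -> \bar R}),
  [/\ disintegrates C lam ks, disintegrates Q2 C ka &
    forall f : X * borel E -> \bar R, measurable_fun setT f -> (forall p, 0 <= f p) ->
    \int[Q2]_p f p = \int[m]_(w in outer) f ((w.1.1, w.1.2), w.2)].
Proof.
have moo : m outer < +oo by rewrite ltey_eq fin_num_measure//; exact: measurable_outer.
have [Q2 Q2E] := finite_pushforward measurable_outer (@measurable_split R d E) moo.
have [lam [ks [ka [C [dC dQ2]]]]] := @double_disintegration R _ (borel V) Z E
  (borel_retract_torus R d) (borel_retract_euclidean Ee) Q2.
by exists lam, ks, ka, C, Q2; split.
Qed.

Hypothesis m_prop : forall (phi : V -> R) (g : Z -> R), continuous phi -> continuous g ->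
  (forall x, 0 <= phi x <= 1)%R -> (forall xi, 0 <= g xi <= 1)%R ->
  (\int[m]_(w in K) (phi w.1.1 * g w.1.2 * (1 - `|w.2|)) =
  (\int[lebesgue_rV d]_(x in Omega) phi x) * (\int[torus_measure]_xi g xi))%R.

Let depth (w : borel W) : R := Num.max 0%R (1 - `|w.2|)%R.

Let measurable_depth : measurable_fun setT depth.
Proof.
apply: measurable_maxr; first exact: measurable_cst.
by apply: measurable_funB => //; exact: measurable_norm_snd.
Qed.

Let depth_ge0 w : (0 <= depth w)%R.
Proof. by rewrite le_max lexx. Qed.

Let depth_le1 w : (depth w <= 1)%R.
Proof. by rewrite ge_max ler01 lerBlDr lerDl normr_ge0. Qed.

Let depth_inner w : inner w -> depth w = (1 - `|w.2|)%R.
Proof. by move=> w1; apply/max_idPr; rewrite subr_ge0 ltW. Qed.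

Let weighted_test (phi : V -> R) (g : Z -> R) : continuous phi -> continuous g ->
  (forall x, 0 <= phi x <= 1)%R -> (forall xi, 0 <= g xi <= 1)%R ->
  \int[m]_(w in inner) ((depth w)%:E * (phi w.1.1 * g w.1.2)%:E) =
  \int[lebesgue_rV d]_(x in Omega) (phi x)%:E * \int[torus_measure]_xi (g xi)%:E.
Proof.
move=> phic gc phi01 g01.
have phi0 x : (0 <= phi x)%R by case/andP: (phi01 x).
have g0 x : (0 <= g x)%R by case/andP: (g01 x).
pose F w := (phi w.1.1 * g w.1.2 * depth w)%R.
have F0 w : (0 <= F w)%R by rewrite mulr_ge0// mulr_ge0.
have F1 w : (F w <= 1)%R.
  by case/andP: (phi01 w.1.1) => _ h1; case/andP: (g01 w.1.2) => _ h2;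
    rewrite mulr_ile1// ?mulr_ge0// mulr_ile1.
have mphi : measurable_fun setT (phi : borel V -> R) by exact: continuous_measurable_real.
have mg : measurable_fun setT (g : borel Z -> R) by exact: continuous_measurable_real.
have mF : measurable_fun setT (F : borel W -> R).
  apply: measurable_funM => //; apply: measurable_funM.
    exact: (measurableT_comp mphi (continuous_measurable_borel (@continuous_fst_fst V Z E))).
  exact: (measurableT_comp mg (continuous_measurable_borel (@continuous_fst_snd V Z E))).
have mK : measurable (K : set (borel W)) by exact: compactification_measurable.
have := congr1 EFin (m_prop phic gc phi01 g01).
rewrite EFinM (EFin_Rintegral (m := lebesgue_rV d) phi0); last first.
  apply: (integral_le1_fin mOmega) => //; first exact: measurable_funTS.
  exact: lebesgue_bounded.
rewrite (EFin_Rintegral (m := torus_measure) g0); last first.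
  by apply: integral_le1_fin => //; rewrite ltey_eq fin_num_measure.
move=> <-.
rewrite (_ : (\int[m]_(w in K) _)%R = (\int[m]_(w in K) F w)%R); last first.
  apply: eq_Rintegral => w; rewrite compactificationE => /set_mem[_ w1].
  by rewrite /F /depth; congr (_ * _)%R; apply/esym/max_idPr; rewrite subr_ge0.
rewrite EFin_Rintegral//; last first.
  apply: integral_le1_fin => //; first exact: measurable_funTS.
    by rewrite ltey_eq fin_num_measure.
  by move=> w; rewrite F0 F1.
rewrite [LHS]integral_mkcond [RHS]integral_mkcond.
apply: ge0_ae_eq_integral_nomeas => //.
- by move=> w; rewrite patchE; case: ifP => // _; rewrite -EFinM lee_fin !mulr_ge0.
- by move=> w; rewrite patchE; case: ifP => // _; rewrite lee_fin.
apply: ae_sub ae_compactification => w Kw.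
rewrite !patchE (mem_set Kw); case: ifPn => [_|/negP w1].
  by rewrite -EFinM /F mulrC.
rewrite /F /depth (_ : Num.max _ _ = 0%R) ?mulr0//.
apply/max_idPl; rewrite subr_le0 leNgt; apply/negP => h; apply: w1.
exact/mem_set.
Qed.

Lemma inner_part : exists k : X -> probability (borel E) R, pkernel k /\
  forall f : borel W -> \bar R, measurable_fun setT f -> (forall w, 0 <= f w) ->
    \int[m]_(w in inner) f w = \int[leb]_(p in Omega `*` setT)
      \int[k p]_z ((weight (p, z))%:E * f (to_ball (p, z))).
Proof.
have depth_fin : \int[m]_(w in inner) (depth w)%:E < +oo.
  apply: (integral_le1_fin measurable_inner); first exact: measurable_funTS.
    by rewrite ltey_eq fin_num_measure//; exact: measurable_inner.
  by move=> w; rewrite depth_ge0 depth_le1.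
have [Q1 Q1E] := finite_transport measurable_inner measurable_depth depth_ge0
  (measurable_from_ball Ee) depth_fin.
have Q1fin : Q1 setT < +oo by rewrite ltey_eq fin_num_measure.
have [M1 M1E] := finite_pushforward measurableT (@measurable_fst _ _ X (borel E)) Q1fin.
have mQ1 : marginal Q1 M1 by apply: integral_marginal => f mf f0; rewrite M1E.
have [k [mk kE]] := borel_retract_disintegrable (borel_retract_euclidean Ee) mQ1.
have [m1 m1E] := finite_pushforward mOmega (@measurable_id _ (borel V) setT)
  (lebesgue_bounded Omega_open Omega_bounded).
have test (phi : V -> R) (g : Z -> R) : continuous phi -> continuous g ->
    (forall x, 0 <= phi x <= 1)%R -> (forall x, 0 <= g x <= 1)%R ->
    \int[M1]_p (phi p.1 * g p.2)%:E = \int[m1]_x (phi x)%:E * \int[torus_measure]_y (g y)%:E.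
  move=> phic gc phi01 g01.
  have mphi : measurable_fun setT (phi : borel V -> R) by exact: continuous_measurable_real.
  have mg : measurable_fun setT (g : borel Z -> R) by exact: continuous_measurable_real.
  have phi0 x : (0 <= phi x)%R by case/andP: (phi01 x).
  have g0 x : (0 <= g x)%R by case/andP: (g01 x).
  have mpg : measurable_fun setT (fun p : X => (phi p.1 * g p.2)%:E).
    by apply/measurable_EFinP; apply: measurable_funM; exact: measurableT_comp.
  rewrite M1E//; last by move=> p; rewrite lee_fin mulr_ge0.
  rewrite m1E; last 2 first.
  - exact/measurable_EFinP.
  - by move=> x; rewrite lee_fin.
  rewrite -(weighted_test phic gc phi01 g01) Q1E.
  - by [].
  - exact: (measurableT_comp mpg measurable_fst).
  - by move=> p; rewrite lee_fin mulr_ge0.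
exists k; split => // f mf f0.
have mH : measurable_fun setT (fun p : X * borel E => (weight p)%:E * f (to_ball p)).
  apply: emeasurable_funM; first by apply/measurable_EFinP; exact: measurable_weight.
  exact: (measurableT_comp mf (measurable_to_ball Ee)).
have H0 (p : X * borel E) : 0 <= (weight p)%:E * f (to_ball p).
  by rewrite mule_ge0// lee_fin /weight addr_ge0.
have mkH : measurable_fun setT
    (fun p : X => \int[k p]_z ((weight (p, z))%:E * f (to_ball (p, z)))).
  exact: (measurable_pkernel_integral mk mH H0).
have kH0 (p : X) : 0 <= \int[k p]_z ((weight (p, z))%:E * f (to_ball (p, z))).
  by apply: integral_ge0 => z _; exact: H0.
rewrite integral_leb_slab//.
have mP : pkernel (fun _ : borel V => @torus_measure R d : probability _ _).
  by move=> U mU; exact: measurable_cst.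
have m1f := measurable_pkernel_integral mP mkH kH0.
rewrite -(m1E _ m1f); last by move=> x; exact: integral_ge0.
rewrite -(product_test (borel_retract_rV R d) (borel_retract_torus R d) test mkH kH0).
transitivity (\int[Q1]_p ((weight p)%:E * f (to_ball p))); last exact: (kE _ mH H0).
rewrite Q1E//; apply: eq_integral => w /set_mem w1.
rewrite from_ballK// muleA -EFinM depth_inner// /weight from_ball_weight//.
by rewrite divff ?mul1e// gt_eqF// subr_gt0.
Qed.

End decomposition.

Lemma measurable_pkernel_Rintegral d1 d2 (X : measurableType d1) (Y : measurableType d2)
    (R : realType) (k : X -> probability Y R) (D : set Y) (h : Y -> R) :
  pkernel k -> measurable D -> measurable_fun D h ->
  measurable_fun setT (fun x => \int[k x]_(y in D) h y).
Proof.
move=> mk mD mh; pose H := (EFin \o h) \_ D.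
have mH : measurable_fun setT H.
  by apply: (measurable_restrictT _ mD).1; exact/measurable_EFinP.
rewrite (_ : (fun x => _) = fine \o (fun x =>
    \int[k x]_y H^\+ y - \int[k x]_y H^\- y)%E); last first.
  by apply/funext => x /=; rewrite /Rintegral integral_mkcond integralE.
apply: measurableT_comp => //; apply: emeasurable_funB.
  apply: (measurable_pkernel_integral mk (f := fun p => H^\+ p.2)%E) => //.
  exact: measurableT_comp (measurable_funepos mH) measurable_snd.
apply: (measurable_pkernel_integral mk (f := fun p => H^\- p.2)%E) => //.
exact: measurableT_comp (measurable_funeneg mH) measurable_snd.
Qed.

Lemma weakstar_of_pkernel d (T : measurableType d) (R : realType) (mu : set T -> \bar R)
    (D : set T) (Y : ptopologicalType) (S : set Y) (C : set (Y -> R))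
    (k : T -> probability (borel Y) R) :
  mu set0 = 0%E -> pkernel k -> measurable (S : set (borel Y)) ->
  (forall h, C h -> measurable_fun (S : set (borel Y)) (h : borel Y -> R)) -> weakstar_measurable mu D S C k.
Proof.
move=> mu0 mk mS mC h Ch; exists (fun x => \int[k x]_(y in S) h y).
  by apply: measurable_funTS; apply: measurable_pkernel_Rintegral => //; exact: mC.
by apply: (ae_of_null measurable0).
Qed.

Lemma disintegrates_fst d1 d2 (X : measurableType d1) (Y : measurableType d2)
    (R : realType) (m : {measure set (X * Y)%type -> \bar R}) (m1 : {measure set X -> \bar R})
    (k : X -> probability Y R) : disintegrates m m1 k ->
  forall A, measurable A -> (\int[m]_p (\1_A p.1)%:E = m1 A)%E.
Proof.
move=> [mk kE] A mA; rewrite (kE (fun p => (\1_A p.1)%:E)).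
- rewrite -integral_indicT//; apply: eq_integral => x _ /=.
  rewrite integral_cst// [X in (_ * X)%E](_ : _ = 1%E) ?mule1//.
  exact: probability_setT.
- exact: (measurableT_comp (measurable_EFin_indic mA) measurable_fst).
- by move=> p; rewrite lee_fin.
Qed.

Section superset.
Context (R : realType) (d : nat) (E : normedModType R) (Omega : set 'rV[R]_d).
Hypothesis Ee : euclidean_space E.
Hypothesis Omega_open : open Omega.
Hypothesis Omega_bounded : bounded_set Omega.
Hypothesis Omega_frontier : lebesgue_rV d (frontier Omega) = 0%E.
Local Notation V := 'rV[R]_d.
Local Notation Z := (torus R d).
Local Notation W := (V * Z * E)%type.
Local Notation X := (borel V * borel Z)%type.
Local Notation K := (compactification E Omega).
Local Notation leb := (lebesgue_rV d \x (@torus_measure R d))%E.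
Local Notation sphere := (frontier (@unit_ball R E)).
Local Open Scope ereal_scope.

Let mOmega : measurable (Omega : set (borel V)).
Proof. exact: borel_open. Qed.

Let mclosure : measurable (closure Omega : set (borel V)).
Proof. by apply: measurable_closed; exact: closed_closure. Qed.

Lemma closed_sphere : closed sphere.
Proof.
rewrite frontier_unit_ball.
rewrite (_ : [set z | _] = (fun z : E => `|z|%R) @^-1` [set r | r = 1%R])//.
by apply: closed_comp; [move=> z _; exact: norm_continuous|exact: closed_eq].
Qed.

Lemma integral_closure_slab (f : X -> \bar R) : (forall p, 0 <= f p) ->
  \int[leb]_(p in closure Omega `*` setT) f p = \int[leb]_(p in Omega `*` setT) f p.
Proof.
move=> f0; rewrite integral_mkcond [RHS]integral_mkcond.
apply: ge0_ae_eq_integral_nomeas.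
- by move=> p; rewrite patchE; case: ifP.
- by move=> p; rewrite patchE; case: ifP.
have mF : measurable (frontier Omega : set (borel V)).
  by apply: measurableD => //; apply: borel_open; exact: open_interior.
have mFX : measurable (frontier Omega `*` setT : set X) by exact: measurableX.
apply: (ae_of_null mFX); first exact: etrans (leb_rectangle mF) Omega_frontier.
move=> p Np; rewrite !patchE; case: ifPn => [/set_mem[Op _]|/negP Op].
  rewrite mem_set//; split => //; apply: contrapT => nO; apply: Np; split => //.
  by split => // /interior_subset.
rewrite memNset// => -[h _]; apply: Op; apply/mem_set; split => //.
exact: subset_closure.
Qed.

Lemma conc_VZE nu (C : {measure set X -> \bar R}) :
  disintegrates C (conc nu) (conc_scale nu : borel V -> probability (borel Z) R) ->
  forall A : set X, measurable A -> @conc_VZ R d E nu A = C A.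
Proof.
move=> [mk CE] A mA; rewrite -(integral_indicT C mA) CE; last 2 first.
- exact: measurable_EFin_indic.
- by move=> p; rewrite lee_fin.
apply: eq_integral => x _; rewrite -integral_indicT; last exact: measurable_xsection.
apply: eq_integral => xi _; rewrite !indicE; congr ((nat_of_bool _)%:R%:E).
by rewrite mem_xsection.
Qed.

Lemma regular_two_scale nu (C : {measure set X -> \bar R}) :
  regular_quadruple Omega nu ->
  disintegrates C (conc nu) (conc_scale nu : borel V -> probability (borel Z) R) ->
  conc nu (~` closure Omega) = 0 ->
  {ae C, forall p, conc_angle nu p.1 p.2 sphere = 1} ->
  two_scale_young_measure Omega nu.
Proof.
move=> [mo ms ma ofin] dC nc angle.
have CVZ := conc_VZE dC.
have VZ0 : @conc_VZ R d E nu set0 = 0 by rewrite CVZ.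
have leb0 : @lebesgue_VZ R d set0 = 0 by exact: (measure0 leb).
split => //.
- split.
    apply: (@weakstar_of_pkernel _ _ R _ _ E setT _ (fun p : X => osc nu p.1 p.2)) => //.
    by move=> h [hc _]; exact: continuous_measurable_real.
  apply: le_lt_trans _ ofin; rewrite le_eqVlt; apply/orP; left; apply/eqP.
  by apply: integral_closure_slab => p; exact: integral_ge0.
- apply: (@weakstar_of_pkernel _ _ R _ _ Z setT _ (conc_scale nu : borel V -> _)) => //.
  by move=> h hc; exact: continuous_measurable_real.
- have msph : measurable (sphere : set (borel E)).
    by apply: measurable_closed; exact: closed_sphere.
  split.
    apply: (@weakstar_of_pkernel _ _ R _ _ E sphere _ (fun p : X => conc_angle nu p.1 p.2)) => //.
    by move=> h hc; exact: within_continuous_measurable.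
  have [N [mN N0 sub]] := angle; apply: (ae_of_null mN).
    by rewrite CVZ.
  by move=> p Np _; apply: contrapT => h; apply: Np; exact: sub.
Qed.

Context (m : {finite_measure set (borel W) -> \bar R}).
Hypothesis m_supp : forall A : set (borel W), measurable A -> K `&` A = set0 -> m A = 0.
Hypothesis m_prop : forall (phi : V -> R) (g : Z -> R), continuous phi -> continuous g ->
  (forall x, 0 <= phi x <= 1)%R -> (forall xi, 0 <= g xi <= 1)%R ->
  (\int[m]_(w in K) (phi w.1.1 * g w.1.2 * (1 - `|w.2|)) =
  (\int[lebesgue_rV d]_(x in Omega) phi x) * (\int[torus_measure]_xi g xi))%R.

Lemma realizing_quadruple : exists nu : young_quadruple E,
  two_scale_young_measure Omega nu /\ realizes Omega nu m.
Proof.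
have [k [mk kE]] := inner_part Ee Omega_open Omega_bounded m_supp m_prop.
have [lam [ks [ka [C [Q2 [dC dQ2 Q2E]]]]]] := outer_part Ee m.
pose nu : young_quadruple E := YoungQuadruple (fun x xi => k (x, xi)) lam ks
  (fun x xi => ka (x, xi)).
have oscE (p : X) : osc nu p.1 p.2 = k p by case: p.
have angleE (p : X) : conc_angle nu p.1 p.2 = ka p by case: p.
have mo : pkernel (fun p : X => osc nu p.1 p.2).
  by rewrite (_ : (fun p : X => _) = k)//; apply/funext => p; exact: oscE.
have ma : pkernel (fun p : X => conc_angle nu p.1 p.2).
  by rewrite (_ : (fun p : X => _) = ka)//; [exact: dQ2.1|apply/funext => p; exact: angleE].
have ms : pkernel (conc_scale nu : borel V -> probability (borel Z) R) by exact: dC.1.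
have mfin : m setT < +oo by rewrite ltey_eq fin_num_measure.
have ofin : \int[leb]_(p in Omega `*` setT) \int[osc nu p.1 p.2]_z `|z : E|%:E < +oo.
  apply: (@le_lt_trans _ _ (\int[m]_(w in @inner R d E) 1)).
    rewrite (kE (fun=> 1))//; apply: ge0_le_integral.
    - exact: measurableX.
    - by move=> p _; exact: integral_ge0.
    - apply: measurable_funTS.
      apply: (measurable_pkernel_integral mo (f := fun q : X * borel E => `|q.2 : E|%:E)) => //.
      apply/measurable_EFinP.
      apply: (measurableT_comp (f := fun z : borel E => `|z : E|%R) _ measurable_snd).
      by apply: continuous_measurable_real; exact: norm_continuous.
    - apply: measurable_funTS.
      apply: (measurable_pkernel_integral mk (f := fun q : X * borel E => (weight q)%:E * 1)).
        by under eq_fun do rewrite mule1; apply/measurable_EFinP; exact: measurable_weight.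
      by move=> q; rewrite mule1 lee_fin /weight addr_ge0.
    move=> p _; rewrite oscE; apply: ge0_le_integral => //.
    - apply/measurable_EFinP.
      by apply: continuous_measurable_real; exact: norm_continuous.
    - under eq_fun do rewrite mule1; apply/measurable_EFinP; rewrite /weight /=.
      apply: measurable_funD => //.
      by apply: continuous_measurable_real; exact: norm_continuous.
    - by move=> z _; rewrite mule1 lee_fin /weight /= lerDr.
  apply: (@le_lt_trans _ _ (\int[m]_w 1)).
    by apply: ge0_subset_integral => //; exact: measurable_inner.
  by rewrite -measure_setTE.
have rnu : regular_quadruple Omega nu by [].
have msph : measurable (sphere : set (borel E)).
  by apply: measurable_closed; exact: closed_sphere.
have Q2ae (f : X * borel E -> \bar R) : measurable_fun setT f -> (forall p, 0 <= f p) ->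
    (forall w, K w -> @outer R d E w -> f ((w.1.1, w.1.2), w.2) = 0) -> \int[Q2]_p f p = 0.
  move=> mf f0 fK; rewrite Q2E//.
  transitivity (\int[m]_(w in @outer R d E) (fun=> 0 : \bar R) w); last exact: integral0.
  apply: ge0_ae_eq_integral_in => //.
  by apply: ae_sub (ae_compactification m_supp) => w Kw ow; exact: fK.
have nc : lam (~` closure Omega) = 0.
  have mnc : measurable (~` closure Omega : set (borel V)) by exact: measurableC.
  rewrite -(disintegrates_fst dC mnc).
  have mf1 : measurable_fun setT (fun q : X * borel E => (\1_(~` closure Omega) q.1.1)%:E : \bar R).
    exact: (measurableT_comp (measurable_EFin_indic mnc) (measurableT_comp measurable_fst measurable_fst)).
  transitivity (\int[Q2]_q (\1_(~` closure Omega) q.1.1)%:E).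
    rewrite (dQ2.2 _ mf1); last by move=> q; rewrite lee_fin.
    apply: eq_integral => p _ /=; rewrite integral_cst// [X in _ * X](_ : _ = 1) ?mule1//.
    exact: probability_setT.
  apply: Q2ae => // w; rewrite compactificationE => -[Ow _] _.
  rewrite (_ : \1_(~` closure Omega) _ = 0%R)//.
  by rewrite indicE memNset// => h; exact: h.
have angle : {ae C, forall p : X, conc_angle nu p.1 p.2 sphere = 1}.
  have mns : measurable (~` sphere : set (borel E)) by exact: measurableC.
  have mf1 : measurable_fun setT (fun q : X * borel E => (\1_(~` sphere) q.2)%:E : \bar R).
    exact: (measurableT_comp (measurable_EFin_indic mns) measurable_snd).
  have f0 (q : X * borel E) : 0 <= (\1_(~` sphere) q.2)%:E :> \bar R by rewrite lee_fin.
  have : \int[Q2]_q (\1_(~` sphere) q.2)%:E = 0.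
    apply: Q2ae => // w _ ow; rewrite (_ : \1_(~` sphere) _ = 0%R)//.
    rewrite indicE memNset// => h; apply: h.
    by rewrite frontier_unit_ball.
  rewrite (dQ2.2 _ mf1 f0) => C0.
  have C1 : \int[C]_p `|ka p (~` sphere)| = 0.
    rewrite -C0; apply: eq_integral => p _; rewrite gee0_abs//.
    by rewrite -(integral_indicT (ka p) mns).
  have [H _] := ae_eq_integral_abs C measurableT (dQ2.1 _ mns).
  apply: ae_sub (H C1) => p Hp; rewrite angleE.
  have kp : ka p (~` sphere) = 0 := Hp I.
  by rewrite -[sphere]setCK probability_setC// [X in _ - X]kp sube0.
exists nu; split; first exact: (regular_two_scale rnu dC nc angle).
have [Q1 Q1E] := pkernel_product mo leb.
apply: (@represents_realizes R d E Omega Ee Omega_open Omega_bounded nu m C Q1 Q2 rnu).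
split => //.
- exact: dC.2.
- move=> f mf f0; rewrite (dQ2.2 _ mf f0); apply: eq_integral => p _.
  by rewrite angleE.
move=> f mf f0; rewrite (integral_inner_outer m_supp mf f0) (kE _ mf f0).
congr (_ + _).
  have mD1 := @measurable_osc_domain R d E Omega Omega_open.
  have mH : measurable_fun setT (fun p : X * borel E => (weight p)%:E * f (to_ball p)).
    apply: emeasurable_funM; first by apply/measurable_EFinP; exact: measurable_weight.
    exact: (measurableT_comp mf (measurable_to_ball Ee)).
  have H0 (p : X * borel E) : 0 <= (weight p)%:E * f (to_ball p).
    by rewrite mule_ge0// lee_fin /weight addr_ge0.
  rewrite [LHS]integral_mkcond [RHS]integral_mkcond Q1E; last 2 first.
  - exact: (measurable_restrictT _ mD1).1 (measurable_funTS mH).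
  - by move=> p; rewrite patchE; case: ifP.
  apply: eq_integral => p _; rewrite patchE oscE; case: ifPn => [/set_mem Op|/negP Op].
    by apply: eq_integral => z _; rewrite patchE mem_set.
  apply/esym; apply: integral0_eq => z _; rewrite patchE memNset// => -[h _].
  by apply: Op; exact/mem_set.
have mD2 := @measurable_conc_domain R d E Omega.
have mH : measurable_fun setT (fun p : X * borel E => f (assemble p)).
  exact: (measurableT_comp mf (measurable_assemble Ee)).
rewrite [RHS]integral_mkcond Q2E; last 2 first.
- exact: (measurable_restrictT _ mD2).1 (measurable_funTS mH).
- by move=> p; rewrite patchE; case: ifP.
apply: ge0_ae_eq_integral_in => //.
  by move=> w; rewrite patchE; case: ifP.
apply: ae_sub (ae_compactification m_supp) => w; rewrite compactificationE => -[Ow _] ow.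
rewrite patchE mem_set; first by rewrite /assemble /=; case: w {Ow ow} => -[].
by split.
Qed.

End superset.

Section regularization.
Context (R : realType) d (T : measurableType d) (mu : {measure set T -> \bar R}) (D : set T).
Context (Y : ptopologicalType) (S : set Y) (C : set (Y -> R))
  (k : T -> probability (borel Y) R).
Hypotheses (rY : borel_retract R Y) (mD : measurable D) (mS : measurable (S : set (borel Y))).
Hypothesis C_dense : forall h : Y -> R, continuous h -> (forall y, 0 <= h y <= 1) ->
  exists H : nat -> Y -> R, forall j,
    [/\ C (H j), continuous (H j), forall y, 0 <= H j y <= 1 &
        forall y, H n y @[n --> \oo] --> h y].
Hypothesis wk : weakstar_measurable mu D S C k.
Hypothesis kS : {ae mu, forall x, D x -> k x S = 1%E}.
Local Open Scope ereal_scope.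

Let integral_S x (h : Y -> R) : measurable_fun setT (h : borel Y -> R) ->
  (forall y, 0 <= h y <= 1)%R ->
  (\int[k x]_(y in S) h y)%R%:E = \int[k x]_y (h y * \1_S y)%:E.
Proof.
move=> mh h01; have h0 y : (0 <= h y)%R by case/andP: (h01 y).
rewrite EFin_Rintegral//.
  rewrite integral_mkcond; apply: eq_integral => y _; rewrite patchE indicE.
  by case: ifP => _; rewrite ?mulr1 ?mulr0.
apply: integral_le1_fin => //; first exact: measurable_funTS.
by rewrite ltey_eq fin_num_measure.
Qed.

Let mul01 (a : R) y : (0 <= a <= 1)%R -> (0 <= a * \1_S y <= 1)%R.
Proof.
by move=> a01; rewrite indicE; case: (_ \in _); rewrite ?mulr1// mulr0 lexx ler01.
Qed.

Let mmul (h : Y -> R) : continuous h ->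
  measurable_fun setT (fun y : borel Y => h y * \1_S y)%R.
Proof.
move=> hc; apply: measurable_funM; first exact: continuous_measurable_real.
exact: measurable_indic.
Qed.

Lemma weakstar_regularize : exists k' : T -> probability (borel Y) R,
  pkernel k' /\ {ae mu, forall x, D x -> k' x = k x}.
Proof.
have [N [N' [c [s [rho [cc ms rc cK]]]]]] := rY.
pose J := ('rV[rat]_N * nat)%type.
have /choice[H HP] (i : J) : exists H : nat -> Y -> R, forall j,
    [/\ C (H j), continuous (H j), forall y, (0 <= H j y <= 1)%R &
        forall y, H n y @[n --> \oo] --> lower_approx c i.1 i.2 y].
  apply: C_dense; first exact: lower_approx_continuous.
  by move=> y; exact: lower_approx_itv.
have /choice[g gP] (i : J * nat) : exists g : T -> R, measurable_fun D g /\
    {ae mu, forall x, D x -> (\int[k x]_(y in S) H i.1 i.2 y)%R = g x}.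
  have [Ci _ _ _] := HP i.1 i.2; have [g mg ag] := wk Ci.
  by exists g.
have [M [mM M0 MP]] : exists M, [/\ measurable M, mu M = 0 & forall x, ~ M x -> D x ->
    k x S = 1 /\ forall i : J * nat, (\int[k x]_(y in S) H i.1 i.2 y)%R = g i x].
  pose F n : set T := if choice.unpickle n is Some i
    then ~` [set x | D x -> (\int[k x]_(y in S) H i.1 i.2 y)%R = g i x] else set0.
  have nF : mu.-negligible (\bigcup_n F n).
    apply: negligible_bigcup => n; rewrite /F.
    case: choice.unpickle => [i|]; last exact: negligible_set0.
    exact: (gP i).2.
  have [M [mM M0 sub]] := negligibleU nF kS.
  exists M; split => // x Mx Dx; split.
    by apply: contrapT => h; apply: Mx; apply: sub; right => /(_ Dx).
  move=> i; apply: contrapT => h; apply: Mx; apply: sub; left.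
  by exists (choice.pickle i) => //; rewrite /F choice.pickleK => /(_ Dx).
pose G := D `\` M.
have mG : measurable G by exact: measurableD.
have mkU U : lower_sets c U -> measurable_fun G (fun x => k x U).
  move=> [->|[q UE]].
    apply: (eq_measurable_fun (fun=> 1)); last exact: measurable_cst.
    by move=> x _; apply/esym; exact: probability_setT.
  have mU : measurable (U : set (borel Y)).
    rewrite (lower_sets_generate cc ms rc cK); apply: sub_sigma_algebra.
    by right; exists q.
  apply: (emeasurable_fun_cvg
    (fun n x => \int[k x]_y (lower_approx c q n y * \1_S y)%:E)).
    move=> n; apply: (emeasurable_fun_cvg
      (fun j x => \int[k x]_y (H (q, n) j y * \1_S y)%:E)).
      move=> j; have [Cj Hc H01 _] := HP (q, n) j.
      apply: (eq_measurable_fun (EFin \o g (q, n, j))).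
        move=> x /set_mem[Dx Mx] /=; have [_ /(_ (q, n, j)) <-] := MP x Mx Dx.
        by rewrite integral_S//; exact: continuous_measurable_real.
      apply/measurable_EFinP; apply: measurable_funS (gP (q, n, j)).1 => //.
      exact: subDsetl.
    move=> x _; apply: (@bounded_cvg R _ _ (k x) (fun j y => H (q, n) j y * \1_S y)%R
      (fun y => lower_approx c q n y * \1_S y)%R).
    - by move=> j; apply: mmul; have [] := HP (q, n) j.
    - by move=> j y; apply: mul01; have [] := HP (q, n) j.
    - move=> y; apply: cvgM; last exact: cvg_cst.
      by have [_ _ _] := HP (q, n) 0%N; exact.
  move=> x [Dx Mx].
  have -> : k x U = \int[k x]_y (\1_U y * \1_S y)%:E.
    rewrite -(integral_indicT (k x) mU); apply: ge0_ae_eq_integral_nomeas.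
    - by move=> y; rewrite lee_fin.
    - by move=> y; rewrite lee_fin mulr_ge0.
    have mSC : measurable (~` S : set (borel Y)) by exact: measurableC.
    apply: (ae_of_null mSC).
      apply: etrans (probability_setC (k x) mS) _.
      rewrite [X in _ - X](_ : _ = 1) ?subee//.
      exact: (MP x Mx Dx).1.
    move=> y /contrapT Sy; rewrite (_ : \1_S y = 1%R) ?mulr1//.
    by rewrite indicE mem_set.
  apply: (@bounded_cvg R _ _ (k x) (fun n y => lower_approx c q n y * \1_S y)%R
      (fun y => \1_U y * \1_S y)%R).
  - by move=> n; apply: mmul; exact: lower_approx_continuous.
  - by move=> n y; apply: mul01; exact: lower_approx_itv.
  - move=> y; apply: cvgM; last exact: cvg_cst.
    by rewrite UE; exact: lower_approx_cvg.
pose P0 : probability (borel Y) R := dirac (point : borel Y).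
exists (fun x => if x \in G then k x else P0); split; last first.
  apply: (ae_of_null mM) => // x Mx Dx.
  by rewrite mem_set.
apply: (pkernelS (lower_sets_generate cc ms rc cK)); first exact: lower_sets_setI.
move=> U cU; rewrite -(setUv G); apply/measurable_funU => //; first exact: measurableC.
split.
  apply: (eq_measurable_fun (fun x => k x U)); last exact: mkU.
  by move=> x ->.
apply: (eq_measurable_fun (fun=> P0 U)); last exact: measurable_cst.
by move=> x /set_mem xG; rewrite memNset.
Qed.

End regularization.

Section iterated.
Context (R : realType) d1 d2 (X : measurableType d1) (Y : measurableType d2).
Context (M : {measure set (X * Y)%type -> \bar R}) (m1 : {measure set X -> \bar R})
  (k : X -> probability Y R).
Hypothesis dM : disintegrates M m1 k.

Lemma disintegrates_xsection A : measurable A -> M A = (\int[m1]_x k x (xsection A x))%E.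
Proof.
move=> mA; rewrite -(integral_indicT M mA) dM.2; last 2 first.
- exact: measurable_EFin_indic.
- by move=> p; rewrite lee_fin.
apply: eq_integral => x _; rewrite -integral_indicT; last exact: measurable_xsection.
apply: eq_integral => xi _; rewrite !indicE; congr ((nat_of_bool _)%:R%:E).
by rewrite mem_xsection.
Qed.

Lemma ae_sections (P : X * Y -> Prop) : {ae M, forall p, P p} ->
  {ae m1, forall x, {ae k x, forall y, P (x, y)}}.
Proof.
move=> [N [mN N0 NP]].
have mf : measurable_fun setT (fun x => k x (xsection N x)).
  rewrite (_ : (fun x => _) = fun x => \int[k x]_y (\1_N (x, y))%:E)%E.
    apply: (measurable_pkernel_integral dM.1 (f := fun p => (\1_N p)%:E)).
      exact: measurable_EFin_indic.
    by move=> p; rewrite lee_fin.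
  apply/funext => x; rewrite -integral_indicT; last exact: measurable_xsection.
  apply: eq_integral => xi _; rewrite !indicE; congr ((nat_of_bool _)%:R%:E).
  by rewrite mem_xsection.
have I0 : (\int[m1]_x `|k x (xsection N x)| = 0)%E.
  by rewrite -N0 disintegrates_xsection//; apply: eq_integral => x _; rewrite gee0_abs.
have [h _] := ae_eq_integral_abs m1 measurableT mf.
apply: ae_sub (h I0) => x /(_ I) kx.
apply: (ae_of_null (measurable_xsection x mN) kx) => y Ny.
by apply: contrapT => nP; apply: Ny; exact: (mem_set (NP _ nP)).
Qed.

Lemma ae_eq_iterated_Rintegral (D : set X) (F G : X * Y -> R) :
  {ae M, forall p, D p.1 -> F p = G p} ->
  \int[m1]_(x in D) \int[k x]_y F (x, y) = \int[m1]_(x in D) \int[k x]_y G (x, y).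
Proof.
move=> /ae_sections FG; apply: ae_eq_Rintegral; apply: ae_sub FG => x kx Dx.
by apply: ae_eq_Rintegral; apply: ae_sub kx => y /(_ Dx) ->.
Qed.

End iterated.

Section subset.
Context (R : realType) (d : nat) (E : normedModType R) (Omega : set 'rV[R]_d).
Hypothesis Ee : euclidean_space E.
Hypothesis Omega_open : open Omega.
Hypothesis Omega_bounded : bounded_set Omega.
Hypothesis Omega_frontier : lebesgue_rV d (frontier Omega) = 0%E.
Local Notation V := 'rV[R]_d.
Local Notation Z := (torus R d).
Local Notation W := (V * Z * E)%type.
Local Notation X := (borel V * borel Z)%type.
Local Notation K := (compactification E Omega).
Local Notation leb := (lebesgue_rV d \x (@torus_measure R d))%E.
Local Notation sphere := (frontier (@unit_ball R E)).
Local Open Scope ereal_scope.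

Let mclosure : measurable (closure Omega : set (borel V)).
Proof. by apply: measurable_closed; exact: closed_closure. Qed.

Let mslab : measurable (closure Omega `*` setT : set X).
Proof. exact: measurableX. Qed.

Lemma disintegrates_leb : disintegrates leb (lebesgue_rV d : {measure set (borel V) -> \bar R})
  (fun _ : borel V => @torus_measure R d : probability _ _).
Proof.
split; first by move=> U mU; exact: measurable_cst.
by move=> f mf f0; exact: fubini_tonelli1.
Qed.

Definition cutoff (j : nat) (z : E) : R := Num.max 0%R (Num.min 1%R (j.+1%:R - `|z|)%R).

Lemma cutoff_itv j z : (0 <= cutoff j z <= 1)%R.
Proof. by rewrite le_max lexx /= ge_max ler01 ge_min lexx. Qed.

Lemma cutoff_continuous j : continuous (cutoff j).
Proof.
move=> z; apply: (@continuous_max R E (fun=> 0%R)); first exact: cvg_cst.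
apply: (@continuous_min R E (fun=> 1%R)); first exact: cvg_cst.
by apply: cvgB; [exact: cvg_cst|exact: norm_continuous].
Qed.

Lemma cutoff_cvg z : cutoff j z @[j --> \oo] --> (1 : R)%R.
Proof.
apply: cvg_near_cst; have [n nz] : exists n : nat, (`|z| < n%:R)%R.
  by exists (Num.bound `|z|); exact: archi_boundP (normr_ge0 z).
exists n => // j /= nj.
have zj : (1 <= j.+1%:R - `|z|)%R.
  have : (n%:R <= j%:R :> R)%R by rewrite ler_nat.
  rewrite -natr1; move: nz; lra.
by rewrite /cutoff (min_l zj) max_r.
Qed.

Lemma vanishing_dense (h : E -> R) : continuous h -> (forall y, 0 <= h y <= 1)%R ->
  exists H : nat -> E -> R, forall j,
    [/\ vanishing_at_infinity (H j), continuous (H j), forall y, (0 <= H j y <= 1)%R &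
        forall y, H n y @[n --> \oo] --> h y].
Proof.
move=> hc h01; exists (fun j z => h z * cutoff j z)%R => j.
have Hc : continuous (fun z => h z * cutoff j z)%R.
  by move=> z; apply: cvgM; [exact: hc|exact: cutoff_continuous].
split => //.
- split => // e e0; exists j.+1%:R => z jz.
  rewrite /cutoff (_ : Num.max _ _ = 0%R) ?mulr0 ?normr0//.
  by apply/max_idPl; rewrite ge_min subr_le0 (ltW jz) orbT.
- move=> z; case/andP: (h01 z) => h0 h1; case/andP: (cutoff_itv j z) => c0 c1.
  by rewrite mulr_ge0//= mulr_ile1.
- move=> z; rewrite -[X in _ --> X]mulr1; apply: cvgM; first exact: cvg_cst.
  exact: cutoff_cvg.
Qed.

Lemma two_scale_regular nu : two_scale_young_measure Omega nu ->
  exists nu' : young_quadruple E, regular_quadruple Omega nu' /\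
    forall f, young_pairing Omega f nu = young_pairing Omega f nu'.
Proof.
move=> [[wo ofin] nc ws [wa angle]].
have self_dense (Y : ptopologicalType) (C : set (Y -> R)) :
    (forall h : Y -> R, continuous h -> C h) -> forall h : Y -> R, continuous h ->
    (forall y, 0 <= h y <= 1)%R -> exists H : nat -> Y -> R, forall j,
    [/\ C (H j), continuous (H j), forall y, (0 <= H j y <= 1)%R &
        forall y, H n y @[n --> \oo] --> h y].
  move=> CC h hc h01; exists (fun=> h) => j; split => //; first exact: CC.
  by move=> y; exact: cvg_cst.
have full (T : ptopologicalType) (P : probability (borel T) R) : P setT = 1.
  exact: probability_setT.
have [ko [mko koE]] := weakstar_regularize (mu := leb) (borel_retract_euclidean Ee)
  mslab measurableT vanishing_dense wo (ae_of_null measurable0 (measure0 _) (fun p _ _ => full _ _)).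
have [ks [mks ksE]] := weakstar_regularize (mu := conc nu) (borel_retract_torus R d)
  mclosure measurableT (self_dense _ _ (fun _ h => h)) ws
  (ae_of_null measurable0 (measure0 _) (fun p _ _ => full _ _)).
have [C CE] := pkernel_product mks (conc nu).
have dC : disintegrates C (conc nu) ks by [].
have conc_ae : {ae conc nu, forall x, closure Omega x}.
  apply: (ae_of_null (measurableC mclosure) nc).
  by move=> x; apply: contrapT.
have CVZ A : measurable A -> @conc_VZ R d E nu A = C A.
  move=> mA; rewrite (disintegrates_xsection dC mA).
  apply: ge0_ae_eq_integral_nomeas => //.
  have [N1 [mN1 N10 sub1]] := ksE; have [N2 [mN2 N20 sub2]] := conc_ae.
  apply: (ae_of_null (measurableU _ _ mN1 mN2)).
    by apply/eqP; rewrite eq_le measure_ge0 andbT -N10 -[leRHS]adde0 -N20 measureU2.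
  move=> x Nx; have Ox : closure Omega x.
    by apply: contrapT => h; apply: Nx; right; exact: sub2.
  rewrite -(_ : ks x = conc_scale nu x)//.
  by apply: contrapT => h; apply: Nx; left; apply: sub1 => /(_ Ox).
have CVZ_ae (P : X -> Prop) : {ae @conc_VZ R d E nu, forall p, P p} -> {ae C, forall p, P p}.
  by move=> [N [mN N0 sub]]; exists N; split => //; rewrite -CVZ.
have waC : weakstar_measurable C (closure Omega `*` setT : set X) sphere (continuous_on sphere)
    (fun p : X => conc_angle nu p.1 p.2).
  by move=> h hC; have [g mg ag] := wa h hC; exists g => //; exact: CVZ_ae.
have msph : measurable (sphere : set (borel E)).
  by apply: measurable_closed; exact: closed_sphere.
have angleC : {ae C, forall p : X, (closure Omega `*` setT : set X) p ->
    conc_angle nu p.1 p.2 sphere = 1} by exact: CVZ_ae.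
have sphere_dense := self_dense E (@continuous_on E R sphere) (fun h hc => continuous_subspaceT hc).
have [ka [mka kaE]] := weakstar_regularize (mu := C) (borel_retract_euclidean Ee)
  mslab msph sphere_dense waC angleC.
pose nu' : young_quadruple E := YoungQuadruple (fun x xi => ko (x, xi)) (conc nu) ks
  (fun x xi => ka (x, xi)).
have oscE (p : X) : osc nu' p.1 p.2 = ko p by case: p.
have angleE (p : X) : conc_angle nu' p.1 p.2 = ka p by case: p.
have mo : pkernel (fun p : X => osc nu' p.1 p.2).
  have -> : (fun p : X => osc nu' p.1 p.2) = ko by apply/funext => p; exact: oscE.
  exact: mko.
have ma : pkernel (fun p : X => conc_angle nu' p.1 p.2).
  have -> : (fun p : X => conc_angle nu' p.1 p.2) = ka by apply/funext => p; exact: angleE.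
  exact: mka.
exists nu'; split.
  split; [exact: mo|exact: mks|exact: ma|].
  apply: le_lt_trans _ ofin; rewrite -integral_closure_slab//; last first.
      by move=> p; exact: integral_ge0.
    rewrite le_eqVlt; apply/orP; left; apply/eqP; apply: ge0_ae_eq_integral_in.
    + by move=> p; exact: integral_ge0.
    + by move=> p; exact: integral_ge0.
    by apply: ae_sub koE => p h Dp; rewrite oscE (h Dp).
move=> f.
have osc_part : (\int[lebesgue_rV d]_(x in Omega) \int[torus_measure]_xi
    \int[osc nu x xi]_z f (x, xi, z) =
    \int[lebesgue_rV d]_(x in Omega) \int[torus_measure]_xi
    \int[osc nu' x xi]_z f (x, xi, z))%R.
  apply: (@ae_eq_iterated_Rintegral R _ _ _ _ _ _ _ disintegrates_leb Omega
    (fun p : X => \int[osc nu p.1 p.2]_z f (p.1, p.2, z))%R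
    (fun p : X => \int[osc nu' p.1 p.2]_z f (p.1, p.2, z))%R).
  apply: ae_sub koE => p h Op; rewrite oscE h//; split => //.
  exact: subset_closure.
have scale_part : (\int[conc nu]_(x in closure Omega) \int[conc_scale nu x]_xi
    \int[conc_angle nu x xi]_(z in sphere) recession Omega f (x, xi, z) =
    \int[conc nu]_(x in closure Omega) \int[ks x]_xi
    \int[conc_angle nu x xi]_(z in sphere) recession Omega f (x, xi, z))%R.
  by apply: ae_eq_Rintegral; apply: ae_sub ksE => x h Ox; rewrite h.
have angle_part : (\int[conc nu]_(x in closure Omega) \int[ks x]_xi
    \int[conc_angle nu x xi]_(z in sphere) recession Omega f (x, xi, z) =
    \int[conc nu]_(x in closure Omega) \int[ks x]_xi
    \int[conc_angle nu' x xi]_(z in sphere) recession Omega f (x, xi, z))%R.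
  apply: (@ae_eq_iterated_Rintegral R _ _ _ _ _ _ _ dC (closure Omega)
    (fun p : X => \int[conc_angle nu p.1 p.2]_(z in sphere) recession Omega f (p.1, p.2, z))%R
    (fun p : X => \int[conc_angle nu' p.1 p.2]_(z in sphere) recession Omega f (p.1, p.2, z))%R).
  apply: ae_sub kaE => p h Op.
  have Dp : (closure Omega `*` setT : set X) p by split.
  have e : conc_angle nu' p.1 p.2 = conc_angle nu p.1 p.2 := etrans (angleE p) (h Dp).
  exact: (congr1 (fun P : probability (borel E) R =>
    \int[P]_(z in sphere) recession Omega f (p.1, p.2, z))%R (esym e)).
exact: (f_equal2 (fun a b : R => (a + b)%R) osc_part (etrans scale_part angle_part)).
Qed.

Lemma two_scale_realizes nu : two_scale_young_measure Omega nu ->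
  exists m, @realizes R d E Omega nu m.
Proof.
move=> /two_scale_regular[nu' [rnu E']].
have [m [m0 mE]] := regular_realizes Ee Omega_open Omega_bounded rnu.
by exists m; split => // g gc; rewrite E' mE.
Qed.

End subset.

Lemma Rintegral_eq0 d (T : measurableType d) (R : realType) (m : {measure set T -> \bar R})
    (D : set T) (f : T -> R) : (forall x, D x -> f x = 0) -> \int[m]_(x in D) f x = 0.
Proof. by move=> f0; rewrite /Rintegral integral0_eq// => x Dx; rewrite f0. Qed.

Lemma continuous_compact_integrable (R : realType) (T : ptopologicalType)
    (m : {measure set (borel T) -> \bar R}) (D : set (borel T)) (A : set T) (f : T -> R) :
  measurable D -> measurable (A : set (borel T)) -> D `<=` A -> compact A ->
  {within A, continuous f} -> (m D < +oo)%E -> m.-integrable D (EFin \o f).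
Proof.
move=> mD mA DA cA fc Dfin; apply: measurable_bounded_integrable => //.
  exact: measurable_funS mA DA (within_continuous_measurable mA fc).
have [M [Mr MP]] : bounded_set (f @` A).
  by apply: compact_bounded; exact: continuous_compact.
exists M; split => // r Mr' x Dx; apply: MP Mr' _ _.
by exists x => //; exact: DA.
Qed.

Section moments.
Context (R : realType) (d : nat) (E : normedModType R) (Omega : set 'rV[R]_d).
Hypothesis Omega_open : open Omega.
Hypothesis Omega_bounded : bounded_set Omega.
Local Notation V := 'rV[R]_d.
Local Notation Z := (torus R d).
Local Notation W := (V * Z * E)%type.
Local Notation K := (compactification E Omega).
Context (phi : V -> R) (g : Z -> R).
Hypotheses (phic : {within closure Omega, continuous phi}) (gc : continuous g).

Let F (w : W) : R := phi w.1.1 * g w.1.2 * (1 - `|w.2|).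

Lemma moment_continuous : {within K, continuous F}.
Proof.
apply/subspace_continuousP => w Kw.
have Ow : closure Omega w.1.1 by move: Kw; rewrite compactificationE => -[].
have wK : id @ within K (nbhs w) --> nbhs w by exact: cvg_within.
apply: cvgM; first apply: cvgM.
- have h1 : (fun w : W => w.1.1) @ within K (nbhs w) --> within (closure Omega) (nbhs w.1.1).
    move=> A nA; change (nbhs w [set v | K v -> A v.1.1]).
    have nB : nbhs w [set v | closure Omega v.1.1 -> A v.1.1].
      exact: (@continuous_fst_fst V Z E w [set y | closure Omega y -> A y]).
    apply: (@filterS _ (nbhs w) _ _ _ _ nB) => v Av.
    by rewrite compactificationE => -[Ov _]; exact: Av.
  by apply: cvg_comp h1 _; move/subspace_continuousP : phic; exact.
- apply: cvg_trans (continuous_comp (@continuous_fst_snd V Z E w) (@gc w.1.2)).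
  exact: cvg_fmap2 wK.
- apply: cvgB; first exact: cvg_cst.
  apply: cvg_trans (continuous_comp (@continuous_snd (V * Z)%type E w) (@norm_continuous _ E w.2)).
  exact: cvg_fmap2 wK.
Qed.

Lemma S_map_moment x xi z : S_map F (x, xi, z) = phi x * g xi.
Proof.
have z0 : 1 + `|z| != 0 by rewrite gt_eqF// ltr_pwDl.
by rewrite /S_map /F /= norm_radial ?addr_ge0//; field.
Qed.

Lemma pairing_moment nu : young_pairing Omega (S_map F) nu =
  (\int[lebesgue_rV d]_(x in Omega) phi x) * (\int[torus_measure]_xi g xi).
Proof.
have conc0 : \int[conc nu]_(x in closure Omega) \int[conc_scale nu x]_xi
    \int[conc_angle nu x xi]_(z in frontier (@unit_ball R E))
      recession Omega (S_map F) (x, xi, z) = 0.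
  apply: Rintegral_eq0 => x Ox; apply: Rintegral_eq0 => xi _; apply: Rintegral_eq0 => z.
  rewrite frontier_unit_ball => z1.
  by rewrite (recession_S_map _ moment_continuous)// /F /= z1 subrr mulr0.
have ig : (@torus_measure R d).-integrable setT (EFin \o g).
  apply: (@continuous_compact_integrable R Z _ setT setT) => //.
  - exact: compact_torus.
  - exact: continuous_subspaceT.
  - by rewrite ltey_eq fin_num_measure.
have mOmega : measurable (Omega : set (borel V)) by exact: borel_open.
have iphi : (lebesgue_rV d).-integrable Omega (EFin \o phi).
  apply: (@continuous_compact_integrable R V _ Omega (closure Omega)) => //.
  - by apply: measurable_closed; exact: closed_closure.
  - exact: subset_closure.
  - exact: compact_closure_bounded.
  - exact: lebesgue_bounded.
rewrite /young_pairing conc0 addr0 -RintegralZr//; apply: eq_Rintegral => x _.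
rewrite -RintegralZl//; apply: eq_Rintegral => xi _.
transitivity (\int[osc nu x xi]_z (phi x * g xi)).
  by apply: eq_Rintegral => z _; exact: S_map_moment.
rewrite Rintegral_cst// [X in fine X](_ : _ = 1%E) ?mulr1//.
exact: probability_setT.
Qed.

End moments.

Theorem lemma3p5 (R : realType) (d : nat) (E : normedModType R)
    (E_euclidean : euclidean_space E)
    (Omega : set 'rV[R]_d) (Omega_open : open Omega)
    (Omega_bounded : bounded_set Omega)
    (Omega_frontier : lebesgue_rV d (frontier Omega) = 0%E) :
  Sstar_image E Omega =
  [set mu | positive_measures E Omega mu /\
    forall (phi : 'rV[R]_d -> R) (g : torus R d -> R),
      {within closure Omega, continuous phi} -> continuous g ->
      charge_integral mu (compactification E Omega)
        (fun p => phi p.1.1 * g p.1.2 * (1 - `|p.2|)) =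
      (\int[lebesgue_rV d]_(x in Omega) phi x) *
      (\int[torus_measure]_xi g xi)].
Proof.
apply/seteqP; split => [mu [nu nuY muE]|mu [[mu_supp mu_ge0] prop]].
  have [m rm] := two_scale_realizes E_euclidean Omega_open Omega_bounded Omega_frontier nuY.
  have [_ Sm] := Sstar_realizes E_euclidean rm; have [m0 mE] := rm.
  have mum A : measurable A -> mu A = m A by move=> mA; rewrite muE// Sm.
  split.
    split; first by move=> A mA KA; rewrite mum// m0.
    by move=> A mA; rewrite mum//; exact: measure_ge0.
  move=> phi g phic gc; rewrite (charge_integralE mum) mE.
    exact: pairing_moment.
  exact: moment_continuous.
have [p [n [mupn _ n0 _]]] := charge_integralP mu.
have mup A : measurable A -> mu A = p A by move=> mA; rewrite mupn// n0// sube0.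
have p_supp (A : set (borel ('rV[R]_d * torus R d * E)%type)) : measurable A -> compactification E Omega `&` A = set0 -> p A = 0%E.
  by move=> mA KA; rewrite -mup//; exact: mu_supp.
have [|nu [nuY rp]] := realizing_quadruple E_euclidean Omega_open Omega_bounded
    Omega_frontier p_supp.
  move=> phi g phic gc _ _; rewrite -(charge_integralE mup); apply: prop => //.
  exact: continuous_subspaceT.
exists nu => // A mA; have [_ Sp] := Sstar_realizes E_euclidean rp.
by rewrite Sp// mup.
Qed.
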